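(* Let $B$ be a finite Blaschke product with $N\ge2$ zeros counted with multiplicity, and let $\mathcal H$ be a Hilbert space. A unital representation $\pi:\mathcal A_B^0\to\mathcal B(\mathcal H)$ is completely contractive if and only if there is a unitary operator $U$ acting on a Hilbert space $\mathcal K\supset\mathcal H$ such that $$\pi(z^jB^i)=P_{\mathcal H}\,U^jB(U)^i|_{\mathcal H}$$ for $1\le i\le N-2$ and $0\le j\le i$, and for $i=N-1$ and $j=0,1,2,\dots$.
   Context: $A(\mathbb D)$ is the disk algebra, $\mathcal A_B=\mathbb C+B\,A(\mathbb D)$ with the supremum norm, and $\mathcal A_B^0$ is the closed unital subalgebra of $\mathcal A_B$ generated by $B$ and $zB$. $\mathcal B(\mathcal H)$ is the algebra of bounded operators on $\mathcal H$, $P_{\mathcal H}$ the orthogonal projection of $\mathcal K$ onto $\mathcal H$. Representations are bounded algebra homomorphisms. $\pi$ is completely contractive if for every $r\ge1$ the map $\mathrm{id}_{M_r}\otimes\pi$ on $M_r(\mathbb C)\otimes\mathcal A_B^0$ (with the supremum of the operator norm) is contractive. *)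

(* Defs.v *)
From HB Require Import structures.
From mathcomp Require Import all_boot all_order all_algebra.
From mathcomp Require Import complex.
From mathcomp Require Import all_classical all_reals all_analysis.

Set Implicit Arguments.
Unset Strict Implicit.
Unset Printing Implicit Defensive.

Import Order.TTheory GRing.Theory Num.Theory.
Import numFieldNormedType.Exports.

Local Open Scope classical_set_scope.
Local Open Scope ring_scope.

(* The inner product is linear in its first argument and conjugate-linear in
   the second. *)
HB.mixin Record CompleteNormedModule_isHilbert (R : realType) H
    of CompleteNormedModule R[i] H := {
  ip : {dot H for @Num.conj R[i]} ;
  ipE : forall x : H, ip x x = `|x| ^+ 2
}.

#[short(type="hilbertType")]
HB.structure Definition Hilbert (R : realType) :=
  {H of CompleteNormedModule_isHilbert R H & CompleteNormedModule R[i] H}.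

Section functions_on_the_disc.
Variable R : realType.
(* R[i] gets its norm topology through the numClosedFieldType instance. *)
Local Notation C := [the numClosedFieldType of R[i]].

Definition closed_disc : set C := [set z | `|z| <= 1].

(* Elements of the function algebras are represented by total functions
   R[i] -> R[i], of which only the values on the closed disc matter:
   disc_algebra, alg_B and alg_B0 are stable under changing the values of a
   function outside the closed disc. *)
Definition disc_algebra : set (C -> C) :=
  [set f | {within closed_disc, continuous f} /\
           forall z : C, `|z| < 1 -> derivable f z 1].

(* The norm of a normed space over R[i] takes values in R[i]. *)
Definition rnorm (V : normedModType C) (x : V) : R := complex.Re `|x|.

Definition sup_norm (f : C -> C) : \bar R :=
  ereal_sup [set (rnorm (f z))%:E | z in closed_disc].

Definition unital_subalgebra (S : set (C -> C)) : Prop :=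
  [/\ S (cst 1),
      forall f g, S f -> S g -> S (f \+ g),
      forall (c : C) f, S f -> S (fun z => c * f z) &
      forall f g, S f -> S g -> S (fun z => f z * g z)].

Definition sup_closed_in (A S : set (C -> C)) : Prop :=
  forall f, A f ->
    (forall e : R, 0 < e ->
       exists2 g, S g & (sup_norm (f \- g)%R < e%:E)%E) ->
    S f.

Definition alg_B (B : C -> C) : set (C -> C) :=
  [set f | exists (c : C) (g : C -> C), disc_algebra g /\
           forall z, closed_disc z -> f z = c + B z * g z].

Definition alg_B0 (B : C -> C) : set (C -> C) :=
  [set f | forall S : set (C -> C),
     S `<=` alg_B B -> unital_subalgebra S -> sup_closed_in (alg_B B) S ->
     S B -> S (fun z => z * B z) -> S f].

Definition blaschke (N : nat) (c : C) (a : 'I_N -> C) (z : C) : C :=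
  c * \prod_(k < N) ((z - a k) / (1 - (a k)^* * z)).

End functions_on_the_disc.

Section operators.
Variable R : realType.
Local Notation C := [the numClosedFieldType of R[i]].

Definition op_norm_for (E : Type) (nu : E -> R) (T : E -> E) : \bar R :=
  ereal_sup [set (nu (T x))%:E | x in [set x | nu x <= 1]].

Definition op_norm (V : normedModType C) (T : V -> V) : \bar R :=
  op_norm_for (@rnorm R V) T.

Definition bounded_operator (V : normedModType C) (T : V -> V) : Prop :=
  linear T /\ (op_norm T < +oo)%E.

Definition l2norm (V : normedModType C) (r : nat) (x : 'I_r -> V) : R :=
  Num.sqrt (\sum_(i < r) rnorm (x i) ^+ 2).

Definition op_mx_act (V : normedModType C) (r : nat) (T : 'M[V -> V]_r)
    (x : 'I_r -> V) : 'I_r -> V :=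
  fun i => \sum_(j < r) T i j (x j).

(* The norm of an operator matrix on the Hilbert direct sum of r copies of V *)
Definition op_mx_norm (V : normedModType C) (r : nat) (T : 'M[V -> V]_r)
    : \bar R :=
  op_norm_for (@l2norm V r) (op_mx_act T).

(* A scalar matrix acts on C^r through multiplication by its entries. *)
Definition mx_op_norm (r : nat) (M : 'M[C]_r) : \bar R :=
  op_mx_norm (map_mx (fun m : C => (fun x : C => m * x)) M).

Definition mx_sup_norm (r : nat) (F : 'M[C -> C]_r) : \bar R :=
  ereal_sup [set mx_op_norm (map_mx (fun f => f z) F) | z in @closed_disc R].

(* Boundedness forces pi f = pi g when f and g agree on the closed disc; the
   values of pi outside A are irrelevant. *)
Record unital_representation (A : set (C -> C)) (H : hilbertType R)
    (pi : (C -> C) -> H -> H) : Prop := UnitalRepresentation {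
  repr_bounded_operator : forall f, A f -> bounded_operator (pi f) ;
  repr_add : forall f g, A f -> A g -> pi (f \+ g) = pi f \+ pi g ;
  repr_scale : forall (c : C) f, A f ->
    pi (fun z => c * f z) = (fun h => c *: pi f h) ;
  repr_mul : forall f g, A f -> A g ->
    pi (fun z => f z * g z) = pi f \o pi g ;
  repr_one : pi (cst 1) = idfun ;
  repr_bounded : exists M : R, forall f, A f ->
    (op_norm (pi f) <= M%:E * sup_norm f)%E
}.

Definition completely_contractive (A : set (C -> C)) (H : hilbertType R)
    (pi : (C -> C) -> H -> H) : Prop :=
  forall (r : nat) (F : 'M[C -> C]_r), (1 <= r)%N ->
    (forall i j, A (F i j)) -> (op_mx_norm (map_mx pi F) <= mx_sup_norm F)%E.

Definition isometric_embedding (H K : hilbertType R) (J : H -> K) : Prop :=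
  linear J /\ forall x y, ip (J x) (J y) = ip x y.

Definition adjoint (H : hilbertType R) (T T' : H -> H) : Prop :=
  forall x y, ip (T x) y = ip x (T' y).

Definition unitary (K : hilbertType R) (U : K -> K) : Prop :=
  bounded_operator U /\
  exists U' : K -> K,
    [/\ bounded_operator U', adjoint U U', U' \o U = idfun & U \o U' = idfun].

(* The orthogonal projection of x onto M; meaningful when M is a closed
   subspace *)
Definition orth_proj (K : hilbertType R) (M : set K) (x : K) : K :=
  xget 0 [set p | M p /\ forall m, M m -> ip (x - p) m = 0].

(* The inverse operator; meaningful when T is bijective *)
Definition op_inv (K : hilbertType R) (T : K -> K) (y : K) : K :=
  xget 0 [set x | T x = y].

(* B(T) by the rational functional calculus
     B(T) = c prod_k (T - a_k I) (I - conj(a_k) T)^-1,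
   for |a_k| < 1 and T a contraction, so that the inverses exist; the factors
   commute. *)
Definition blaschke_op (N : nat) (c : C) (a : 'I_N -> C) (K : hilbertType R)
    (T : K -> K) : K -> K :=
  fun x => c *:
    (\big[(fun S1 S2 : K -> K => S1 \o S2)/idfun]_(k < N)
      ((fun y => T y - a k *: y) \o op_inv (fun y => y - (a k)^* *: T y))) x.

End operators.

(* Main.v *)
From HB Require Import structures.
Require Import Defs.
From mathcomp Require Import all_boot all_order all_algebra.
From mathcomp Require Import complex.
From mathcomp Require Import ring lra.
From mathcomp Require Import cyclic separable cyclotomic.
From mathcomp Require Import all_classical all_reals all_analysis.

(** Write [B = P / Q] with polynomials [P] and [Q], where the zeros of [Q] lie
outside the closed disc.  Everything takes place on the linear span of the
functions [z^j B^i] with [j <= i <= N - 2] or [i = N - 1], which is dense in the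
algebra ([alg_B0_dense]).  It contains the generators.  Cancelling the top
coefficient in [P = B Q] expresses [z^N (c - q B)], where [|q| < 1 = |c|],
through lower powers of [z] with coefficients in the algebra; since [c - q B] is
inverted by a geometric series, all [z^j B^(N-1)] belong to the algebra
([alg_B0_mono_top]).  Higher powers [B^(N-1+k)] are replaced by [B^(N-1)] times a
polynomial in [z] close to [B^k].  The exponents of the theorem are those of the
span, except [i = j = 0], which is the unit.

From a dilation to complete contractivity.  For [f] in the span, [pi f] is the
compression of the rational function [f] of [U] ([span_compression]).  For a
matrix of such functions a von Neumann inequality is needed
([unitary_matrix_bound]): if [|P(z) v| <= s |q(z)| |v|] on the unit circle for a
matrix [P] of polynomials and a polynomial [q], then
[|P(U) y| <= s |q(U) y|].  It is proved without spectral theory: the truncated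
orbits [sum_k z^k U^-k y] are approximate eigenvectors of [U] for the eigenvalue
[z], and a discrete Parseval identity averages the scalar inequality over roots
of unity.  Density and the boundedness of [pi] extend the estimate from the span
to the algebra.

From complete contractivity to a dilation.  Comparing the norm of [1 - t F] with
[1 + O(t^2)] as [t] tends to 0, and using the maximum modulus principle to work
on the circle only, complete contractivity makes [pi] completely positive on the
span ([matrix_positivity]).  Equivalently, the functional
[sum f |h><k| |-> sum <pi f h, k>] on functions with values in the finite rank
operators is positive ([tensor_positivity]).  A Hahn-Banach argument extends it
to a positive functional [phi] on all bounded functions on the circle with
values in the finite rank operators ([positive_functional_exists]).  Then
[<u, v> = phi(|u><v|)] is a positive semidefinite form on the bounded functions
[u], [v] from the circle to finite dimensional subspaces of [H], and its Hilbert
space completion carries the dilation ([dilation_exists]): [J h] is the constant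
function [h] and [U] is multiplication by [z], so that [B(U)] is multiplication
by [B] and [<U^j B(U)^i J h, J k> = <pi (z^j B^i) h, k>]. *)

Set Implicit Arguments.
Unset Strict Implicit.
Unset Printing Implicit Defensive.
Import Order.TTheory GRing.Theory Num.Theory.
Import numFieldNormedType.Exports.
Local Open Scope classical_set_scope.
Local Open Scope ring_scope.

Local Notation Re := (@complex.Re _).
Local Notation Im := (@complex.Im _).
Local Notation "x %:C" := (real_complex _ x) : ring_scope.

Section linear_functions.
Variables (K : pzRingType) (U V : lmodType K) (f : U -> V).
Hypothesis fL : linear f.

Lemma linear_fun0 : f 0 = 0.
Proof.
by have /eqP := fL 1 0 0; rewrite scaler0 add0r scale1r eq_sym -subr_eq0 addrK => /eqP.
Qed.

Lemma linear_funD x y : f (x + y) = f x + f y.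
Proof. by rewrite -[x]scale1r fL !scale1r. Qed.

Lemma linear_funZ d x : f (d *: x) = d *: f x.
Proof. by rewrite -[d *: x]addr0 fL linear_fun0 addr0. Qed.

Lemma linear_funB x y : f (x - y) = f x - f y.
Proof. by rewrite linear_funD -scaleN1r linear_funZ scaleN1r. Qed.

Lemma linear_fun_sum I (r : seq I) (P : pred I) (F : I -> U) :
  f (\sum_(i <- r | P i) F i) = \sum_(i <- r | P i) f (F i).
Proof. exact: (big_morph f linear_funD linear_fun0). Qed.

End linear_functions.

(** * Moduli and positive semidefinite forms *)

Section modulus.
Variable R : realType.
Local Notation C := [the numClosedFieldType of R[i]].

Lemma ReD (x y : C) : Re (x + y) = Re x + Re y.
Proof. by case: x => ? ?; case: y. Qed.

Lemma ReN (x : C) : Re (- x) = - Re x.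
Proof. by case: x. Qed.

Lemma ReB (x y : C) : Re (x - y) = Re x - Re y.
Proof. by rewrite ReD ReN. Qed.

Lemma Re_sum I (s : seq I) (P : pred I) (F : I -> C) :
  Re (\sum_(i <- s | P i) F i) = \sum_(i <- s | P i) Re (F i).
Proof. exact: (big_morph Re ReD). Qed.

Lemma ReZ (t : R) (x : C) : Re (t%:C * x) = t * Re x.
Proof. by case: x => u v /=; rewrite mul0r subr0. Qed.

Lemma Re_conj (x : C) : Re (x^*) = Re x.
Proof. by case: x. Qed.

Lemma le_Re (x y : C) : x <= y -> Re x <= Re y.
Proof. by rewrite lecE => /andP[]. Qed.

Lemma real_complex_Re (x : C) : 0 <= x -> x = (Re x)%:C.
Proof. by case: x => u v; rewrite lecE /= => /andP[/eqP -> _]. Qed.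

Section normed_module.
Variable V : normedModType C.
Implicit Types x y : V.

Lemma normE x : `|x| = (rnorm x)%:C.
Proof. by rewrite [LHS]real_complex_Re. Qed.

Lemma rnorm_ge0 x : 0 <= rnorm x.
Proof. exact: le_Re (normr_ge0 x). Qed.

Lemma rnormD x y : rnorm (x + y) <= rnorm x + rnorm y.
Proof. by rewrite /rnorm -ReD; exact: le_Re (ler_normD x y). Qed.

Lemma rnormN x : rnorm (- x) = rnorm x.
Proof. by rewrite /rnorm normrN. Qed.

Lemma rnormB x y : rnorm (x - y) = rnorm (y - x).
Proof. by rewrite -rnormN opprB. Qed.

Lemma rnorm0 : rnorm (0 : V) = 0.
Proof. by rewrite /rnorm normr0. Qed.

Lemma rnorm0_eq0 x : rnorm x = 0 -> x = 0.
Proof. by move=> x0; apply/eqP; rewrite -normr_eq0 normE x0. Qed.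

Lemma rnorm_sum I (s : seq I) (P : pred I) (F : I -> V) :
  rnorm (\sum_(i <- s | P i) F i) <= \sum_(i <- s | P i) rnorm (F i).
Proof.
elim/big_rec2: _ => [|i y1 y2 _ IH]; first by rewrite rnorm0.
by apply: le_trans (rnormD _ _) _; rewrite lerD2l.
Qed.

Lemma rnormZ (a : C) x : rnorm (a *: x) = rnorm a * rnorm x.
Proof.
by rewrite /rnorm normrZ (real_complex_Re (normr_ge0 a)) ReZ.
Qed.
End normed_module.

Lemma rnormM (a b : C) : rnorm (a * b) = rnorm a * rnorm b.
Proof. exact: rnormZ. Qed.

Lemma rnorm1 : rnorm (1 : C) = 1.
Proof. by rewrite /rnorm normr1. Qed.

Lemma rnormX (a : C) n : rnorm (a ^+ n) = rnorm a ^+ n.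
Proof. by elim: n => [|n IH]; rewrite ?expr0 ?rnorm1// !exprS rnormM IH. Qed.

Lemma rnorm_conj (a : C) : rnorm (a^*) = rnorm a.
Proof. by rewrite /rnorm norm_conjC. Qed.

Lemma rnorm_real (t : R) : rnorm (t%:C : C) = `|t|.
Proof.
by rewrite /rnorm normc_def /= expr0n addr0 sqrtr_sqr.
Qed.

Lemma Re_le_rnorm (a : C) : Re a <= rnorm a.
Proof. by apply: le_trans (ler_norm _) _; rewrite -lecR -normE normc_ge_Re. Qed.

Lemma mul_conj (a : C) : a * a^* = (rnorm a ^+ 2)%:C.
Proof. by rewrite -normCK normE rmorphXn. Qed.

Lemma rnormV (a : C) : rnorm a^-1 = (rnorm a)^-1.
Proof. by apply: complexI; rewrite fmorphV -!normE normfV. Qed.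

Lemma rnorm_eq1 (a : C) : (`|a| = 1) <-> (rnorm a = 1).
Proof. by rewrite normE; split=> [/complexI|->]. Qed.

Lemma norm_le1 (a : C) : (`|a| <= 1) = (rnorm a <= 1).
Proof. by rewrite normE -(@lecR R _ 1). Qed.

Lemma norm_lt1 (a : C) : (`|a| < 1) = (rnorm a < 1).
Proof. by rewrite normE -(@ltcR R _ 1). Qed.

End modulus.

Section semi_inner.
Variable R : realType.
Local Notation C := [the numClosedFieldType of R[i]].

Record semi_inner (X : lmodType C) (s : X -> X -> C) : Prop := SemiInner {
  si_linear : forall (c : C) x y z, s (c *: x + y) z = c * s x z + s y z ;
  si_conj : forall x y, s y x = (s x y)^* ;
  si_ge0 : forall x, 0 <= s x x }.

Definition sinorm (X : lmodType C) (s : X -> X -> C) (x : X) : R :=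
  Num.sqrt (Re (s x x)).

Section theory.
Variables (X : lmodType C) (s : X -> X -> C).
Hypothesis hs : semi_inner s.
Implicit Types x y z : X.
Local Notation n := (sinorm s).

Lemma siDl x y z : s (x + y) z = s x z + s y z.
Proof. by rewrite -(scale1r x) si_linear// mul1r scale1r. Qed.

Lemma si0l z : s 0 z = 0.
Proof. by apply: (addrI (s 0 z)); rewrite -siDl !addr0. Qed.

Lemma siZl c x z : s (c *: x) z = c * s x z.
Proof. by rewrite -(addr0 (c *: x)) si_linear// si0l addr0. Qed.

Lemma siNl x z : s (- x) z = - s x z.
Proof. by rewrite -scaleN1r siZl mulN1r. Qed.

Lemma siBl x y z : s (x - y) z = s x z - s y z.
Proof. by rewrite siDl siNl. Qed.

Lemma siDr x y z : s x (y + z) = s x y + s x z.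
Proof. by rewrite si_conj// siDl rmorphD/= -!(si_conj hs). Qed.

Lemma si0r z : s z 0 = 0.
Proof. by rewrite si_conj// si0l rmorph0. Qed.

Lemma siZr c x z : s x (c *: z) = c^* * s x z.
Proof. by rewrite si_conj// siZl rmorphM/= -(si_conj hs). Qed.

Lemma siNr x z : s x (- z) = - s x z.
Proof. by rewrite si_conj// siNl rmorphN/= -(si_conj hs). Qed.

Lemma siBr x y z : s x (y - z) = s x y - s x z.
Proof. by rewrite siDr siNr. Qed.

Lemma si_suml I (r : seq I) (P : pred I) (F : I -> X) z :
  s (\sum_(i <- r | P i) F i) z = \sum_(i <- r | P i) s (F i) z.
Proof. exact: (big_morph (s^~ z) (fun x y => siDl x y z) (si0l z)). Qed.

Lemma si_sumr I (r : seq I) (P : pred I) (F : I -> X) z :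
  s z (\sum_(i <- r | P i) F i) = \sum_(i <- r | P i) s z (F i).
Proof. exact: (big_morph (s z) (siDr z) (si0r z)). Qed.

Lemma sinorm_ge0 x : 0 <= n x.
Proof. exact: sqrtr_ge0. Qed.

Lemma sinorm_sqr x : n x ^+ 2 = Re (s x x).
Proof. by rewrite sqr_sqrtr//; exact: le_Re (si_ge0 hs x). Qed.

Lemma si_self x : s x x = (n x ^+ 2)%:C.
Proof. by rewrite sinorm_sqr; exact/real_complex_Re/si_ge0. Qed.

Lemma sinormD_sqr x y :
  n (x + y) ^+ 2 = n x ^+ 2 + Re (s x y) *+ 2 + n y ^+ 2.
Proof.
rewrite !sinorm_sqr siDl !siDr !ReD (si_conj hs x y) Re_conj; ring.
Qed.

Lemma sinormZ c x : n (c *: x) = rnorm c * n x.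
Proof.
apply/eqP; rewrite -(@eqrXn2 _ 2)// ?mulr_ge0 ?sinorm_ge0 ?rnorm_ge0//.
rewrite exprMn !sinorm_sqr siZl siZr mulrA mul_conj ReZ//.
Qed.

Lemma sinormN x : n (- x) = n x.
Proof. by rewrite /sinorm siNl siNr opprK. Qed.

(** For real [t], the square of the seminorm of [y - t (s x y)^* x] is a
quadratic polynomial in [t] that is nonnegative everywhere. *)
Lemma cauchy_schwarz x y : rnorm (s x y) <= n x * n y.
Proof.
have H (t : R) : 0 <= t ^+ 2 * (rnorm (s x y) ^+ 2 * n x ^+ 2)
    - t * rnorm (s x y) ^+ 2 *+ 2 + n y ^+ 2.
  suff -> : t ^+ 2 * (rnorm (s x y) ^+ 2 * n x ^+ 2)
    - t * rnorm (s x y) ^+ 2 *+ 2 + n y ^+ 2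
    = n ((- t%:C * (s x y)^*) *: x + y) ^+ 2 by exact: sqr_ge0.
  rewrite sinormD_sqr sinormZ rnormM rnormN rnorm_conj rnorm_real siZl.
  have -> : - t%:C * (s x y)^* * s x y = (- t)%:C * (s x y * (s x y)^*).
    by rewrite rmorphN; ring.
  rewrite mul_conj ReZ /= exprMn.
  rewrite exprMn real_normK ?num_real//; ring.
rewrite -(@ler_pXn2r _ 2) ?nnegrE ?mulr_ge0 ?sinorm_ge0 ?rnorm_ge0//.
rewrite exprMn.
have p0 := rnorm_ge0 (s x y); have x0 := sinorm_ge0 x; have y0 := sinorm_ge0 y.
set p := rnorm _ in H p0 *; set a := n x in H x0 *; set b := n y in H y0 *.
have [a0|a0] := eqVneq a 0.
  (* The polynomial is affine, so a large [t] makes it negative. *)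
  have [->|pn0] := eqVneq p 0; first by rewrite a0 expr0n mul0r.
  have := H ((b ^+ 2 + 1) / p ^+ 2); rewrite a0 expr0n /= !mulr0 sub0r divfK ?expf_neq0//.
  by move=> ?; have := sqr_ge0 b; lra.
have a2 : 0 < a ^+ 2 by rewrite exprn_gt0// lt_def a0.
have := mulr_ge0 (ltW a2) (H (a ^- 2)).
have -> : a ^+ 2 * ((a ^- 2) ^+ 2 * (p ^+ 2 * a ^+ 2) - a ^- 2 * p ^+ 2 *+ 2 + b ^+ 2)
  = a ^+ 2 * b ^+ 2 - p ^+ 2 by field.
by rewrite subr_ge0.
Qed.

Lemma sinormD x y : n (x + y) <= n x + n y.
Proof.
rewrite -(@ler_pXn2r _ 2) ?nnegrE ?addr_ge0 ?sinorm_ge0//.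
rewrite sinormD_sqr sqrrD lerD2r lerD2l ler_pMn2r//.
exact: le_trans (Re_le_rnorm _) (cauchy_schwarz x y).
Qed.

Lemma sinorm_parallelogram x y :
  n (x + y) ^+ 2 + n (x - y) ^+ 2 = (n x ^+ 2 + n y ^+ 2) *+ 2.
Proof.
rewrite !sinormD_sqr sinormN siNr ReN; ring.
Qed.

(** The remainder of a vector after projection may be nonzero and yet have
seminorm 0; then it does not enter [e], so expansions hold only under [s]. *)
Lemma gram_schmidt (xs : seq X) : exists m (e : 'I_m -> X),
  (forall i j, s (e i) (e j) = (i == j)%:R) /\
  forall x, x \in xs -> forall y, s x y = \sum_(i < m) s x (e i) * s (e i) y.
Proof.
elim: xs => [|x0 xs [m [e [ort ex]]]].
  by exists 0%N, (fun=> 0); split=> [[]|x].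
pose r := x0 - \sum_(i < m) s x0 (e i) *: e i.
have re j : s r (e j) = 0.
  rewrite siBl si_suml (bigD1 j)//= siZl ort eqxx mulr1 big1 ?addr0 ?subrr//.
  by move=> i ij; rewrite siZl ort (negPf ij) mulr0.
have x0E y : s x0 y = \sum_(i < m) s x0 (e i) * s (e i) y + s r y.
  rewrite siBl si_suml addrC -addrA; under [X in - X + _]eq_bigr do rewrite siZl.
  by rewrite addNr addr0.
have [r0|r0] := eqVneq (n r) 0.
  exists m, e; split => // x; rewrite inE => /orP[/eqP ->|/ex//] y.
  rewrite x0E; have : rnorm (s r y) <= n r * n y by exact: cauchy_schwarz.
  rewrite r0 mul0r => h; suff -> : s r y = 0 by rewrite addr0.
  by apply: rnorm0_eq0; apply/eqP; rewrite eq_le h rnorm_ge0.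
pose f := (n r)^-1%:C *: r.
have fe j : s f (e j) = 0 by rewrite siZl re mulr0.
have ef j : s (e j) f = 0 by rewrite si_conj// fe rmorph0.
have rn : s r r = (n r ^+ 2)%:C by exact: si_self.
have cj (t : R) : (t%:C : C)^* = t%:C by exact: conjc_real.
have ff : s f f = 1.
  rewrite siZl siZr rn cj -!rmorphM /=.
  by rewrite (_ : _ * _ = 1) ?rmorph1//; field.
exists m.+1, (fun i => oapp e f (unlift ord0 i)); split.
  move=> i j; case: unliftP => [i'|] ->; case: unliftP => [j'|] -> //=.
have last_term x y : s x y = \sum_(i < m) s x (e i) * s (e i) y + s x f * s f y ->
   s x y = \sum_(i < m.+1) s x (oapp e f (unlift ord0 i))
                     * s (oapp e f (unlift ord0 i)) y.
  move=> ->; rewrite big_ord_recl unlift_none /= addrC; congr (_ + _).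
  by apply: eq_bigr => i _; rewrite liftK.
move=> x; rewrite inE => /orP[/eqP ->|/ex xE] y; apply: last_term.
  rewrite {1}x0E; congr (_ + _).
  have -> : s x0 f = s r f.
    by rewrite x0E big1 ?add0r// => i _; rewrite ef mulr0.
  rewrite /f siZr siZl rn cj.
  have -> : (n r ^+ 2)%:C = (n r)%:C * (n r)%:C :> C by rewrite -rmorphM.
  by rewrite fmorphV; field; rewrite fmorph_eq0.
rewrite {1}xE (_ : s x f = 0) ?mul0r ?addr0//.
by rewrite xE big1// => i _; rewrite ef mulr0.
Qed.

End theory.

Lemma ip_semi_inner (H : hilbertType R) : semi_inner (@ip R H).
Proof.
split=> [a x y z|x y|x].
- by rewrite linearDl/= linearZl.
- by rewrite [LHS]hermC expr0 mul1r.
- by rewrite ipE exprn_ge0.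
Qed.

Lemma sinorm_ip (H : hilbertType R) (x : H) : sinorm (@ip R H) x = rnorm x.
Proof.
by rewrite /sinorm ipE normE -rmorphXn/= sqrtr_sqr ger0_norm// rnorm_ge0.
Qed.

Lemma ip_self (H : hilbertType R) (x : H) : ip x x = (rnorm x ^+ 2)%:C.
Proof. by rewrite -sinorm_ip; exact/si_self/ip_semi_inner. Qed.

End semi_inner.

(** * Hilbert space completion *)

Section limits.
Variable R : realType.
Local Notation C := [the numClosedFieldType of R[i]].

Lemma rnorm_cvgP (V : normedModType C) (T : Type) (F : set_system T)
    (FF : Filter F) (f : T -> V) (l : V) :
  f @ F --> l <-> forall e : R, 0 < e -> \forall x \near F, rnorm (f x - l) <= e.
Proof.
split=> [/cvgrPdist_le fl e e0|fl].
  have /fl : (0 : C) < e%:C by rewrite -(@ltcR R 0) in e0.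
  by apply: filterS => x; rewrite distrC => /le_Re.
apply/cvgrPdist_le => e e0.
have [e' e'0 ->] : exists2 e' : R, 0 < e' & e = e'%:C.
  by exists (Re e); rewrite -?(@ltcR R 0) -?real_complex_Re// ltW.
by have := fl _ e'0; apply: filterS => x; rewrite distrC normE lecR.
Qed.

Lemma rnorm_cvg_le (V : normedModType C) (T : Type) (F : set_system T)
    (FF : ProperFilter F) (f : T -> V) (l z : V) (r : R) :
  f @ F --> l -> (\forall x \near F, rnorm (f x - z) <= r) -> rnorm (l - z) <= r.
Proof.
move=> /rnorm_cvgP fl fz; apply/ler_addgt0Pr => e e0.
have [x [h1 h2]] := @filter_ex _ F _ _ (filterI (fl _ e0) fz).
rewrite -(subrKA (f x)) addrC; apply: le_trans (rnormD _ _) _.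
by rewrite lerD// rnormB.
Qed.

Lemma rnorm_cvg_unique (V : normedModType C) (T : Type) (F : set_system T)
    (FF : ProperFilter F) (f : T -> V) (l l' : V) :
  f @ F --> l -> f @ F --> l' -> l = l'.
Proof.
move=> fl /rnorm_cvgP fl'; apply/eqP; rewrite -subr_eq0; apply/eqP/rnorm0_eq0.
apply/eqP; rewrite eq_le rnorm_ge0 andbT; apply/ler_addgt0Pr => e e0.
by rewrite add0r; apply: rnorm_cvg_le fl _; exact: fl'.
Qed.

Lemma rnorm_Re_Im (z : C) : rnorm z <= `|Re z| + `|Im z|.
Proof.
rewrite /rnorm normc_def /= -(@ler_pXn2r _ 2) ?nnegrE ?sqrtr_ge0 ?addr_ge0//.
rewrite sqr_sqrtr ?addr_ge0 ?sqr_ge0// -(real_normK (num_real (Re z))).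
rewrite -(real_normK (num_real (Im z))).
have := normr_ge0 (Re z); have := normr_ge0 (Im z).
move: `|Re z| `|Im z| => u v; nra.
Qed.

Lemma Re_Im_le (z : C) : `|Re z| <= rnorm z /\ `|Im z| <= rnorm z.
Proof.
rewrite /rnorm normc_def /=; split.
  rewrite -(sqrtr_sqr (Re z)) ler_wsqrtr// lerDl sqr_ge0//.
by rewrite -(sqrtr_sqr (Im z)) ler_wsqrtr// lerDr sqr_ge0.
Qed.

Lemma complex_complete (T : Type) (F : set_system T) (FF : ProperFilter F)
    (f : T -> C) :
  (forall e : R, 0 < e -> exists z, \forall x \near F, rnorm (f x - z) <= e) ->
  cvg (f @ F).
Proof.
move=> fF.
have H (g : C -> R) : (forall x y, `|g x - g y| <= rnorm (x - y)) ->
    cvg ((g \o f) @ F).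
  move=> gE; apply: (@R_complete R); apply: cauchy_exP => e e0.
  have [|z fz] := fF (e / 2); first by rewrite divr_gt0.
  exists (g z); rewrite /fmap /=; near_simpl.
  apply: filterS fz => x fxz; rewrite -ball_normE /=.
  rewrite distrC (le_lt_trans (gE _ _))// (le_lt_trans fxz)//; lra.
have ReE (x y : C) : `|Re x - Re y| <= rnorm (x - y).
  by rewrite -ReB; case: (Re_Im_le (x - y)).
have ImE (x y : C) : `|Im x - Im y| <= rnorm (x - y).
  have -> : Im x - Im y = Im (x - y) by case: x => ? ?; case: y.
  by case: (Re_Im_le (x - y)).
have /cvg_ex[u /= fu] := H Re ReE; have /cvg_ex[v /= fv] := H Im ImE.
apply: (cvgP (Complex u v : C)); apply/rnorm_cvgP => e e0.
have e20 : 0 < e / 2 by rewrite divr_gt0.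
move/cvgrPdist_le: fu => /(_ _ e20) fu; move/cvgrPdist_le: fv => /(_ _ e20) fv.
near=> x.
apply: le_trans (rnorm_Re_Im _) _.
have -> : Re (f x - Complex u v) = Re (f x) - u by case: (f x).
have -> : Im (f x - Complex u v) = Im (f x) - v by case: (f x).
rewrite [leRHS](splitr e) lerD// distrC; near: x; [exact: fu|exact: fv].
Unshelve. all: by end_near. Qed.

End limits.

Section completion.
Variable R : realType.
Local Notation C := [the numClosedFieldType of R[i]].
Variables (X : lmodType C) (s : X -> X -> C).
Local Notation n := (sinorm s).

Definition represented_limit : {pred X -> C} := fun phi =>
  `[< forall e : R, 0 < e ->
        exists x, forall y, rnorm (phi y - s x y) <= e * n y >].

(** A point of the completion is the functional [y |-> <point, y>], a limit of
the functionals [s x].  This needs neither a quotient by the vectors of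
seminorm 0 nor equivalence classes of Cauchy sequences. *)
Record completion (hs : semi_inner s) := Completion {
  functional : X -> C ;
  _ : functional \in represented_limit }.

Hypothesis hs : semi_inner s.
Local Notation K := (completion hs).

HB.instance Definition _ := [isSub for @functional hs].
HB.instance Definition _ := [Choice of K by <:].

Lemma represented (x : X) : s x \in represented_limit.
Proof.
apply/asboolP => e e0; exists x => y.
by rewrite subrr rnorm0 mulr_ge0 ?sinorm_ge0// ltW.
Qed.

Lemma represented_limit_submod : submod_closed represented_limit.
Proof.
split=> [|c f g /asboolP hf /asboolP hg].
  by apply/asboolP => e e0; exists 0 => y; rewrite si0l// subr0 rnorm0
    mulr_ge0 ?sinorm_ge0// ltW.
apply/asboolP => e e0.
have c1 : 0 < rnorm c + 1 by rewrite ltr_wpDl ?rnorm_ge0.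
have [x hx] := hf (e / 2 / (rnorm c + 1)) ltac:(by rewrite !divr_gt0).
have [y hy] := hg (e / 2) ltac:(by rewrite divr_gt0).
exists (c *: x + y) => z.
have -> : (c *: f + g) z - s (c *: x + y) z = c * (f z - s x z) + (g z - s y z).
  have -> : (c *: f + g) z = c * f z + g z by [].
  rewrite (si_linear hs c x y z); move: (f z : C) (g z : C) => u v.
  by rewrite mulrBr opprD addrACA.
apply: le_trans (rnormD _ _) _; rewrite rnormM [e in leRHS]splitr mulrDl.
apply: lerD => //; apply: le_trans (ler_wpM2l (rnorm_ge0 _) (hx z)) _.
rewrite mulrA ler_wpM2r ?sinorm_ge0// mulrA ler_pdivrMr// mulrC.
by rewrite ler_wpM2l ?lerDl// ltW// divr_gt0.
Qed.

HB.instance Definition _ :=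
  GRing.isSubmodClosed.Build C (X -> C) represented_limit represented_limit_submod.
HB.instance Definition _ := [SubChoice_isSubLmodule of K by <:].

Lemma functionalP (k l : K) : functional k =1 functional l -> k = l.
Proof. by move=> kl; apply/val_inj/funext. Qed.

Lemma functionalD (k l : K) y :
  functional (k + l) y = functional k y + functional l y.
Proof. by []. Qed.

Lemma functionalZ c (k : K) y : functional (c *: k) y = c * functional k y.
Proof. by []. Qed.

Lemma functionalB (k l : K) y :
  functional (k - l) y = functional k y - functional l y.
Proof. by []. Qed.

Definition emb (x : X) : K := Completion hs (represented x).

Fact approximant_subproof (k : K) (m : nat) :
  exists x, forall y, rnorm (functional k y - s x y) <= m.+1%:R^-1 * n y.
Proof. by have /asboolP := valP k; apply; rewrite invr_gt0. Qed.

Definition approximant k m := projT1 (cid (approximant_subproof k m)).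

Lemma approximant_le k m y :
  rnorm (functional k y - s (approximant k m) y) <= m.+1%:R^-1 * n y.
Proof. exact: (projT2 (cid (approximant_subproof k m))). Qed.

(** Take [y = x]. *)
Lemma sinorm_le_of_dual (x : X) (e : R) : 0 <= e ->
  (forall y, rnorm (s x y) <= e * n y) -> n x <= e.
Proof.
move=> e0 /(_ x); rewrite si_self// rnorm_real ger0_norm ?sqr_ge0// expr2.
have [->//|x0] := eqVneq (n x) 0.
by rewrite ler_pM2r// lt_def x0 sinorm_ge0.
Qed.

Lemma approximant_dist k m p :
  n (approximant k m - approximant k p) <= m.+1%:R^-1 + p.+1%:R^-1.
Proof.
apply: sinorm_le_of_dual => [|y].
  by rewrite addr_ge0// invr_ge0.
rewrite siBl// -(subrKA (functional k y)) mulrDl.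
apply: le_trans (rnormD _ _) _.
by rewrite lerD// ?approximant_le// rnormB approximant_le.
Qed.

Lemma approximant_bound k m : n (approximant k m) <= n (approximant k 0) + 2.
Proof.
rewrite -(subrK (approximant k 0) (approximant k m)).
apply: le_trans (sinormD hs _ _) _; rewrite addrC lerD2l.
apply: le_trans (approximant_dist _ _ _) _; rewrite invr1 -[2%:R]/(1 + 1).
by rewrite lerD2r invf_le1// ler1n.
Qed.

Lemma functional_cvg (k : K) y :
  s (approximant k m) y @[m --> \oo] --> functional k y.
Proof.
apply/rnorm_cvgP => e e0.
have : (m.+1%:R^-1 : R) @[m --> \oo] --> 0 by exact: cvg_harmonic.
move/cvgrPdist_le => /(_ (e / (n y + 1))).
have y1 : 0 < n y + 1 by rewrite ltr_wpDl ?sinorm_ge0.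
rewrite divr_gt0// => /(_ isT); apply: filterS => m.
rewrite sub0r normrN ger0_norm ?invr_ge0// ler_pdivlMr// => h.
rewrite rnormB (le_trans (approximant_le _ _ _))// (le_trans _ h)//.
by rewrite ler_wpM2l ?invr_ge0// lerDl.
Qed.

Arguments functional_cvg : clear implicits.

Lemma functional_linear (k : K) c x y :
  functional k (c *: x + y) = c^* * functional k x + functional k y.
Proof.
apply: rnorm_cvg_unique (functional_cvg k _) _.
under eq_fun do rewrite siDr// siZr//.
by apply: cvgD; [apply: cvgMr|]; exact: functional_cvg.
Qed.

Lemma functionalBr (k : K) x y :
  functional k (x - y) = functional k x - functional k y.
Proof.
by rewrite addrC -scaleN1r functional_linear rmorphN1 mulN1r addrC.
Qed.

Lemma functional_bound (k : K) y :
  rnorm (functional k y) <= (n (approximant k 0) + 1) * n y.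
Proof.
rewrite -(subrK (s (approximant k 0) y) (functional k y)).
apply: le_trans (rnormD _ _) _; rewrite addrC mulrDl mul1r lerD//.
  exact: cauchy_schwarz.
by apply: le_trans (approximant_le _ _ _) _; rewrite invr1 mul1r.
Qed.

Definition ip_completion (k l : K) : C :=
  lim (functional k (approximant l m) @[m --> \oo]).
Local Notation ipK := ip_completion.

Lemma ip_completion_cvg k l :
  functional k (approximant l m) @[m --> \oo] --> ipK k l.
Proof.
apply: (@complex_complete _ _ \oo _ (fun m => functional k (approximant l m))) => e e0.
set D := n (approximant k 0) + 1.
have D0 : 0 < D by rewrite ltr_wpDl ?sinorm_ge0.
have [M hM] : exists M : nat, 2 * D / M.+1%:R <= e.
  have M := archi_boundP (x := 2 * D / e) ltac:(by rewrite ltW// !divr_gt0// mulr_gt0).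
  exists (Num.bound (2 * D / e)); rewrite ler_pdivrMr// [leRHS]mulrC -ler_pdivrMr//.
  by rewrite ltW// (lt_le_trans M)// ler_nat.
exists (functional k (approximant l M)); exists M => // m /= Mm.
rewrite -functionalBr (le_trans (functional_bound _ _))// -/D (le_trans _ hM)//.
rewrite [2 * D]mulrC -mulrA ler_pM2l// (le_trans (approximant_dist _ _ _))//.
by rewrite mulr_natl mulr2n lerD2r lef_pV2 ?posrE// ler_nat ltnS.
Qed.

Arguments ip_completion_cvg : clear implicits.

Lemma ip_completion_cvg2 k l :
  s (approximant k m) (approximant l m) @[m --> \oo] --> ipK k l.
Proof.
have -> : ipK k l = ipK k l - 0 by rewrite subr0.
under eq_fun => m do
  rewrite -[s _ _](subKr (functional k (approximant l m))).
apply: cvgB; first exact: ip_completion_cvg.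
apply/rnorm_cvgP => e e0.
set D := n (approximant l 0) + 2.
have D0 : 0 < D by rewrite ltr_wpDl ?sinorm_ge0.
have : (m.+1%:R^-1 : R) @[m --> \oo] --> 0 by exact: cvg_harmonic.
move/cvgrPdist_le => /(_ (e / D)); rewrite divr_gt0// => /(_ isT).
apply: filterS => m; rewrite sub0r normrN ger0_norm ?invr_ge0//.
rewrite ler_pdivlMr// subr0 => h.
rewrite (le_trans (approximant_le _ _ _))// (le_trans _ h)//.
by rewrite ler_wpM2l ?invr_ge0// approximant_bound.
Qed.

Arguments ip_completion_cvg2 : clear implicits.

Lemma ip_completion_semi_inner : semi_inner ipK.
Proof.
split=> [c k l m|k l|k].
- apply: rnorm_cvg_unique (ip_completion_cvg _ _) _.
  under eq_fun do rewrite functionalD functionalZ.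
  by apply: cvgD; [apply: cvgMr|]; exact: ip_completion_cvg.
- apply: rnorm_cvg_unique (ip_completion_cvg2 _ _) _.
  under eq_fun do rewrite si_conj//.
  have /rnorm_cvgP h := ip_completion_cvg2 k l.
  apply/rnorm_cvgP => e /h; apply: filterS => m.
  by rewrite -rmorphB rnorm_conj.
- have /rnorm_cvgP h := ip_completion_cvg2 k k.
  have {}h (e : R) : 0 < e -> `|complex.Im (ipK k k)| <= e /\ - e <= Re (ipK k k).
    move=> /h/(@filter_ex _ \oo)[m]; rewrite rnormB (si_self hs).
    set z := ipK k k => zm; have [] := Re_Im_le (z - (n (approximant k m) ^+ 2)%:C).
    rewrite ReB; have -> : complex.Im (z - (n (approximant k m) ^+ 2)%:C) = complex.Im z.
      by case: (z) => u v /=; rewrite subr0.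
    move=> /le_trans/(_ zm) + /le_trans/(_ zm) -> => /ler_normlP[+ _].
    have := sqr_ge0 (n (approximant k m)) => ? h1; split=> //.
    by move: h1 => /=; lra.
  rewrite lecE /=; apply/andP; split.
    rewrite -normr_eq0 eq_le normr_ge0 andbT; apply/ler_addgt0Pr => e /h[].
    by rewrite add0r.
  by apply/ler_addgt0Pr => e /h[_]; rewrite -lerBlDr sub0r.
Qed.
Local Notation hK := ip_completion_semi_inner.
Local Notation N := (sinorm ipK).

Lemma ip_emb k y : ipK k (emb y) = functional k y.
Proof.
apply: rnorm_cvg_unique (ip_completion_cvg _ _) _.
apply/rnorm_cvgP => e e0.
set D := n (approximant k 0) + 1.
have D0 : 0 < D by rewrite ltr_wpDl ?sinorm_ge0.
have : (m.+1%:R^-1 : R) @[m --> \oo] --> 0 by exact: cvg_harmonic.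
move/cvgrPdist_le => /(_ (e / D)); rewrite divr_gt0// => /(_ isT).
apply: filterS => m; rewrite sub0r normrN ger0_norm ?invr_ge0//.
rewrite ler_pdivlMr// => h.
rewrite -functionalBr (le_trans (functional_bound _ _))// mulrC (le_trans _ h)//.
rewrite ler_pM2r// sinorm_le_of_dual ?invr_ge0// => z.
by rewrite siBl// rnormB; exact: (approximant_le (emb y)).
Qed.

Lemma ip_emb2 x y : ipK (emb x) (emb y) = s x y.
Proof. exact: ip_emb. Qed.

Lemma functional_le (k : K) y : rnorm (functional k y) <= N k * n y.
Proof.
rewrite -ip_emb (le_trans (cauchy_schwarz hK _ _))//.
by rewrite [N (emb y)]/sinorm ip_emb2.
Qed.

(** [N k ^+ 2] is the limit of the values of [k] at its approximants, whose
seminorms tend to [N k]. *)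
Lemma completion_norm_le (k : K) (e : R) : 0 <= e ->
  (forall y, rnorm (functional k y) <= e * n y) -> N k <= e.
Proof.
move=> e0 ke.
have [->//|k0] := eqVneq (N k) 0; have {k0}Npos : 0 < N k by rewrite lt_def k0 sinorm_ge0.
rewrite -(ler_pM2r Npos) -expr2 (sinorm_sqr hK).
have cRe (f : nat -> C) (l : C) : f @ \oo --> l -> (Re \o f) @ \oo --> Re l.
  move=> /rnorm_cvgP fl; apply/cvgrPdist_le => d /fl; apply: filterS => m.
  by rewrite distrC -ReB; apply: le_trans; case: (Re_Im_le (f m - l)).
have h1 := cRe _ _ (ip_completion_cvg k k).
have h2 := cRe _ _ (ip_completion_cvg2 k k).
have h3 : n (approximant k m) @[m --> \oo] --> N k.
  by rewrite /sinorm; apply: continuous_cvg h2; exact: sqrt_continuous.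
have h4 : e * n (approximant k m) @[m --> \oo] --> e * N k by apply: cvgMr.
apply: ler_cvg_to h1 h4 _; near=> m => /=.
by rewrite (le_trans (Re_le_rnorm _)).
Unshelve. all: by end_near. Qed.

Definition completion_norm (k : K) : C := (N k)%:C.

Fact completion_ler_normD k l :
  completion_norm (k + l) <= completion_norm k + completion_norm l.
Proof. by rewrite /completion_norm -rmorphD lecR; exact: sinormD hK _ _. Qed.

Fact completion_normrZ (c : C) k :
  completion_norm (c *: k) = `|c| * completion_norm k.
Proof. by rewrite /completion_norm (sinormZ hK) rmorphM/= [in RHS]normE. Qed.

Fact completion_normr0_eq0 k : completion_norm k = 0 -> k = 0.
Proof.
move=> /complexI k0; apply: functionalP => y; apply: rnorm0_eq0.
by apply/eqP; rewrite eq_le rnorm_ge0 andbT -(mul0r (n y)) -k0 functional_le.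
Qed.

HB.instance Definition _ := Lmodule_isNormed.Build C K
  completion_ler_normD completion_normrZ completion_normr0_eq0.

Lemma rnorm_completion (k : K) : rnorm k = N k.
Proof. by []. Qed.

Lemma emb_dense (k : K) (e : R) : 0 < e -> exists x, rnorm (k - emb x) <= e.
Proof.
move=> e0; have /asboolP/(_ e e0)[x kx] := valP k.
by exists x; rewrite rnorm_completion; apply: completion_norm_le (ltW e0) _.
Qed.

(** A Cauchy filter converges pointwise as a filter of functionals, and the
pointwise limit is again a limit of represented functionals. *)
Lemma completion_complete (F : set_system K) :
  ProperFilter F -> cauchy F -> cvg F.
Proof.
move=> FF /cauchyP Fc.
have {}Fc (e : R) : 0 < e -> exists k : K, \forall l \near F, rnorm (l - k) <= e.
  move=> e0; have e0' : (0 : C) < e%:C by rewrite -(@ltcR R 0) in e0.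
  have [k Fk] := Fc _ e0'; exists k; apply: filterS Fk => l.
  by rewrite -ball_normE /= distrC => /ltW/le_Re.
have funF (y : X) : cvg (functional l y @[l --> F]).
  apply: complex_complete => e e0.
  have y1 : 0 < n y + 1 by rewrite ltr_wpDl ?sinorm_ge0.
  have [|k kF] := Fc (e / (n y + 1)); first by rewrite divr_gt0.
  exists (functional k y); apply: filterS kF => l lk.
  rewrite -functionalB (le_trans (functional_le _ _))//.
  rewrite -(@ler_pM2r _ (n y + 1)) ?mulfVK ?gt_eqF// in lk.
  by apply: le_trans lk; rewrite ler_wpM2l ?sinorm_ge0// lerDl.
pose phi (y : X) : C := lim (functional l y @[l --> F]).
have phiE (k : K) (e : R) : (\forall l \near F, rnorm (l - k) <= e) ->
    forall y, rnorm (phi y - functional k y) <= e * n y.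
  move=> Fk y; apply: rnorm_cvg_le (funF y) _; apply: filterS Fk => l lk.
  rewrite -functionalB (le_trans (functional_le _ _))//.
  by rewrite ler_wpM2r ?sinorm_ge0.
have phiP : phi \in represented_limit.
  apply/asboolP => e e0; have e20 : 0 < e / 2 by rewrite divr_gt0.
  have [k /phiE kF] := Fc _ e20; have /asboolP/(_ _ e20)[x kx] := valP k.
  exists x => y; rewrite -(subrKA (functional k y)) [e in leRHS]splitr mulrDl.
  exact: le_trans (rnormD _ _) (lerD (kF y) (kx y)).
apply: (cvgP (Completion hs phiP)); apply/rnorm_cvgP => e e0.
have e20 : 0 < e / 2 by rewrite divr_gt0.
have [k kF] := Fc _ e20; apply: filterS (kF) => l lk.
rewrite -(subrKA k) [leRHS]splitr; apply: le_trans (rnormD _ _) _.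
rewrite lerD// rnormB; apply: completion_norm_le (ltW e20) _ => y.
exact: phiE kF y.
Qed.

HB.instance Definition _ := Uniform_isComplete.Build K completion_complete.

Fact ip_completion_bilinear : bilinear_for
  (GRing.Scale.Law.clone _ _ *%R _)
  (GRing.Scale.Law.clone _ _ (Num.conj \; *%R) _) (ipK : K -> K -> C).
Proof.
split=> [k|k] c x y /=.
- by rewrite (si_linear hK).
- by rewrite (siDr hK) (siZr hK).
Qed.

HB.instance Definition _ := bilinear_isBilinear.Build C K K C
  _ _ ipK ip_completion_bilinear.

Fact ip_completion_hermitian (k l : K) : ipK k l = (-1) ^+ false * (ipK l k)^*.
Proof. by rewrite expr0 mul1r (si_conj hK). Qed.

HB.instance Definition _ := isHermitianSesquilinear.Build C K false (@Num.conj C)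
  ipK ip_completion_hermitian.

Fact ip_completion_gt0 (k : K) : k != 0 -> 0 < ipK k k.
Proof.
move=> k0; rewrite lt_def (si_ge0 hK) andbT; apply: contra k0 => /eqP k0.
apply/eqP/completion_normr0_eq0; rewrite /completion_norm /sinorm k0.
by rewrite sqrtr0.
Qed.

HB.instance Definition _ := isDotProduct.Build C K ipK ip_completion_gt0.

Fact ip_completionE (k : K) : ipK k k = `|k| ^+ 2.
Proof. by rewrite (si_self hK) rmorphXn. Qed.

HB.instance Definition _ := CompleteNormedModule_isHilbert.Build R K
  ip_completionE.

Lemma emb_linear : linear emb.
Proof. by move=> c x y; apply: functionalP => z; exact: si_linear. Qed.

Lemma lift_subproof (V V' : X -> X) (k : K) :
  cancel V' V -> (forall x y, s (V x) y = s x (V' y)) ->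
  functional k \o V' \in represented_limit.
Proof.
move=> V'K adj; apply/asboolP => e e0.
have /asboolP/(_ _ e0)[x kx] := valP k; exists (V x) => y /=.
by rewrite adj (le_trans (kx _))// /sinorm -adj V'K.
Qed.

Definition lift (V V' : X -> X) (V'K : cancel V' V)
  (adj : forall x y, s (V x) y = s x (V' y)) (k : K) : K :=
  Completion hs (lift_subproof k V'K adj).

Section lift.
Variables (V V' : X -> X) (VK : cancel V V') (V'K : cancel V' V).
Hypothesis adj : forall x y, s (V x) y = s x (V' y).
Let adj' x y : s (V' x) y = s x (V y).
Proof. by rewrite (si_conj hs) -adj -(si_conj hs). Qed.
Let U := lift V'K adj.
Let U' := lift VK adj'.

Lemma lift_linear : linear U.
Proof. by move=> c k l; exact: functionalP. Qed.

Lemma lift_emb x : U (emb x) = emb (V x).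
Proof. by apply: functionalP => y /=; rewrite adj. Qed.

Lemma lift_norm_le k : N (U k) <= N k.
Proof.
apply: completion_norm_le (sinorm_ge0 _ _) _ => y /=.
by rewrite (le_trans (functional_le _ _))// /sinorm -adj V'K.
Qed.

Lemma lift_bounded : bounded_operator U.
Proof.
split; first exact: lift_linear.
apply: (@le_lt_trans _ _ 1%:E); last by rewrite ltry.
apply: ub_ereal_sup => _ [k /= k1 <-]; rewrite lee_fin.
exact: le_trans (lift_norm_le k) k1.
Qed.
End lift.

Lemma ip_lift (V V' : X -> X) (VK : cancel V V') (V'K : cancel V' V)
    (adj : forall x y, s (V x) y = s x (V' y))
    (adj' : forall x y, s (V' x) y = s x (V y)) (k l : K) :
  ipK (lift V'K adj k) l = ipK k (lift VK adj' l).
Proof.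
set U := lift V'K adj; set U' := lift VK adj'.
have Uemb y : ipK (U k) (emb y) = ipK k (U' (emb y)).
  by rewrite ip_emb /U' (lift_emb VK adj') ip_emb.
apply/eqP; rewrite -subr_eq0; apply/eqP/rnorm0_eq0/eqP.
rewrite eq_le rnorm_ge0 andbT; apply/ler_addgt0Pr => e e0; rewrite add0r.
have D0 : 0 < N (U k) + N k + 1 by rewrite ltr_wpDl// addr_ge0// sinorm_ge0.
have [|y ly] := @emb_dense l (e / (N (U k) + N k + 1)).
  by rewrite divr_gt0.
rewrite rnorm_completion ler_pdivlMr// in ly.
have -> : ipK (U k) l - ipK k (U' l) =
    ipK (U k) (l - emb y) - ipK k (U' (l - emb y)).
  have -> : U' (l - emb y) = U' l - U' (emb y) by exact: functionalP.
  by rewrite !(siBr hK) Uemb opprB addrA subrK.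
apply: le_trans (rnormD _ _) _; rewrite rnormN (le_trans _ ly)//.
rewrite mulrC !mulrDl mul1r; apply: ler_wpDr; first exact: sinorm_ge0.
rewrite lerD// (le_trans (cauchy_schwarz hK _ _))//.
by rewrite ler_wpM2l ?sinorm_ge0// lift_norm_le.
Qed.

End completion.

(** A bijection [V] that preserves the form extends to a unitary by composing
functionals with its inverse [V']. *)
Theorem hilbert_completion (R : realType)
    (X : lmodType [the numClosedFieldType of R[i]]) (s : X -> X -> _)
    (V V' : X -> X) :
  semi_inner s -> cancel V V' -> cancel V' V ->
  (forall x y, s (V x) y = s x (V' y)) ->
  exists (K : hilbertType R) (e : X -> K) (U : K -> K),
    [/\ linear e, forall x y, ip (e x) (e y) = s x y, unitary U &
        forall x, U (e x) = e (V x)].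
Proof.
move=> hs VK V'K adj.
have adj' x y : s (V' x) y = s x (V y).
  by rewrite (si_conj hs) -adj -(si_conj hs).
exists (completion hs : hilbertType R), (emb hs), (lift V'K adj); split.
- exact: emb_linear.
- exact: ip_emb2.
- split; first exact: lift_bounded.
  exists (lift VK adj'); split; first exact: lift_bounded.
  + exact: ip_lift.
  + by apply/funext => k; apply: functionalP => y /=; rewrite VK.
  + by apply/funext => k; apply: functionalP => y /=; rewrite V'K.
- exact: lift_emb.
Qed.

(** * Dominated extension of linear functionals *)

Section hahn_banach.
Variables (R : realType) (V : lmodType R) (D : set V).
Hypothesis DD : forall x y, D x -> D y -> D (x + y).
Hypothesis DZ : forall (t : R) x, D x -> D (t *: x).

Definition sublinear (q : V -> R) : Prop :=
  (forall x y, D x -> D y -> q (x + y) <= q x + q y) /\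
  (forall (t : R) x, 0 < t -> D x -> q (t *: x) = t * q x).

(** The reverse inequality is the same one for [t^-1] and [t *: x]. *)
Lemma homogeneous_of_le (q : V -> R) :
  (forall (t : R) x, 0 < t -> D x -> t * q x <= q (t *: x)) ->
  forall (t : R) x, 0 < t -> D x -> q (t *: x) = t * q x.
Proof.
move=> h t x t0 Dx; apply/eqP; rewrite eq_le h// andbT.
have := h t^-1 (t *: x) ltac:(by rewrite invr_gt0) (DZ t Dx).
rewrite scalerA mulVf ?gt_eqF// scale1r -(ler_pM2l t0) mulrA divff ?gt_eqF//.
by rewrite mul1r.
Qed.

Let DN x : D x -> D (- x).
Proof. by rewrite -scaleN1r; exact: DZ. Qed.

Lemma sublinear0 q : sublinear q -> D 0 -> q 0 = 0.
Proof.
move=> [_ qZ] D0; have := qZ 2 0 ltac:(by []) D0; rewrite scaler0; lra.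
Qed.

Lemma sublinear_opp q x : sublinear q -> D x -> - q (- x) <= q x.
Proof.
move=> hq Dx; have D0 : D 0 by rewrite -(scale0r x); exact: DZ.
have := hq.1 _ _ Dx (DN Dx); rewrite subrr (sublinear0 hq D0); lra.
Qed.

(** The largest sublinear functional below [q] that takes the value [- q y]
at [- y]. *)
Definition lower (q : V -> R) (y x : V) : R :=
  inf [set q (x + t *: y) - t * q y | t in [set t : R | 0 <= t]].

Lemma lower_has_inf q x y : sublinear q -> D x -> D y ->
  has_inf [set q (x + t *: y) - t * q y | t in [set t : R | 0 <= t]].
Proof.
move=> hq Dx Dy; have D0 : D 0 by rewrite -(scale0r x); exact: DZ.
split; first by exists (q (x + 0 *: y) - 0 * q y), 0 => /=.
exists (- q (- x)) => _ [t /= t0 <-].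
have tqy : q (t *: y) = t * q y.
  have [->|tn0] := eqVneq t 0; first by rewrite scale0r mul0r sublinear0.
  by rewrite hq.2// lt_def tn0.
have := hq.1 _ _ (DD Dx (DZ t Dy)) (DN Dx).
by rewrite addrAC subrr add0r tqy; lra.
Qed.

Lemma lower_le q x y t : sublinear q -> D x -> D y -> 0 <= t ->
  lower q y x <= q (x + t *: y) - t * q y.
Proof.
move=> hq Dx Dy t0; apply: inf_lbound; first by case: (lower_has_inf hq Dx Dy).
by exists t.
Qed.

Lemma lower_sublinear q y : sublinear q -> D y -> sublinear (lower q y).
Proof.
move=> hq Dy; split=> [x z Dx Dz|].
  rewrite -lerBlDr; apply: lb_le_inf; first by case: (lower_has_inf hq Dx Dy).
  move=> _ [a /= a0 <-]; rewrite lerBlDr -lerBlDl.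
  apply: lb_le_inf; first by case: (lower_has_inf hq Dz Dy).
  move=> _ [b /= b0 <-]; rewrite lerBlDr.
  apply: le_trans (lower_le hq (DD Dx Dz) Dy (addr_ge0 a0 b0)) _.
  have := hq.1 _ _ (DD Dx (DZ a Dy)) (DD Dz (DZ b Dy)).
  rewrite addrACA -scalerDl; lra.
apply: homogeneous_of_le => u v u0 Dv.
apply: lb_le_inf; first by case: (lower_has_inf hq (DZ u Dv) Dy).
move=> _ [a /= a0 <-].
have := lower_le hq Dv Dy (divr_ge0 a0 (ltW u0)).
rewrite -(ler_pM2l u0) mulrBr -(hq.2 u (v + _))//; last by apply: DD => //; exact: DZ.
by rewrite scalerDr scalerA mulrCA divff ?gt_eqF// mulr1 mulrA mulrCA divff
  ?gt_eqF// mulr1.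
Qed.

(** The infimum of a chain of sublinear functionals below [p] is sublinear, so
there is a minimal one; minimality against [lower] makes it additive. *)
Theorem hahn_banach (p : V -> R) : sublinear p ->
  exists f : V -> R,
    [/\ forall x y, D x -> D y -> f (x + y) = f x + f y,
        forall (t : R) x, D x -> f (t *: x) = t * f x &
        forall x, D x -> f x <= p x].
Proof.
move=> hp.
pose P (q : V -> R) := [/\ sublinear q, forall x, D x -> q x <= p x &
                         forall x, ~ D x -> q x = p x].
pose T := {q : V -> R | P q}.
pose le (q r : T) : bool := `[< forall x, D x -> sval r x <= sval q x >].
have p0 : P p by split.
have lb (q : T) x : D x -> - p (- x) <= sval q x.
  move=> Dx; case: q => q [hq qp _] /=; have := sublinear_opp hq Dx.
  have := qp _ (DN Dx); lra.
have [|||A Atot|q qmin] := @Zorn T le.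
- by move=> q; apply/asboolP.
- move=> q r u /asboolP h1 /asboolP h2; apply/asboolP => x Dx.
  exact: le_trans (h2 x Dx) (h1 x Dx).
- move=> [q Pq] [r Pr] /asboolP h1 /asboolP h2; apply: eq_exist => /=.
  apply/funext => x; have [Dx|nDx] := pselect (D x).
    by apply/eqP; rewrite eq_le h1 ?h2.
  by have [_ _ ->//] := Pq; have [_ _ ->] := Pr.
- have [[q0 Aq0]|A0] := pselect (exists q, A q); last first.
    by exists (exist _ p p0) => s As; case: A0; exists s.
  pose S x := [set sval q x | q in A].
  have hS x : D x -> has_inf (S x).
    move=> Dx; split; first by exists (sval q0 x), q0.
    by exists (- p (- x)) => _ [q _ <-]; exact: lb.
  pose m x := if `[< D x >] then inf (S x) else p x.
  have mE x : D x -> m x = inf (S x) by move=> Dx; rewrite /m asboolT.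
  have mle x q : D x -> A q -> m x <= sval q x.
    move=> Dx Aq; rewrite mE//; apply: inf_lbound; first by case: (hS x Dx).
    by exists q.
  have leQ (q : T) : sublinear (sval q) by case: (svalP q).
  have hm : P m.
    split; [split=> [x y Dx Dy|]|move=> x Dx|move=> x nDx].
    + rewrite -lerBlDr [leRHS]mE//; apply: lb_le_inf; first by case: (hS x Dx).
      move=> _ [q Aq <-]; rewrite lerBlDr -lerBlDl [leRHS]mE//.
      apply: lb_le_inf; first by case: (hS y Dy).
      move=> _ [r Ar <-]; rewrite lerBlDr.
      have [/asboolP qr|/asboolP rq] := Atot _ _ Aq Ar.
        apply: le_trans (mle _ _ (DD Dx Dy) Ar) _.
        apply: le_trans ((leQ r).1 _ _ Dx Dy) _.
        by rewrite addrC lerD2l qr.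
      apply: le_trans (mle _ _ (DD Dx Dy) Aq) _.
      apply: le_trans ((leQ q).1 _ _ Dx Dy) _.
      by rewrite addrC lerD2r rq.
    + apply: homogeneous_of_le => u v u0 Dv; rewrite [leRHS]mE; last exact: DZ.
      apply: lb_le_inf; first by case: (hS _ (DZ u Dv)).
      by move=> _ [q Aq <-]; rewrite (leQ q).2// ler_pM2l// mle.
    + by apply: le_trans (mle x q0 Dx Aq0) _; case: (svalP q0) => _ ->.
    + by rewrite /m asboolF.
  by exists (exist _ m hm) => q Aq; apply/asboolP => x Dx; exact: mle.
have [hq qp qn] := svalP q.
have qadd y x : D y -> D x -> sval q x + sval q y <= sval q (x + y).
  move=> Dy Dx.
  pose r x := if `[< D x >] then lower (sval q) y x else p x.
  have rE z : D z -> r z = lower (sval q) y z by move=> Dz; rewrite /r asboolT.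
  have rq z : D z -> r z <= sval q z.
    move=> Dz; rewrite rE//; have := lower_le hq Dz Dy (lexx 0).
    by rewrite scale0r mul0r addr0 subr0.
  have hr : P r.
    have [l1 l2] := lower_sublinear hq Dy.
    split; [split=> [z w Dz Dw|t z t0 Dz]|move=> z Dz|move=> z nDz].
    + by rewrite !rE//; [exact: l1|exact: DD].
    + by rewrite !rE//; [exact: l2|exact: DZ].
    + by apply: le_trans (rq _ Dz) _; exact: qp.
    + by rewrite /r asboolF.
  have /(_ _)/(congr1 sval) /= E := qmin (exist _ r hr).
  rewrite -[X in X + _ <= _]/(sval q x) -E; last by apply/asboolP.
  have := lower_le hq Dx Dy ler01; rewrite scale1r mul1r -rE//.
  by rewrite E ?lerBrDr//; apply/asboolP.
have fD x y : D x -> D y -> sval q (x + y) = sval q x + sval q y.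
  by move=> Dx Dy; apply/eqP; rewrite eq_le hq.1//= qadd.
exists (sval q); split => // t x Dx.
have D0 : D 0 by rewrite -(scale0r x); exact: DZ.
have fN z : D z -> sval q (- z) = - sval q z.
  move=> Dz; apply/eqP; rewrite -addr_eq0 -fD//; last exact: DN.
  by rewrite addNr (sublinear0 hq).
have [t0|t0|->] := ltgtP t 0; last by rewrite scale0r mul0r (sublinear0 hq).
  rewrite -[t]opprK scaleNr fN; last exact: DZ.
  by rewrite hq.2 ?oppr_gt0// !mulNr.
by rewrite hq.2.
Qed.

End hahn_banach.

(** * Roots of unity and the maximum modulus principle *)

Section fourier.
Variable R : realType.
Local Notation C := [the numClosedFieldType of R[i]].

Lemma primitive_root_exists n : (0 < n)%N ->
  exists2 w : C, n.-primitive_root w & rnorm w = 1.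
Proof.
move=> n0; pose p : {poly C} := 'X^n - 1.
have [r def_p] := closed_field_poly_normal p.
have sz_p : size p = n.+1 by rewrite size_XnsubC.
rewrite (monicP _) ?monicXnsubC// scale1r in def_p.
have rn1 : all n.-unity_root r.
  by apply/allP => z; rewrite -root_prod_XsubC -def_p.
have sz_r : (n < (size r).+1)%N by rewrite -(size_prod_XsubC r id) -def_p sz_p.
have uniq_r : uniq r.
  rewrite -separable_prod_XsubC -def_p separable_Xn_sub_1//.
  by rewrite pnatr_eq0 -lt0n.
have [w _ w1] := hasP (has_prim_root n0 rn1 uniq_r sz_r).
exists w => //; apply/eqP; rewrite -(@pexpr_eq1 _ _ n) ?rnorm_ge0//.
by rewrite -rnormX (prim_expr_order w1) rnorm1.
Qed.

Lemma rnorm1_conj (w : C) : rnorm w = 1 -> w * w^* = 1.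
Proof. by move=> w1; rewrite mul_conj w1 expr1n. Qed.

Lemma sum_primitive_root n (w : C) (k k' : 'I_n) :
  n.-primitive_root w -> rnorm w = 1 ->
  \sum_(l < n) (w ^+ l) ^+ k * ((w ^+ l) ^+ k')^* = (k == k')%:R * n%:R.
Proof.
move=> wn w1.
have E l : (w ^+ l) ^+ k * ((w ^+ l) ^+ k')^* = (w ^+ k * (w^*) ^+ k') ^+ l.
  by rewrite !rmorphXn/= exprMn -!exprM ![(l * _)%N]mulnC.
under eq_bigr do rewrite E.
have ww := rnorm1_conj w1.
have [->|kk'] := eqVneq k k'.
  rewrite mul1r -exprMn ww expr1n; under eq_bigr do rewrite expr1n.
  by rewrite sumr_const card_ord.
set h := w ^+ k * _; rewrite mul0r; apply/eqP.
have hn : h ^+ n - 1 = 0.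
  rewrite exprMn -!exprM mulnC exprM (prim_expr_order wn) expr1n mul1r.
  rewrite mulnC exprM -rmorphXn (prim_expr_order wn) rmorph1 expr1n subrr//.
have : (h - 1) * \sum_(l < n) h ^+ l == 0 by rewrite -subrX1 hn.
rewrite mulf_eq0 subr_eq0 => /orP[/eqP h1|//]; case/negP: kk'.
have : w ^+ k == w ^+ k'.
  rewrite -[w ^+ k]mulr1 -(expr1n _ k') -ww exprMn mulrCA -[w ^+ k * _]/h.
  by rewrite h1 mulr1.
by rewrite (eq_prim_root_expr wn) !modn_small.
Qed.

Section forms.
Variables (X : lmodType C) (s : X -> X -> C).
Hypothesis hs : semi_inner s.
Local Notation N := (sinorm s).

(** The cross terms cancel because the sum over the roots of unity of
[w^(l (k - k'))] vanishes for [k != k']. *)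
Lemma parseval n (w : C) (x : 'I_n -> X) :
  n.-primitive_root w -> rnorm w = 1 ->
  \sum_(l < n) N (\sum_(k < n) (w ^+ l) ^+ k *: x k) ^+ 2 =
  n%:R * \sum_(k < n) N (x k) ^+ 2.
Proof.
move=> wn w1; apply: (@complexI R).
rewrite rmorph_sum rmorphM rmorph_nat rmorph_sum /=.
transitivity (\sum_(k < n) \sum_(k' < n) s (x k) (x k') *
    \sum_(l < n) (w ^+ l) ^+ k * ((w ^+ l) ^+ k')^*).
  under eq_bigr do rewrite -(si_self hs) (si_suml hs).
  rewrite exchange_big; apply: eq_bigr => k _ /=.
  under eq_bigr do rewrite (si_sumr hs).
  rewrite exchange_big; apply: eq_bigr => k' _ /=.
  rewrite mulr_sumr; apply: eq_bigr => l _.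
  by rewrite (siZl hs) (siZr hs); ring.
rewrite mulr_sumr; apply: eq_bigr => k _.
rewrite (bigD1 k)//= sum_primitive_root// eqxx mul1r big1 => [|k' k'k].
  by rewrite addr0 (si_self hs) mulrC.
by rewrite sum_primitive_root// eq_sym (negPf k'k) mul0r mulr0.
Qed.

(** The coordinates in an orthonormal basis of the span of the [x j] reduce the
inequality to the scalar one, applied to each coordinate. *)
Lemma scalar_matrix_bound r (A : 'I_r -> 'I_r -> C) (b : R) :
  (forall v : 'I_r -> C, \sum_(i < r) rnorm (\sum_(j < r) A i j * v j) ^+ 2 <=
     b * \sum_(j < r) rnorm (v j) ^+ 2) ->
  forall x : 'I_r -> X, \sum_(i < r) N (\sum_(j < r) A i j *: x j) ^+ 2 <=
     b * \sum_(j < r) N (x j) ^+ 2.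
Proof.
move=> hA x.
have [m [e [_ xe]]] := gram_schmidt hs [seq x j | j <- enum 'I_r].
have {}xe j y : s (x j) y = \sum_(a < m) s (x j) (e a) * s (e a) y.
  by apply: xe; rewrite map_f// mem_enum.
have xN (c : 'I_r -> C) : N (\sum_(j < r) c j *: x j) ^+ 2 =
    \sum_(a < m) rnorm (\sum_(j < r) c j * s (x j) (e a)) ^+ 2.
  apply: (@complexI R); rewrite -(si_self hs) rmorph_sum /=.
  set u := \sum_(j < r) c j *: x j.
  have uE y : s u y = \sum_(a < m) s u (e a) * s (e a) y.
    rewrite {1}/u (si_suml hs); under eq_bigr do rewrite (siZl hs) xe mulr_sumr.
    rewrite exchange_big; apply: eq_bigr => a _ /=.
    rewrite (si_suml hs) mulr_suml; apply: eq_bigr => j _.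
    by rewrite (siZl hs) mulrA.
  rewrite uE; apply: eq_bigr => a _; rewrite (si_conj hs u) mul_conj.
  by congr ((rnorm _ ^+ 2)%:C); rewrite (si_suml hs); apply: eq_bigr => j _;
    rewrite (siZl hs).
under eq_bigr do rewrite xN; rewrite exchange_big /=.
have -> : \sum_(j < r) N (x j) ^+ 2 =
    \sum_(a < m) \sum_(j < r) rnorm (s (x j) (e a)) ^+ 2.
  rewrite exchange_big; apply: eq_bigr => j _ /=.
  have -> : x j = \sum_(j' < r) (j' == j)%:R *: x j'.
    by rewrite (bigD1 j)//= eqxx scale1r big1 ?addr0// => j' /negPf ->; rewrite scale0r.
  rewrite xN; apply: eq_bigr => a _; rewrite (si_suml hs); congr (rnorm _ ^+ 2).
  by apply: eq_bigr => j' _; rewrite (siZl hs).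
by rewrite mulr_sumr; apply: ler_sum => a _; exact: hA.
Qed.
End forms.

(** By Parseval, the sum of the squares of the coefficients is a mean value of
[|p|^2] over roots of unity. *)
Lemma coef_le_sup (p : {poly C}) (M : R) :
  (forall z, rnorm z = 1 -> rnorm p.[z] <= M) -> forall k, rnorm p`_k <= M.
Proof.
move=> pM k; have M0 : 0 <= M by apply: le_trans (pM 1 (rnorm1 R)); exact: rnorm_ge0.
have [kp|kp] := ltnP k (size p); last by rewrite nth_default// rnorm0.
have hs : semi_inner (fun x y : C => x * y^*).
  split=> [c x y z|x y|x]; first by rewrite /GRing.scale/=; ring.
    by rewrite rmorphM /= conjCK mulrC.
  by rewrite mul_conjC_ge0.
have NE x : sinorm (fun x y : C => x * y^*) x = rnorm x.
  by rewrite /sinorm mul_conj /= sqrtr_sqr ger0_norm// rnorm_ge0.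
have p0 : (0 < size p)%N by exact: leq_ltn_trans kp.
have [w wn w1] := primitive_root_exists p0.
have := parseval hs (fun i : 'I_(size p) => p`_i : C) wn w1.
under eq_bigr => l _.
  rewrite NE (_ : \sum_(k < _) _ = p.[w ^+ l]); last first.
    by rewrite horner_coef; apply: eq_bigr => i _; rewrite mulrC.
  over.
move=> /= E; rewrite -(@ler_pXn2r _ 2) ?nnegrE ?rnorm_ge0//.
have np : 0 < (size p)%:R :> R by rewrite ltr0n.
rewrite -(ler_pM2l np); apply: (@le_trans _ _ (\sum_(l < size p) M ^+ 2)).
  apply: (@le_trans _ _ (\sum_(l < size p) rnorm p.[w ^+ l] ^+ 2)).
    rewrite E ler_pM2l// (bigD1 (Ordinal kp))//= NE lerDl.
    by rewrite sumr_ge0// => i _; exact: sqr_ge0.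
  apply: ler_sum => l _; rewrite lerXn2r ?nnegrE ?rnorm_ge0// pM//.
  by rewrite rnormX w1 expr1n.
by rewrite sumr_const card_ord mulr_natl.
Qed.

(** The bound on the coefficients gives [|p w| <= M / (1 - |w|)]; applied to
the powers of [p], it improves to [|p w| <= M]. *)
Lemma maximum_modulus (p : {poly C}) (M : R) :
  (forall z, rnorm z = 1 -> rnorm p.[z] <= M) ->
  forall w, rnorm w <= 1 -> rnorm p.[w] <= M.
Proof.
move=> pM w; rewrite le_eqVlt => /orP[/eqP/pM//|w1].
have M0 : 0 <= M by apply: le_trans (pM 1 (rnorm1 R)); exact: rnorm_ge0.
have w1' : 0 < 1 - rnorm w by rewrite subr_gt0.
have crude (q : {poly C}) (L : R) : (forall z, rnorm z = 1 -> rnorm q.[z] <= L) ->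
    rnorm q.[w] * (1 - rnorm w) <= L.
  move=> qL; have L0 : 0 <= L by apply: le_trans (qL 1 (rnorm1 R)); exact: rnorm_ge0.
  have : rnorm q.[w] <= L * \sum_(i < size q) rnorm w ^+ i.
    rewrite horner_coef (le_trans (rnorm_sum _ _ _))// mulr_sumr ler_sum// => i _.
    by rewrite rnormM rnormX ler_wpM2r ?exprn_ge0 ?rnorm_ge0// coef_le_sup.
  rewrite -(ler_pM2r w1') => /le_trans; apply; rewrite -mulrA ler_piMr//.
  rewrite mulrC -opprB mulNr -subrX1 opprB gerBl exprn_ge0// rnorm_ge0//.
have pow n : rnorm p.[w] ^+ n * (1 - rnorm w) <= M ^+ n.
  have := crude (p ^+ n) (M ^+ n); rewrite horner_exp rnormX; apply => z /pM pz.
  by rewrite horner_exp rnormX lerXn2r ?nnegrE ?rnorm_ge0.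
rewrite leNgt; apply/negP => Mp.
have [M00|Mn0] := eqVneq M 0.
  by have := pow 1%N; rewrite !expr1 M00 pmulr_lle0// leNgt -M00 Mp.
have Mpos : 0 < M by rewrite lt_def Mn0.
pose d := rnorm p.[w] / M - 1.
have d0 : 0 < d by rewrite subr_gt0 ltr_pdivlMr// mul1r.
have bern n : 1 + n%:R * d <= (1 + d) ^+ n.
  elim: n => [|n IH]; first by rewrite mul0r addr0.
  rewrite exprS; have : 0 <= 1 + d by rewrite addr_ge0// ltW.
  move=> /ler_wpM2l /(_ _ _ IH); apply: le_trans; rewrite -natr1.
  have : 0 <= n%:R * d * d by rewrite !mulr_ge0// ltW.
  lra.
have {}pow n : (1 + n%:R * d) * (1 - rnorm w) <= 1.
  apply: (@le_trans _ _ ((1 + d) ^+ n * (1 - rnorm w))).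
    by rewrite ler_pM2r.
  rewrite /d addrC subrK expr_div_n mulrAC ler_pdivrMr ?exprn_gt0// mul1r.
  exact: pow.
have := archi_boundP (x := (1 - rnorm w)^-1 / d)
  ltac:(by rewrite ltW// divr_gt0// invr_gt0).
set n := Num.bound _; have := pow n; rewrite -ler_pdivlMr// mul1r => h.
rewrite ltr_pdivrMr//; apply/negP; rewrite -leNgt; lra.
Qed.

End fourier.

(** * Uniform approximation on the closed disc *)

Section disc_functions.
Variable R : realType.
Local Notation C := [the numClosedFieldType of R[i]].

Definition disc_approx (P : set (C -> C)) (f : C -> C) : Prop :=
  forall e : R, 0 < e ->
    exists2 g, P g & forall z, rnorm z <= 1 -> rnorm (f z - g z) <= e.

Definition is_poly : set (C -> C) := [set f | exists p : {poly C}, f = horner p].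

Definition poly_limit : set (C -> C) := disc_approx is_poly.

Lemma disc_approx_id (P : set (C -> C)) f : P f -> disc_approx P f.
Proof.
by move=> Pf e e0; exists f => // z _; rewrite subrr rnorm0 ltW.
Qed.

Lemma disc_approx_idem (P : set (C -> C)) f :
  disc_approx (disc_approx P) f -> disc_approx P f.
Proof.
move=> h e e0; have e20 : 0 < e / 2 by rewrite divr_gt0.
have [g hg fg] := h _ e20; have [k Pk gk] := hg _ e20.
exists k => // z z1; rewrite -(subrKA (g z)) [leRHS]splitr.
by apply: le_trans (rnormD _ _) _; rewrite lerD ?fg ?gk.
Qed.

Lemma disc_approxW (P Q : set (C -> C)) f :
  (forall g, P g -> Q g) -> disc_approx P f -> disc_approx Q f.
Proof. by move=> PQ h e /h [g /PQ Qg fg]; exists g. Qed.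

Lemma disc_approxD (P : set (C -> C)) f g :
  (forall f g, P f -> P g -> P (fun z => f z + g z)) ->
  disc_approx P f -> disc_approx P g -> disc_approx P (fun z => f z + g z).
Proof.
move=> PD hf hg e e0; have e20 : 0 < e / 2 by rewrite divr_gt0.
have [f' Pf ff] := hf _ e20; have [g' Pg gg] := hg _ e20.
exists (fun z => f' z + g' z); first exact: PD.
move=> z z1; rewrite opprD addrACA [leRHS]splitr.
by apply: le_trans (rnormD _ _) _; rewrite lerD ?ff ?gg.
Qed.

Definition disc_bounded (f : C -> C) := exists M : R,
  0 < M /\ forall z, rnorm z <= 1 -> rnorm (f z) <= M.

Lemma disc_approx_bounded (P : set (C -> C)) f :
  (forall g, P g -> disc_bounded g) -> disc_approx P f -> disc_bounded f.
Proof.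
move=> Pb /(_ 1 ltr01)[g Pg fg]; have [M [M0 gM]] := Pb _ Pg.
exists (1 + M); split; first by rewrite addr_gt0.
move=> z z1; rewrite -(subrK (g z) (f z)).
by apply: le_trans (rnormD _ _) _; rewrite lerD ?fg ?gM.
Qed.

(** The factors are bounded on the disc, so products of approximations
approximate the product. *)
Lemma disc_approxM (P Q : set (C -> C)) f g :
  (forall f, P f -> disc_bounded f) -> (forall f, Q f -> disc_bounded f) ->
  disc_approx P f -> disc_approx Q g ->
  disc_approx [set h | exists f g, [/\ P f, Q g & h = fun z => f z * g z]]
    (fun z => f z * g z).
Proof.
move=> Pb Qb hf hg e e0.
have [M [M0 gM]] := disc_approx_bounded Qb hg.
have [f' Pf' ff] := hf (e / 2 / M) ltac:(by rewrite !divr_gt0).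
have [L [L0 fL]] := Pb _ Pf'.
have [g' Qg' gg] := hg (e / 2 / L) ltac:(by rewrite !divr_gt0).
exists (fun z => f' z * g' z); first by exists f', g'.
move=> z z1.
have -> : f z * g z - f' z * g' z = (f z - f' z) * g z + f' z * (g z - g' z) by ring.
apply: le_trans (rnormD _ _) _; rewrite !rnormM [leRHS]splitr lerD//.
  rewrite -[leRHS](divfK (x := M)) ?gt_eqF//.
  by rewrite ler_pM ?rnorm_ge0 ?ff ?gM.
rewrite -[leRHS](divfK (x := L)) ?gt_eqF// [leRHS]mulrC.
by rewrite ler_pM ?rnorm_ge0 ?gg ?fL.
Qed.

Lemma disc_bounded_cst c : disc_bounded (fun=> c).
Proof.
exists (rnorm c + 1); split; first by rewrite ltr_wpDl ?rnorm_ge0.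
by move=> z _; rewrite lerDl.
Qed.

Lemma poly_disc_bounded f : is_poly f -> disc_bounded f.
Proof.
move=> [p ->]; elim/poly_ind: p => [|p c [M [M0 pM]]].
  by under [horner 0]funext do rewrite horner0; exact: disc_bounded_cst.
exists (M + (rnorm c + 1)); split; first by rewrite addr_gt0// ltr_wpDl ?rnorm_ge0.
move=> z z1; rewrite hornerMXaddC (le_trans (rnormD _ _))// lerD ?lerDl//.
by rewrite rnormM -[M]mulr1 ler_pM ?rnorm_ge0 ?pM.
Qed.

Lemma poly_limit_poly (p : {poly C}) : poly_limit (horner p).
Proof. by apply: disc_approx_id; exists p. Qed.

Lemma poly_limitM f g : poly_limit f -> poly_limit g ->
  poly_limit (fun z => f z * g z).
Proof.
move=> hf hg; have := disc_approxM poly_disc_bounded poly_disc_bounded hf hg.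
apply: disc_approxW => _ [_ [_ [[p ->] [q ->] ->]]].
by exists (p * q); apply/funext => z; rewrite hornerM.
Qed.

Lemma poly_limitD f g : poly_limit f -> poly_limit g ->
  poly_limit (fun z => f z + g z).
Proof.
apply: disc_approxD => _ _ [p ->] [q ->].
by exists (p + q); apply/funext => z; rewrite hornerD.
Qed.

Lemma poly_limit_cst c : poly_limit (fun=> c).
Proof.
have -> : (fun=> c) = horner c%:P by apply/funext => z; rewrite hornerC.
exact: poly_limit_poly.
Qed.

Lemma poly_limitX f n : poly_limit f -> poly_limit (fun z => f z ^+ n).
Proof.
move=> hf; elim: n => [|n IH]; first exact: poly_limit_cst.
by under [fun z => _]funext do rewrite exprS; exact: poly_limitM.
Qed.

Lemma poly_limit_bounded f : poly_limit f -> disc_bounded f.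
Proof. exact/disc_approx_bounded/poly_disc_bounded. Qed.

Lemma pow_small (x e : R) : 0 <= x -> x < 1 -> 0 < e -> exists n, x ^+ n <= e.
Proof.
move=> x0 x1 e0; have : x ^+ n @[n --> \oo] --> 0.
  by apply: cvg_expr; rewrite ger0_norm.
move=> /cvgrPdist_le/(_ _ e0)[n _ /(_ n (leqnn n))].
by rewrite sub0r normrN ger0_norm ?exprn_ge0// => h; exists n.
Qed.

(** The partial sums of the geometric series approximate, uniformly since
[|b z| <= |b| < 1]. *)
Lemma poly_limit_inv (b : C) : rnorm b < 1 -> poly_limit (fun z => (1 - b * z)^-1).
Proof.
move=> b1 e e0; have b1' : 0 < 1 - rnorm b by rewrite subr_gt0.
have [n hn] := pow_small (rnorm_ge0 b) b1 (mulr_gt0 e0 b1').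
exists (horner (\sum_(i < n) (b *: 'X) ^+ i)); first by eexists.
move=> z z1; rewrite horner_sum; under eq_bigr do rewrite horner_exp hornerZ hornerX.
have bz : rnorm (b * z) <= rnorm b by rewrite rnormM ler_piMr ?rnorm_ge0.
have d0 : 1 - rnorm b <= rnorm (1 - b * z).
  rewrite lerBlDr; apply: (@le_trans _ _ (rnorm (1 - b * z) + rnorm (b * z))).
    by rewrite -[leLHS](rnorm1 R) -[X in rnorm X <= _](subrK (b * z)) rnormD.
  by rewrite lerD2l.
have dn0 : 1 - b * z != 0.
  by apply/negP => /eqP d00; move: d0; rewrite d00 rnorm0 leNgt b1'.
have -> : (1 - b * z)^-1 - \sum_(i < n) (b * z) ^+ i = (b * z) ^+ n / (1 - b * z).
  have := subrX1 (b * z) n; set S := \sum_(i < n) _ => /(canRL (subrK _)) ->.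
  by field.
rewrite rnormM rnormX rnormV ler_pdivrMr; last exact: lt_le_trans d0.
apply: le_trans (ler_wpM2l (ltW e0) d0); apply: le_trans hn.
by rewrite lerXn2r ?nnegrE ?rnorm_ge0.
Qed.

Lemma poly_limit_maximum_modulus f (M : R) : poly_limit f ->
  (forall z, rnorm z = 1 -> rnorm (f z) <= M) ->
  forall w, rnorm w <= 1 -> rnorm (f w) <= M.
Proof.
move=> hf fM w w1; apply/ler_addgt0Pr => e e0.
have e20 : 0 < e / 2 by rewrite divr_gt0.
have [_ [p ->] fp] := hf _ e20.
have pM : rnorm p.[w] <= M + e / 2.
  apply: maximum_modulus w1 => z z1; rewrite -(subrK (f z) p.[z]) addrC.
  by apply: le_trans (rnormD _ _) _; rewrite lerD ?fM// rnormB fp ?z1.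
rewrite -(subrK p.[w] (f w)); apply: le_trans (rnormD _ _) _.
by have := fp _ w1; lra.
Qed.

End disc_functions.

(** * A dense subspace of the algebra *)

Section blaschke.
Variable R : realType.
Local Notation C := [the numClosedFieldType of R[i]].

Section disc_algebra.

Lemma disc_algebraD (f g : C -> C) : disc_algebra f -> disc_algebra g ->
  disc_algebra (fun z => f z + g z).
Proof.
move=> [fc fd] [gc gd]; split=> [x|z z1].
  by apply: cvgD; [exact: fc|exact: gc].
by apply: derivableD; [exact: fd|exact: gd].
Qed.

Lemma disc_algebraM (f g : C -> C) : disc_algebra f -> disc_algebra g ->
  disc_algebra (fun z => f z * g z).
Proof.
move=> [fc fd] [gc gd]; split=> [x|z z1].
  by apply: cvgM; [exact: fc|exact: gc].
by apply: derivableM; [exact: fd|exact: gd].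
Qed.

Lemma disc_algebra_derivable (f : C -> C) :
  (forall z, `|z| <= 1 -> derivable f z 1) -> disc_algebra f.
Proof.
move=> fd; split=> [|z /ltW]; last exact: fd.
apply/continuous_in_subspaceT => z; rewrite inE => z1.
exact/differentiable_continuous/derivable1_diffP/fd.
Qed.

Lemma disc_algebra_cst (b : C) : disc_algebra (fun=> b).
Proof. by apply: disc_algebra_derivable => z _; exact: derivable_cst. Qed.

Lemma disc_algebra_id : disc_algebra (fun z : C => z).
Proof. by apply: disc_algebra_derivable => z _; exact: derivable_id. Qed.

Lemma disc_algebraX (f : C -> C) n : disc_algebra f ->
  disc_algebra (fun z => f z ^+ n).
Proof.
move=> hf; elim: n => [|n IH]; first exact: disc_algebra_cst.
by under [fun z => _]funext do rewrite exprS; exact: disc_algebraM.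
Qed.

Lemma one_sub_neq0 (b z : C) : rnorm b < 1 -> rnorm z <= 1 -> 1 - b * z != 0.
Proof.
move=> b1 z1; apply/negP; rewrite subr_eq0 => /eqP h.
have : rnorm (b * z) < 1.
  by rewrite rnormM (le_lt_trans _ b1)// ler_piMr ?rnorm_ge0.
by rewrite -h rnorm1 ltxx.
Qed.

Lemma disc_algebra_inv (b : C) : rnorm b < 1 ->
  disc_algebra (fun z => (1 - b * z)^-1).
Proof.
move=> b1; apply: disc_algebra_derivable => z z1.
apply: derivableV; first by rewrite one_sub_neq0// -norm_le1.
by apply: derivableB; [exact: derivable_cst|apply: derivableM;
  [exact: derivable_cst|exact: derivable_id]].
Qed.

End disc_algebra.

Lemma blaschke_factor_le1 (b z : C) : rnorm b < 1 -> rnorm z <= 1 ->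
  rnorm ((z - b) / (1 - b^* * z)) <= 1.
Proof.
move=> b1 z1.
have d0 : 1 - b^* * z != 0 by rewrite one_sub_neq0// rnorm_conj.
rewrite rnormM rnormV ler_pdivrMr ?mul1r; last first.
  by rewrite lt_def rnorm_ge0 andbT; apply: contra d0 => /eqP/rnorm0_eq0 ->.
rewrite -(@ler_pXn2r _ 2) ?nnegrE ?rnorm_ge0// -subr_ge0.
have -> : rnorm (1 - b^* * z) ^+ 2 - rnorm (z - b) ^+ 2 =
    (1 - rnorm b ^+ 2) * (1 - rnorm z ^+ 2).
  have : (1 - b^* * z) * (1 - b^* * z)^* - (z - b) * (z - b)^* =
      (1 - b * b^*) * (1 - z * z^*).
    by rewrite !(rmorphB, rmorphM, rmorph1) /= conjCK; ring.
  rewrite !mul_conj => /(congr1 Re) /=; rewrite oppr0 !addr0 mulr0 subr0.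
  by move=> <-.
by rewrite mulr_ge0// subr_ge0 exprn_ile1 ?rnorm_ge0// ltW.
Qed.

Lemma rnorm_prod I (r : seq I) (F : I -> C) :
  rnorm (\prod_(i <- r) F i) = \prod_(i <- r) rnorm (F i).
Proof. exact: (big_morph (@rnorm R C) (@rnormM R) (rnorm1 R)). Qed.

Variables (N : nat) (c : C) (a : 'I_N -> C).
Hypothesis (N2 : (2 <= N)%N) (hc : `|c| = 1) (ha : forall k, `|a k| < 1).
Local Notation B := (blaschke c a).
Local Notation A := (alg_B0 B).

Let c1 : rnorm c = 1. Proof. exact/rnorm_eq1. Qed.
Let a1 k : rnorm (a k) < 1. Proof. by rewrite -norm_lt1. Qed.

Lemma blaschke_ind (P : (C -> C) -> Prop) :
  (forall b, P (fun=> b)) ->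
  (forall f g, P f -> P g -> P (fun z => f z * g z)) ->
  (forall b, rnorm b < 1 -> P (fun z => (z - b) / (1 - b^* * z))) -> P B.
Proof.
move=> Pc PM Pf; rewrite /blaschke; apply: (PM) => //.
elim: (index_enum 'I_N) => [|k r IH].
  by under [fun z => _]funext do rewrite big_nil; exact: Pc.
under [fun z => _]funext do rewrite big_cons; exact: (PM _ _ (Pf _ (a1 k)) IH).
Qed.

Lemma disc_algebra_blaschke : disc_algebra B.
Proof.
apply: blaschke_ind => [b|f g|b b1].
- exact: disc_algebra_cst.
- exact: disc_algebraM.
- apply: disc_algebraM; last by apply: disc_algebra_inv; rewrite rnorm_conj.
  by apply: disc_algebraD; [exact: disc_algebra_id|exact: disc_algebra_cst].
Qed.

Lemma poly_limit_id : poly_limit (fun z : C => z).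
Proof.
have -> : (fun z : C => z) = horner 'X by apply/funext => z; rewrite hornerX.
exact: poly_limit_poly.
Qed.

Lemma poly_limit_blaschke : poly_limit B.
Proof.
apply: blaschke_ind => [b|f g|b b1].
- exact: poly_limit_cst.
- exact: poly_limitM.
- apply: poly_limitM; last by apply: poly_limit_inv; rewrite rnorm_conj.
  by apply: poly_limitD; [exact: poly_limit_id|exact: poly_limit_cst].
Qed.

Lemma blaschke_le1 z : rnorm z <= 1 -> rnorm (B z) <= 1.
Proof.
move=> z1; rewrite rnormM c1 mul1r rnorm_prod.
by apply: prodr_ile1 => k _; rewrite rnorm_ge0 blaschke_factor_le1.
Qed.

Lemma sup_norm_lt (f : C -> C) (d e : R) : d < e ->
  (forall z, rnorm z <= 1 -> rnorm (f z) <= d) -> (sup_norm f < e%:E)%E.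
Proof.
move=> de fd; apply: (@le_lt_trans _ _ d%:E); last by rewrite lte_fin.
apply: ub_ereal_sup => _ [z zD <-]; rewrite lee_fin fd//.
by rewrite -norm_le1.
Qed.

Lemma sup_norm_ge (f : C -> C) z : rnorm z <= 1 -> ((rnorm (f z))%:E <= sup_norm f)%E.
Proof.
by move=> z1; apply: ereal_sup_ubound; exists z => //; rewrite /closed_disc/= norm_le1.
Qed.

Lemma alg_B_subalgebra : unital_subalgebra (alg_B B).
Proof.
split.
- exists 1, (fun=> 0); split; first exact: disc_algebra_cst.
  by move=> z _; rewrite mulr0 addr0.
- move=> f g [b [f' [hf fE]]] [d [g' [hg gE]]].
  exists (b + d), (fun z => f' z + g' z); split; first exact: disc_algebraD.
  by move=> z zD; rewrite /= fE// gE// mulrDr addrACA.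
- move=> d f [b [f' [hf fE]]].
  exists (d * b), (fun z => d * f' z); split.
    exact: disc_algebraM (disc_algebra_cst d) hf.
  by move=> z zD; rewrite fE//; ring.
- move=> f g [b [f' [hf fE]]] [d [g' [hg gE]]].
  exists (b * d), (fun z => b * g' z + (d * f' z + B z * (f' z * g' z))); split.
    have hB := disc_algebraM disc_algebra_blaschke (disc_algebraM hf hg).
    have hd := disc_algebraM (disc_algebra_cst d) hf.
    exact: disc_algebraD (disc_algebraM (disc_algebra_cst b) hg) (disc_algebraD hd hB).
  by move=> z zD; rewrite fE// gE//; ring.
Qed.

Lemma alg_B_mul f : disc_algebra f -> alg_B B (fun z => B z * f z).
Proof. by move=> hf; exists 0, f; split=> // z _; rewrite add0r. Qed.

Lemma alg_B_ext f g : (forall z, rnorm z <= 1 -> f z = g z) -> alg_B B f -> alg_B B g.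
Proof.
move=> fg [d [h [hh fE]]]; exists d, h; split=> // z zD.
by rewrite -fE// fg// -norm_le1.
Qed.

Lemma alg_B0_sub : A `<=` alg_B B.
Proof.
move=> f; apply => //.
- exact: alg_B_subalgebra.
- apply: (alg_B_ext (f := fun z => B z * 1)) => [z _|]; first by rewrite mulr1.
  exact/alg_B_mul/disc_algebra_cst.
- under [fun z => _]funext do rewrite mulrC.
  exact/alg_B_mul/disc_algebra_id.
Qed.

Lemma alg_B0_subalgebra : unital_subalgebra A.
Proof.
split.
- by move=> S _ [].
- by move=> f g Af Ag S h1 h2 h3 h4 h5; case: (h2) => _ D _ _; apply: D; [exact: Af|exact: Ag].
- by move=> d f Af S h1 h2 h3 h4 h5; case: (h2) => _ _ Z _; apply: Z; exact: Af.
- by move=> f g Af Ag S h1 h2 h3 h4 h5; case: (h2) => _ _ _ M; apply: M; [exact: Af|exact: Ag].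
Qed.

Lemma alg_B0_closed : sup_closed_in (alg_B B) A.
Proof.
move=> f Bf fA S h1 h2 h3 h4 h5; apply: (h3 _ Bf) => e /fA[g Ag fg].
by exists g => //; exact: Ag.
Qed.

Lemma alg_B0_blaschke : A B.
Proof. by move=> S h1 h2 h3 h4 h5. Qed.

Lemma alg_B0_Xblaschke : A (fun z => z * B z).
Proof. by move=> S h1 h2 h3 h4 h5. Qed.

Lemma alg_B0D f g : A f -> A g -> A (fun z => f z + g z).
Proof. by case: alg_B0_subalgebra => _ h _ _; exact: h. Qed.
Lemma alg_B0Z d f : A f -> A (fun z => d * f z).
Proof. by case: alg_B0_subalgebra => _ _ h _; exact: h. Qed.
Lemma alg_B0M f g : A f -> A g -> A (fun z => f z * g z).
Proof. by case: alg_B0_subalgebra => _ _ _ h; exact: h. Qed.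
Lemma alg_B0_cst d : A (fun=> d).
Proof.
rewrite (_ : (fun=> d) = fun z => d * cst 1 z); last by apply/funext => z; rewrite /= mulr1.
by apply: alg_B0Z; case: alg_B0_subalgebra.
Qed.
Lemma alg_B0X f n : A f -> A (fun z => f z ^+ n).
Proof.
move=> hf; elim: n => [|n IH]; first exact: alg_B0_cst.
by under [fun z => _]funext do rewrite exprS; exact: alg_B0M.
Qed.
Lemma alg_B0_sum I (r : seq I) (F : I -> C -> C) :
  (forall i, A (F i)) -> A (fun z => \sum_(i <- r) F i z).
Proof.
move=> AF; elim: r => [|i r IH].
  by under [fun z => _]funext do rewrite big_nil; exact: alg_B0_cst.
by under [fun z => _]funext do rewrite big_cons; exact: alg_B0D.
Qed.

Lemma alg_B0_limit f : alg_B B f -> disc_approx A f -> A f.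
Proof.
move=> Bf fA; apply: (alg_B0_closed Bf) => e e0.
have [g Ag fg] := fA _ (divr_gt0 e0 (ltr0Sn _ 1)); exists g => //.
by apply: sup_norm_lt fg; lra.
Qed.

Definition mono (i j : nat) (z : C) : C := z ^+ j * B z ^+ i.

Lemma alg_B0_mono_le i j : (j <= i)%N -> A (mono i j).
Proof.
move=> ji; rewrite (_ : mono i j = fun z => (z * B z) ^+ j * B z ^+ (i - j)).
  apply: alg_B0M; apply: alg_B0X; first exact: alg_B0_Xblaschke.
  exact: alg_B0_blaschke.
by apply/funext => z; rewrite exprMn -mulrA -exprD subnKC.
Qed.

Definition bnum : {poly C} := c *: \prod_(k < N) ('X - (a k)%:P).
Definition bden : {poly C} := \prod_(k < N) (1 - (a k)^* *: 'X).

Lemma blaschke_bden z : rnorm z <= 1 -> B z * bden.[z] = bnum.[z].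
Proof.
move=> z1; rewrite /blaschke hornerZ -mulrA; congr (_ * _).
rewrite !horner_prod -big_split /=; apply: eq_bigr => k _.
by rewrite !hornerE divfK// one_sub_neq0// rnorm_conj.
Qed.

Lemma coef_bnum : size bnum = N.+1 /\ bnum`_N = c.
Proof.
have c0 : c != 0 by apply/eqP => c0; move: c1; rewrite c0 rnorm0 => /eqP; rewrite eq_sym oner_eq0.
have sz : size (\prod_(k < N) ('X - (a k)%:P)) = N.+1.
  by rewrite size_prod_XsubC -[index_enum _]enumT size_enum_ord.
split; first by rewrite size_scale.
have := monic_prod_XsubC (index_enum 'I_N) predT a; rewrite monicE lead_coefE sz /=.
by rewrite coefZ => /eqP ->; rewrite mulr1.
Qed.

(** The top coefficient of [bden] is, up to sign, the product of the conjugates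
of the zeros. *)
Lemma coef_bden : (size bden <= N.+1)%N /\ rnorm bden`_N < 1.
Proof.
pose p (r : seq 'I_N) : {poly C} := \prod_(k <- r) (1 - (a k)^* *: 'X).
have H r : (size (p r) <= (size r).+1)%N /\ rnorm (p r)`_(size r) <= 1 /\
    ((0 < size r)%N -> rnorm (p r)`_(size r) < 1).
  elim: r => [|k r [IH1 [IH2 IH3]]].
    by rewrite /p big_nil size_poly1 coef1 /= rnorm1.
  have pE : p (k :: r) = p r - (a k)^* *: (p r * 'X).
    by rewrite /p big_cons mulrBl mul1r -scalerAl [X in _ *: X]mulrC.
  have cE : (p (k :: r))`_(size r).+1 = - (a k)^* * (p r)`_(size r).
    by rewrite pE coefB coefZ coefMX /= nth_default// sub0r mulNr.
  have lt1 : rnorm (p (k :: r))`_(size r).+1 < 1.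
    rewrite cE rnormM rnormN rnorm_conj (le_lt_trans _ (a1 k))//.
    by rewrite ler_piMr ?rnorm_ge0.
  split; last by split=> //; exact: ltW.
  rewrite pE (leq_trans (size_polyD _ _))// geq_max size_polyN; apply/andP; split.
    exact: leq_trans IH1 _.
  rewrite (leq_trans (size_scale_leq _ _))// (leq_trans (size_polyMleq _ _))//.
  by rewrite size_polyX addn2.
have [h1 [_ h2]] := H (index_enum 'I_N).
have E : size (index_enum 'I_N) = N by rewrite -[index_enum _]enumT size_enum_ord.
by rewrite E in h1 h2; split=> //; apply: h2; exact: leq_trans N2.
Qed.

(** Cancelling the top coefficient in [bnum = B bden] expresses
[z^N (c - q B)], where [|q| < 1 = |c|], through lower powers of [z]. *)
Lemma power_reduction (z : C) : rnorm z <= 1 -> z ^+ N * (c - bden`_N * B z) =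
  \sum_(l < N) (bden`_l * (z ^+ l * B z) - bnum`_l * z ^+ l).
Proof.
move=> z1; have := blaschke_bden z1.
have [s1 cN] := coef_bnum; have [s2 _] := coef_bden.
rewrite (horner_coef_wide _ s2) (@horner_coef_wide _ N.+1) ?s1//.
rewrite !big_ord_recr /= cN mulrDr => /eqP; rewrite -subr_eq0 => /eqP h.
rewrite big_split /= sumrN.
rewrite [X in _ = X - _](_ : _ = B z * \sum_(i < N) bden`_i * z ^+ i); last first.
  by rewrite mulr_sumr; apply: eq_bigr => i _; ring.
apply/eqP; rewrite -subr_eq0 -oppr_eq0; apply/eqP; rewrite -[RHS]h; ring.
Qed.

Lemma mono_le1 i j z : rnorm z <= 1 -> rnorm (mono i j z) <= 1.
Proof.
move=> z1; have B1 := blaschke_le1 z1; rewrite /mono (rnormM (z ^+ j)) !rnormX.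
by rewrite mulr_ile1 ?exprn_ge0 ?rnorm_ge0// exprn_ile1 ?rnorm_ge0.
Qed.

(** By induction on [j], the product of [mono N.-1 j] with [c - q B] is in the
algebra; the partial sums of the geometric series of [(c - q B)^-1] are in the
algebra as well, because [|q / c| < 1]. *)
Lemma alg_B0_mono_top j : A (mono N.-1 j).
Proof.
have [_ qlt] := coef_bden; set q := bden`_N in qlt.
elim/ltn_ind: j => j IH.
have [jN|Nj] := ltnP j N; first by apply: alg_B0_mono_le; case: (N) N2 jN.
have c0 : c != 0 by apply/eqP => c0; move: c1; rewrite c0 rnorm0 => /eqP; rewrite eq_sym oner_eq0.
pose h z : C := \sum_(l < N) (bden`_l * (mono N.-1 (l + (j - N)) z * B z)
                            - bnum`_l * mono N.-1 (l + (j - N)) z).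
have hE z : rnorm z <= 1 -> h z = mono N.-1 j z * (c - q * B z).
  move=> z1; rewrite /mono.
  have -> : z ^+ j = z ^+ N * z ^+ (j - N) by rewrite -exprD subnKC.
  transitivity (z ^+ N * (c - q * B z) * (z ^+ (j - N) * B z ^+ N.-1)); last by ring.
  rewrite power_reduction// mulr_suml; apply: eq_bigr => l _.
  by rewrite /mono exprD; ring.
have Ah : A h.
  apply: alg_B0_sum => l; have Al : A (mono N.-1 (l + (j - N))).
    by apply: IH; rewrite -{2}(subnK Nj) addnC ltn_add2l.
  have := alg_B0D (alg_B0Z bden`_l (alg_B0M Al alg_B0_blaschke))
                  (alg_B0Z (- bnum`_l) Al).
  by congr (A _); apply/funext => z; rewrite mulNr.
apply: alg_B0_limit.
  rewrite (_ : mono _ _ = fun z => B z * (z ^+ j * B z ^+ N.-2)).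
    apply: alg_B_mul; apply: disc_algebraM; apply: disc_algebraX.
      exact: disc_algebra_id.
    exact: disc_algebra_blaschke.
  apply/funext => z; rewrite /mono mulrCA -exprS.
  by rewrite prednK// -subn1 subn_gt0.
move=> e e0; have [M qM] := @pow_small R _ _ (rnorm_ge0 q) qlt e0.
exists (fun z => h z * (c^-1 * \sum_(i < M) (q / c * B z) ^+ i)).
  have AB : A (fun z => q / c * B z) := alg_B0Z _ alg_B0_blaschke.
  exact: alg_B0M Ah (alg_B0Z _ (alg_B0_sum _ (fun i => alg_B0X _ AB))).
move=> z z1; rewrite hE//.
have -> : mono N.-1 j z - mono N.-1 j z * (c - q * B z) *
    (c^-1 * \sum_(i < M) (q / c * B z) ^+ i) = mono N.-1 j z * (q / c * B z) ^+ M.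
  have := subrX1 (q / c * B z) M; set S := \sum_(i < M) _ => /(canRL (subrK _)) ->.
  by field.
have B1 := blaschke_le1 z1.
rewrite rnormM (rnormX (q / c * B z)) (rnormM (q / c)) (rnormM q) rnormV c1 invr1.
rewrite mulr1; apply: le_trans qM; rewrite -[leRHS]mul1r.
apply: ler_pM; rewrite ?exprn_ge0 ?mulr_ge0 ?rnorm_ge0 ?mono_le1//.
by rewrite lerXn2r ?nnegrE ?mulr_ge0 ?rnorm_ge0// ler_piMr ?rnorm_ge0.
Qed.

(** The exponents of the theorem, together with [(0, 0)] for the unit. *)
Definition admissible (i j : nat) : bool :=
  ((i <= N - 2) && (j <= i))%N || (i == N.-1).

Inductive mono_span : set (C -> C) :=
| mono_span_gen i j : admissible i j -> mono_span (mono i j)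
| mono_spanD f g : mono_span f -> mono_span g -> mono_span (fun z => f z + g z)
| mono_spanZ (d : C) f : mono_span f -> mono_span (fun z => d * f z).

Lemma mono_span_cst d : mono_span (fun=> d).
Proof.
have -> : (fun=> d) = fun z => d * mono 0 0 z.
  by apply/funext => z; rewrite /mono !expr0 !mulr1.
exact/mono_spanZ/mono_span_gen.
Qed.

Lemma alg_B0_mono i j : admissible i j -> A (mono i j).
Proof.
by case/orP => [/andP[_]|/eqP ->]; [exact: alg_B0_mono_le|exact: alg_B0_mono_top].
Qed.

Lemma mono_span_alg_B0 f : mono_span f -> A f.
Proof.
elim=> [i j|g h _ Ag _ Ah|d g _ Ag]; first exact: alg_B0_mono.
  exact: alg_B0D.
exact: alg_B0Z.
Qed.

Lemma poly_limit_mono i j : poly_limit (mono i j).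
Proof.
apply: poly_limitM; apply: poly_limitX; first exact: poly_limit_id.
exact: poly_limit_blaschke.
Qed.

Lemma mono_span_poly_limit f : mono_span f -> poly_limit f.
Proof.
elim=> [i j _|g h _ Ag _ Ah|d g _ Ag]; first exact: poly_limit_mono.
  exact: poly_limitD.
by apply: poly_limitM => //; exact: poly_limit_cst.
Qed.

Lemma mono_span_bounded f : mono_span f -> disc_bounded f.
Proof. by move=> /mono_span_poly_limit/poly_limit_bounded. Qed.

Local Notation approx := (disc_approx mono_span).

Lemma approxD f g : approx f -> approx g -> approx (fun z => f z + g z).
Proof. by apply: disc_approxD => h k; exact: mono_spanD. Qed.

Lemma approxZ d f : approx f -> approx (fun z => d * f z).
Proof.
move=> hf e e0; have d1 : 0 < rnorm d + 1 by rewrite ltr_wpDl ?rnorm_ge0.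
have [g sg fg] := hf _ (divr_gt0 e0 d1).
exists (fun z => d * g z); first exact: mono_spanZ.
move=> z z1; rewrite -mulrBr rnormM (le_trans (ler_wpM2l (rnorm_ge0 _) (fg z z1)))//.
by rewrite mulrA ler_pdivrMr// mulrC ler_wpM2l ?lerDl// ltW.
Qed.

Lemma mono_span_sum I (r : seq I) (F : I -> C -> C) :
  (forall i, mono_span (F i)) -> mono_span (fun z => \sum_(i <- r) F i z).
Proof.
move=> AF; elim: r => [|i r IH].
  by under [fun z => _]funext do rewrite big_nil; exact: mono_span_cst.
by under [fun z => _]funext do rewrite big_cons; exact: mono_spanD.
Qed.

(** Beyond the exponent [N.-1], the powers of [B] are replaced by polynomials
in [z], which the span absorbs. *)
Lemma approx_mono_top i j : (N.-1 <= i)%N -> approx (mono i j).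
Proof.
move=> Ni e e0; have [_ [p ->] Bp] := poly_limitX (i - N.-1) poly_limit_blaschke e0.
exists (fun z => mono N.-1 j z * p.[z]).
  rewrite (_ : (fun z => _) = fun z => \sum_(k < size p) p`_k * mono N.-1 (j + k) z).
    by apply: mono_span_sum => k; apply/mono_spanZ/mono_span_gen; rewrite /admissible eqxx orbT.
  apply/funext => z; rewrite horner_coef mulr_sumr; apply: eq_bigr => k _.
  by rewrite /mono exprD; ring.
move=> z z1; have -> : mono i j z = mono N.-1 j z * B z ^+ (i - N.-1).
  by rewrite /mono -mulrA -exprD subnKC.
by rewrite -mulrBr rnormM (le_trans _ (Bp z z1))// ler_piMl ?rnorm_ge0 ?mono_le1.
Qed.

Lemma approx_mono i j : (j <= i)%N || (N.-1 <= i)%N -> approx (mono i j).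
Proof.
have [Ni _|Ni] := leqP N.-1 i; first exact: approx_mono_top.
rewrite orbF => ji; apply/disc_approx_id/mono_span_gen/orP; left.
rewrite ji andbT; case: (N) N2 Ni => [|[|n]]//= _; by rewrite subSS subn1.
Qed.

Lemma admissibleE i j : admissible i j -> (j <= i)%N || (N.-1 <= i)%N.
Proof. by case/orP => [/andP[_ ->]//|/eqP ->]; rewrite leqnn orbT. Qed.

Lemma mono_spanM f g : mono_span f -> mono_span g -> approx (fun z => f z * g z).
Proof.
move=> sf sg; elim: sf => [i j ij|f1 f2 _ h1 _ h2|d f1 _ h1]; last first.
- by under [fun z => _]funext do rewrite -mulrA; exact: approxZ.
- by under [fun z => _]funext do rewrite mulrDl; exact: approxD.
elim: sg => [k l kl|g1 g2 _ h1 _ h2|d g1 _ h1]; last first.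
- by under [fun z => _]funext do rewrite mulrCA; exact: approxZ.
- by under [fun z => _]funext do rewrite mulrDr; exact: approxD.
have -> : (fun z => mono i j z * mono k l z) = mono (i + k) (j + l).
  by apply/funext => z; rewrite /mono !exprD; ring.
apply: approx_mono; have /orP[ji|Ni] := admissibleE ij; last first.
  by rewrite (leq_trans Ni) ?leq_addr ?orbT.
have /orP[lk|Nk] := admissibleE kl; first by rewrite leq_add.
by rewrite (leq_trans Nk) ?leq_addl ?orbT.
Qed.

(** The uniform limits of the span form a closed algebra: a product of two
admissible monomials is admissible or carries a power of [B] that
[approx_mono_top] reduces. *)
Lemma alg_B0_dense f : A f -> approx f.
Proof.
pose S := [set g | alg_B B g /\ approx g].
suff AS : A `<=` S by move=> /AS[].
have [AB1 ABD ABZ ABM] := alg_B_subalgebra.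
have AB : alg_B B B := alg_B0_sub alg_B0_blaschke.
have AXB : alg_B B (fun z => z * B z) := alg_B0_sub alg_B0_Xblaschke.
move=> g; apply => [h []//||h Bh hS||].
- split.
  + by split=> //; apply/disc_approx_id/mono_span_cst.
  + by move=> h k [Bh hh] [Bk hk]; split; [exact: ABD|exact: approxD].
  + by move=> d h [Bh hh]; split; [exact: ABZ|exact: approxZ].
  + move=> h k [Bh hh] [Bk hk]; split; first exact: ABM.
    apply: disc_approx_idem.
    apply: disc_approxW (disc_approxM mono_span_bounded mono_span_bounded hh hk).
    by move=> _ [u [v [su sv ->]]]; exact: mono_spanM.
- split=> //; apply: disc_approx_idem => e /hS[k [_ hk] hlt].
  exists k => // z z1; rewrite -lee_fin; apply: le_trans (ltW hlt).
  exact: (sup_norm_ge (h - k) z1).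
- split=> //; rewrite (_ : B = mono 1 0); first exact: approx_mono.
  by apply/funext => z; rewrite /mono mul1r.
- by split=> //; exact: (@approx_mono 1 1).
Qed.

End blaschke.

(** * Orthogonal projection onto the range of an isometry *)

Lemma conj_real (R : realType) (t : R) :
  (real_complex R t : [the numClosedFieldType of R[i]])^* = real_complex R t.
Proof. exact: conjc_real. Qed.

Lemma conj_realM (R : realType) (t : R) (z : [the numClosedFieldType of R[i]]) :
  (real_complex R t * z)^* = real_complex R t * z^*.
Proof. by rewrite rmorphM; congr (_ * _); exact: conj_real. Qed.

Section hilbert_space.
Variable R : realType.
Local Notation C := [the numClosedFieldType of R[i]].

Lemma seq_complete (H : hilbertType R) (u : nat -> H) :
  (forall e : R, 0 < e ->
     exists M, forall n, (M <= n)%N -> rnorm (u n - u M) <= e) ->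
  exists l : H, u @ \oo --> l.
Proof.
move=> uc; apply/cvg_ex; apply: cauchy_cvg; apply: cauchy_exP => e e0.
have e'0 : 0 < Re e / 2.
  by rewrite divr_gt0//; move: e0; rewrite ltcE => /andP[].
have [M uM] := uc _ e'0; exists (u M); exists M => // n /= Mn.
rewrite -ball_normE /= distrC normE.
have -> : e = (Re e)%:C by apply: real_complex_Re; exact: ltW.
rewrite ltcR; apply: le_lt_trans (uM n Mn) _; move: e'0; lra.
Qed.

Lemma ip_inj (H : hilbertType R) (x y : H) : (forall h, ip x h = ip y h) -> x = y.
Proof.
move=> xy; apply/eqP; rewrite -subr_eq0; apply/eqP/rnorm0_eq0.
apply/eqP; rewrite -sqrf_eq0 -(inj_eq (@complexI R)) -ip_self (siBl (ip_semi_inner H)) xy subrr.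
by rewrite rmorph0.
Qed.

Section projection.
Variables (H K : hilbertType R) (J : H -> K).
Hypothesis hJ : isometric_embedding J.
Let siK := ip_semi_inner K.
Let siH := ip_semi_inner H.
Let JD := linear_funD hJ.1.
Let JZ := linear_funZ hJ.1.
Let JB := linear_funB hJ.1.

Lemma isometric_embedding_norm x : rnorm (J x) = rnorm x.
Proof. by rewrite -!sinorm_ip /sinorm hJ.2. Qed.

(** A point of the range at minimal distance from [x]: a minimizing sequence is
Cauchy by the parallelogram law. *)
Lemma nearest_point x : exists h, forall h', rnorm (x - J h) <= rnorm (x - J h').
Proof.
pose S := [set rnorm (x - J h) ^+ 2 | h in [set: H]].
have hS : has_inf S.
  split; first by exists (rnorm (x - J 0) ^+ 2), 0.
  by exists 0 => _ [h _ <-]; exact: sqr_ge0.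
pose d := inf S.
have dle h : d <= rnorm (x - J h) ^+ 2 by apply: inf_lbound; [exact: hS.2|exists h].
have /choice[u hu] n : exists h, rnorm (x - J h) ^+ 2 <= d + n.+1%:R^-1.
  have [|_ [h _ <-] hlt] := inf_adherent (eps := n.+1%:R^-1) _ hS.
    by rewrite invr_gt0.
  by exists h; exact: ltW.
have dist n m : rnorm (u n - u m) ^+ 2 <= (n.+1%:R^-1 + m.+1%:R^-1) *+ 2.
  have := sinorm_parallelogram siK (x - J (u n)) (x - J (u m)).
  have -> : x - J (u n) - (x - J (u m)) = J (u m - u n).
    by rewrite JB opprB addrC addrA subrK.
  rewrite !sinorm_ip.
  rewrite isometric_embedding_norm rnormB.
  have -> : x - J (u n) + (x - J (u m)) = 2%:R *: (x - J (2^-1 *: (u n + u m))).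
    rewrite scalerBr -JZ scalerA divff ?pnatr_eq0// scale1r JD.
    by rewrite scaler_nat mulr2n opprD addrACA.
  rewrite rnormZ exprMn.
  have -> : rnorm (2%:R : C) = 2.
    by rewrite -[2%:R]/(2%:R : C) -(rmorph_nat (real_complex R)) rnorm_real ger0_norm.
  move: (rnorm (x - J (2^-1 *: (u n + u m)))) (dle (2^-1 *: (u n + u m))) (hu n) (hu m).
  move: (rnorm (x - J (u n))) (rnorm (x - J (u m))) (rnorm (u n - u m)) => p q r t.
  by move: n.+1%:R^-1 m.+1%:R^-1 => n' m'; lra.
have [e e0|l ul] := @seq_complete H u.
  have e2 : 0 < e ^+ 2 by rewrite exprn_gt0.
  have /archi_boundP : 0 <= 4 / e ^+ 2 by rewrite ltW// divr_gt0.
  set M := Num.bound _ => hM; exists M => n Mn.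
  rewrite -(@ler_pXn2r _ 2) ?nnegrE ?rnorm_ge0//; last exact: ltW.
  apply: le_trans (dist n M) _; rewrite ltr_pdivrMr// in hM.
  have M1 : 0 < M.+1%:R :> R by rewrite ltr0n.
  have : n.+1%:R^-1 <= M.+1%:R^-1 :> R by rewrite lef_pV2 ?posrE ?ltr0n// ler_nat.
  have : M.+1%:R^-1 * 4 <= e ^+ 2.
    rewrite mulrC ler_pdivrMr// (le_trans (ltW hM))// mulrC ler_pM2l// ler_nat.
    exact: leqnSn.
  by move: n.+1%:R^-1 M.+1%:R^-1 => n' M'; lra.
exists l => h'; apply/ler_addgt0Pr => e e0.
move/rnorm_cvgP: ul => ul.
have dh' : d <= rnorm (x - J h') ^+ 2 := dle h'.
have e20 : 0 < e / 2 by rewrite divr_gt0.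
have hinv : \forall n \near \oo, (n.+1%:R^-1 : R) <= (e / 2) ^+ 2.
  have /cvgrPdist_le/(_ ((e / 2) ^+ 2)) : (n.+1%:R^-1 : R) @[n --> \oo] --> 0.
    exact: cvg_harmonic.
  rewrite exprn_gt0// => /(_ isT); apply: filterS => n.
  by rewrite sub0r normrN ger0_norm ?invr_ge0.
have [n [un hn]] := @filter_ex _ \oo _ _ (filterI (ul _ e20) hinv).
have -> : x - J l = (x - J (u n)) + J (u n - l) by rewrite JB addrA subrK.
apply: le_trans (rnormD _ _) _; rewrite isometric_embedding_norm.
suff : rnorm (x - J (u n)) <= rnorm (x - J h') + e / 2 by lra.
rewrite -(@ler_pXn2r _ 2) ?nnegrE ?rnorm_ge0 ?addr_ge0 ?rnorm_ge0 ?(ltW e20)//.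
apply: le_trans (hu n) _; rewrite sqrrD.
have : 0 <= rnorm (x - J h') * (e / 2) by rewrite mulr_ge0 ?rnorm_ge0// ltW.
move: hn dh'; move: (rnorm (x - J h')) n.+1%:R^-1 (e / 2) => t n' e' *; lra.
Qed.

(** If the inner product [p] were not 0, moving [J h] by a small multiple of
[p *: J h'] would decrease the distance. *)
Lemma nearest_point_orthogonal x h : (forall h', rnorm (x - J h) <= rnorm (x - J h')) ->
  forall h', ip (x - J h) (J h') = 0.
Proof.
move=> hmin h'; set p := ip _ _; set w := x - J h in p *.
apply: rnorm0_eq0; set b := rnorm p.
have b0 : 0 <= b := rnorm_ge0 p.
have key (e : R) : 0 < e -> 2 * b ^+ 2 <= e * (b ^+ 2 * rnorm (J h') ^+ 2).
  move=> e0; have := hmin (h + (e%:C * p) *: h').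
  rewrite JD JZ opprD addrA -/w.
  rewrite -(@ler_pXn2r _ 2) ?nnegrE ?rnorm_ge0// -!sinorm_ip (sinormD_sqr siK w).
  rewrite sinormN// (sinormZ siK) siNr// siZr// ReN !sinorm_ip rnormM rnorm_real.
  have -> : (e%:C * p)^* * ip w (J h') = (e * b ^+ 2)%:C.
    by rewrite conj_realM -mulrA [_ * ip _ _]mulrC mul_conj -rmorphM.
  rewrite [Re _]/=.
  rewrite (ger0_norm (ltW e0)) -/b => h1.
  rewrite -(ler_pM2l e0); move: h1; rewrite !exprMn; lra.
apply/eqP; rewrite -sqrf_eq0 eq_le sqr_ge0 andbT.
set q := b ^+ 2 in key *; set v := rnorm _ ^+ 2 in key.
have v0 : 0 <= v by exact: sqr_ge0.
have q0 : 0 <= q by exact: sqr_ge0.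
have v1 : 0 < v + 1 by lra.
have := key (v + 1)^-1 ltac:(by rewrite invr_gt0).
rewrite [leRHS]mulrC ler_pdivlMr// => h1; have := mulr_ge0 q0 v0; lra.
Qed.

Lemma adjoint_exists : exists J' : K -> H, forall x h, ip x (J h) = ip (J' x) h.
Proof.
have /choice[J' hJ'] x : exists g, forall h, ip x (J h) = ip g h.
  have [g hg] := nearest_point x; exists g => h.
  rewrite -(hJ.2 g h); apply/eqP; rewrite -subr_eq0 -siBl//.
  exact/eqP/nearest_point_orthogonal.
by exists J'.
Qed.

Lemma orth_proj_eq (p x : K) : range J p -> (forall h, ip (x - p) (J h) = 0) ->
  orth_proj (range J) x = p.
Proof.
move=> Jp px; rewrite /orth_proj; set S := [set q | _].
have Sp : S p by split=> // _ [h _ <-].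
have [[g _ <-] hx] := xgetPex 0 (ex_intro _ p Sp).
case: Jp px => h _ <- px {Sp S}; congr J; apply: ip_inj => k; rewrite -hJ.2 -(hJ.2 h).
have /eqP := hx (J k) (ex_intro2 _ _ k I erefl); have /eqP := px k.
by rewrite !siBl// !subr_eq0 => /eqP <- /eqP <-.
Qed.

Variable J' : K -> H.
Hypothesis hJ' : forall x h, ip x (J h) = ip (J' x) h.

Lemma adjoint_linear : linear J'.
Proof.
by move=> c x y; apply: ip_inj => h; rewrite -hJ' !si_linear// !hJ'.
Qed.

Lemma adjointK h : J' (J h) = h.
Proof. by apply: ip_inj => g; rewrite -hJ' hJ.2. Qed.

Lemma adjoint_norm_le x : rnorm (J' x) <= rnorm x.
Proof.
have [->|n0] := eqVneq (rnorm (J' x)) 0; first exact: rnorm_ge0.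
have npos : 0 < rnorm (J' x) by rewrite lt_def n0 rnorm_ge0.
rewrite -(ler_pM2r npos) -expr2 -[leLHS]/(Re (rnorm (J' x) ^+ 2)%:C) -ip_self -hJ'.
rewrite -(isometric_embedding_norm (J' x)) -!sinorm_ip.
exact: le_trans (Re_le_rnorm _) (cauchy_schwarz siK _ _).
Qed.

Lemma orth_proj_adjoint x : orth_proj (range J) x = J (J' x).
Proof.
apply: orth_proj_eq => [|h]; first by exists (J' x).
by rewrite siBl// hJ.2 hJ' subrr.
Qed.

End projection.
End hilbert_space.

(** * Polynomials and Blaschke products of a unitary *)

Section unitary.
Variable R : realType.
Local Notation C := [the numClosedFieldType of R[i]].
Variables (K : hilbertType R) (U : K -> K).
Hypothesis hU : unitary U.
Let siK := ip_semi_inner K.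

Let UD := linear_funD hU.1.1.
Let U0 := linear_fun0 hU.1.1.
Let UZ := linear_funZ hU.1.1.
Let UB := linear_funB hU.1.1.

Lemma unitary_norm x : rnorm (U x) = rnorm x.
Proof.
case: hU => _ [U' [_ adj /(congr1 (@^~ x)) /= UK _]].
by rewrite -!sinorm_ip /sinorm adj UK.
Qed.

Lemma iter_unitary_norm k x : rnorm (iter k U x) = rnorm x.
Proof. by elim: k => //= k <-; rewrite unitary_norm. Qed.

Lemma iter_unitaryD k x y : iter k U (x + y) = iter k U x + iter k U y.
Proof. by elim: k => //= k ->. Qed.

Lemma iter_unitaryZ k c x : iter k U (c *: x) = c *: iter k U x.
Proof. by elim: k => //= k ->. Qed.

Lemma iter_unitary_sum I (r : seq I) (P : pred I) (F : I -> K) k :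
  iter k U (\sum_(i <- r | P i) F i) = \sum_(i <- r | P i) iter k U (F i).
Proof.
apply: (big_morph _ (iter_unitaryD k)); elim: k => //= k ->; exact: U0.
Qed.

Definition poly_op (p : {poly C}) (x : K) : K :=
  \sum_(k < size p) p`_k *: iter k U x.

Lemma poly_op_wide n (p : {poly C}) x : (size p <= n)%N ->
  poly_op p x = \sum_(k < n) p`_k *: iter k U x.
Proof.
move=> pn; rewrite /poly_op (big_ord_widen n (fun k => p`_k *: iter k U x))//.
rewrite big_mkcond; apply: eq_bigr => k _; case: ltnP => // kp.
by rewrite nth_default// scale0r.
Qed.

Lemma poly_opD p q x : poly_op (p + q) x = poly_op p x + poly_op q x.
Proof.
rewrite (poly_op_wide x (size_polyD p q)) (poly_op_wide x (leq_maxl (size p) (size q))).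
rewrite (poly_op_wide x (leq_maxr (size p) (size q))) -big_split /=.
by apply: eq_bigr => k _; rewrite coefD scalerDl.
Qed.

Lemma poly_opZ c p x : poly_op (c *: p) x = c *: poly_op p x.
Proof.
rewrite (poly_op_wide x (size_scale_leq c p)) scaler_sumr.
by apply: eq_bigr => k _; rewrite coefZ scalerA.
Qed.

Lemma poly_opC c x : poly_op c%:P x = c *: x.
Proof. by rewrite (poly_op_wide x (size_polyC_leq1 c)) big_ord1 coefC. Qed.

Lemma poly_opMX p x : poly_op (p * 'X) x = U (poly_op p x).
Proof.
rewrite (@poly_op_wide (size p).+1); last first.
  by rewrite (leq_trans (size_polyMleq _ _))// size_polyX addn2.
rewrite big_ord_recl coefMX eqxx scale0r add0r.
rewrite -[U _]/(iter 1 U _) iter_unitary_sum; apply: eq_bigr => k _.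
by rewrite coefMX /= UZ.
Qed.

Lemma poly_opX x : poly_op 'X x = U x.
Proof. by rewrite -['X]mul1r poly_opMX poly_opC scale1r. Qed.

Lemma poly_opM p q x : poly_op (p * q) x = poly_op p (poly_op q x).
Proof.
elim/poly_ind: p => [|p c IH].
  by rewrite mul0r /poly_op size_poly0 !big_ord0.
rewrite mulrDl !poly_opD mul_polyC poly_opZ poly_opC; congr (_ + _).
by rewrite mulrAC !poly_opMX IH.
Qed.

Lemma poly_opC_comm p q x : poly_op p (poly_op q x) = poly_op q (poly_op p x).
Proof. by rewrite -!poly_opM mulrC. Qed.

Lemma poly_op1 x : poly_op 1 x = x.
Proof. by rewrite poly_opC scale1r. Qed.

Lemma poly_opN p x : poly_op (- p) x = - poly_op p x.
Proof. by rewrite -scaleN1r poly_opZ scaleN1r. Qed.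

Lemma poly_opXn n x : poly_op 'X^n x = iter n U x.
Proof. by elim: n => [|n IH]; rewrite ?expr0 ?poly_op1// exprS mulrC poly_opMX IH. Qed.

Lemma one_sub_injective (b : C) : rnorm b < 1 -> injective (fun x => x - b *: U x).
Proof.
move=> b1 x y xy; apply/eqP; rewrite -subr_eq0; apply/eqP.
have E : x - y = b *: U (x - y).
  rewrite UB scalerBr -(subrKA (b *: U x)) xy.
  by rewrite addrC addrA subrK.
have /esym/eqP := congr1 (@rnorm R K) E; rewrite rnormZ unitary_norm.
rewrite -subr_eq0 -{2}[rnorm (x - y)]mul1r -mulrBl mulf_eq0 subr_eq0 lt_eqF//=.
by move/eqP/rnorm0_eq0.
Qed.

(** The solution is the limit of the iterates of the contraction
[x |-> y + b U x]. *)
Lemma one_sub_surjective (b : C) : rnorm b < 1 ->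
  forall y, exists x, x - b *: U x = y.
Proof.
move=> b1 y; have b1' : 0 < 1 - rnorm b by rewrite subr_gt0.
pose u n := iter n (fun x => y + b *: U x) 0.
pose D := rnorm y / (1 - rnorm b).
have D0 : 0 <= D by rewrite divr_ge0 ?rnorm_ge0// ltW.
have uD k : rnorm (u k) <= D.
  elim: k => [|k IH]; first by rewrite rnorm0.
  apply: le_trans (rnormD _ _) _; rewrite rnormZ unitary_norm -/(u k).
  have -> : D = rnorm y + rnorm b * D by rewrite /D; field; rewrite gt_eqF.
  by rewrite lerD2l ler_wpM2l ?rnorm_ge0.
have udist M k : rnorm (u (M + k)%N - u M) <= rnorm b ^+ M * D.
  elim: M => [|M IH]; first by rewrite subr0 mul1r.
  rewrite addSn /u !iterS -/(u _) -/(u M) opprD addrACA subrr add0r -scalerBr.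
  by rewrite -UB rnormZ unitary_norm exprS -mulrA ler_wpM2l ?rnorm_ge0.
have [e e0|l ul] := @seq_complete R K u.
  have D1 : 0 < D + 1 by rewrite ltr_wpDl.
  have [M hM] := pow_small (rnorm_ge0 b) b1 (divr_gt0 e0 D1).
  exists M => n /subnKC <-; apply: le_trans (udist _ _) _.
  rewrite ler_pdivlMr// in hM; apply: le_trans hM.
  by rewrite ler_wpM2l ?exprn_ge0 ?rnorm_ge0// lerDl.
exists l; apply/eqP; rewrite -subr_eq0; apply/eqP/rnorm0_eq0/eqP.
rewrite eq_le rnorm_ge0 andbT; apply/ler_addgt0Pr => e e0; rewrite add0r.
move/rnorm_cvgP: ul => /(_ _ (divr_gt0 e0 (ltr0Sn R 1)))[M _ hM].
have h1 := hM M (leqnn M); have h2 := hM M.+1 (leqnSn M).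
have -> : l - b *: U l - y = (l - u M.+1) + b *: U (u M - l).
  by rewrite /u iterS -/(u M) UB scalerBr opprD !addrA subrK addrAC.
apply: le_trans (rnormD _ _) _; rewrite rnormZ unitary_norm rnormB.
rewrite [leRHS]splitr lerD// -[leRHS]mul1r ler_pM ?rnorm_ge0//; exact: ltW.
Qed.

Lemma op_inv_one_sub (b : C) x : rnorm b < 1 ->
  op_inv (fun y => y - b *: U y) (x - b *: U x) = x.
Proof.
move=> b1; apply: one_sub_injective b1 _ _ _.
exact: (xgetPex 0 (ex_intro (fun y => y - b *: U y = x - b *: U x) x erefl)).
Qed.

Section blaschke_op.
Variables (N : nat) (c : C) (a : 'I_N -> C).
Hypothesis ha : forall k, `|a k| < 1.
Let a1 k : rnorm (a k)^* < 1. Proof. by rewrite rnorm_conj -norm_lt1. Qed.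

(** The inverses in [blaschke_op] cancel against the factors of [bden], so on
vectors [bden(U) x] the operator [B(U)] is a polynomial in [U]. *)
Lemma blaschke_op_bden x :
  blaschke_op c a U (poly_op (bden a) x) = poly_op (bnum c a) x.
Proof.
rewrite /blaschke_op /bnum poly_opZ /bden; congr (_ *: _).
elim: (index_enum 'I_N) x => [|k r IH] x; first by rewrite !big_nil !poly_op1.
rewrite !big_cons mulrC !poly_opM /= IH poly_opC_comm.
rewrite poly_opD poly_opN poly_opZ poly_op1 poly_opX op_inv_one_sub//.
by rewrite poly_opD poly_opN poly_opC poly_opX.
Qed.

Lemma bden_surjective m y : exists x, poly_op (bden a ^+ m) x = y.
Proof.
elim: m y => [|m IH] y; first by exists y; rewrite expr0 poly_op1.
suff [z hz] : exists z, poly_op (bden a) z = y.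
  by have [x hx] := IH z; exists x; rewrite exprS poly_opM hx.
rewrite /bden; elim: (index_enum 'I_N) y => [|k r IHr] y.
  by exists y; rewrite big_nil poly_op1.
have [z hz] := one_sub_surjective (a1 k) y; have [x hx] := IHr z.
exists x; rewrite big_cons poly_opM hx poly_opD poly_opN poly_opZ.
by rewrite poly_op1 poly_opX.
Qed.

Lemma iter_blaschke_op i m x :
  iter i (blaschke_op c a U) (poly_op (bden a ^+ (i + m)) x) =
  poly_op (bnum c a ^+ i * bden a ^+ m) x.
Proof.
elim: i m => [|i IH] m; first by rewrite expr0 mul1r.
rewrite iterS addSnnS IH.
have -> : bnum c a ^+ i * bden a ^+ m.+1 = bden a * (bnum c a ^+ i * bden a ^+ m).
  by rewrite exprS mulrCA.
by rewrite poly_opM blaschke_op_bden -poly_opM mulrA -exprS.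
Qed.

End blaschke_op.

End unitary.

(** * The von Neumann inequality for a matrix of polynomials *)

Section von_neumann.
Variable R : realType.
Local Notation C := [the numClosedFieldType of R[i]].

Lemma sum_ord_le n m (F : nat -> R) :
  (forall k, 0 <= F k) -> (forall k, (m <= k)%N -> F k = 0) ->
  \sum_(k < n) F k <= \sum_(k < m) F k.
Proof.
move=> F0 Fm; have [nm|mn] := leqP n m.
  rewrite (big_ord_widen _ F nm) big_mkcond ler_sum// => k _.
  by case: ifP.
rewrite [leRHS](big_ord_widen _ F (ltnW mn)) [leRHS]big_mkcond ler_sum// => k _.
by case: ltnP => // /Fm ->.
Qed.

(** The number [n] of equal terms will grow while the number [d] of uncontrolled
terms at each end stays fixed. *)
Lemma sum_plateau (d n : nat) (f : nat -> R) (x D : R) :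
  (forall t, (d <= t < d + n)%N -> f t = x) -> (forall t, 0 <= f t <= D) ->
  n%:R * x <= \sum_(t < d + n + d) f t <= n%:R * x + D *+ (d + d).
Proof.
move=> fx fD; rewrite -(big_mkord xpredT f).
rewrite (@big_cat_nat _ _ _ (d + n))//= ?leq_addr//.
rewrite (@big_cat_nat _ _ _ d 0 (d + n))//= ?leq_addr//.
have -> : \sum_(d <= t < d + n) f t = n%:R * x.
  rewrite (eq_big_nat _ _ fx) sumr_const_nat addKn mulr_natl//.
have h k m : 0 <= \sum_(k <= t < m) f t <= D *+ (m - k).
  rewrite sumr_ge0 /= => [|t _]; last by case/andP: (fD t).
  by rewrite -sumr_const_nat ler_sum// => t _; case/andP: (fD t).
have := h 0%N d; have := h (d + n)%N (d + n + d)%N.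
rewrite subn0 addKn mulrnDr; move: (D *+ d) => D' /andP[h1 h2] /andP[h3 h4].
by apply/andP; split; lra.
Qed.

Variables (K : hilbertType R) (U V : K -> K).
Hypothesis (hV : unitary V) (VU : cancel U V).
Let siK := ip_semi_inner K.

(** [U] maps [orbit_poly n y z] to its multiple by [z], up to the two terms at
the ends of the sum. *)
Definition orbit_poly n (y : K) (z : C) : K := \sum_(k < n) z ^+ k *: iter k V y.

(** The coefficient of [z^t] in [p(z) orbit_poly n y z]. *)
Definition orbit_coef (p : {poly C}) n (y : K) (t : nat) : K :=
  \sum_(k < n) (p * 'X^k)`_t *: iter k V y.

Lemma orbit_coefE (p : {poly C}) n d y (z : C) : (size p <= d)%N ->
  \sum_(t < n + d) z ^+ t *: orbit_coef p n y t = p.[z] *: orbit_poly n y z.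
Proof.
move=> pd; under eq_bigr do rewrite scaler_sumr.
rewrite exchange_big scaler_sumr; apply: eq_bigr => k _ /=.
rewrite scalerA -[z ^+ k]hornerXn -hornerM (@horner_coef_wide _ (n + d)).
  by rewrite scaler_suml; apply: eq_bigr => t _; rewrite scalerA mulrC.
rewrite (leq_trans (size_polyMleq _ _))// size_polyXn addnS /= addnC.
by rewrite leq_add// ltnW.
Qed.

(** Away from the ends, the coefficients are those of [orbit_poly] for the vector
[p(U) y]. *)
Lemma orbit_coef_mid (p : {poly C}) n d y t : (size p <= d)%N -> (d <= t < n)%N ->
  orbit_coef p n y t = iter t V (poly_op U p y).
Proof.
move=> pd /andP[dt tn].
have pt : (size p <= t.+1)%N by rewrite (leq_trans pd)// ltnW.
rewrite (poly_op_wide U y pt) (iter_unitary_sum hV).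
have -> : orbit_coef p n y t = \sum_(k < t.+1) p`_(t - k) *: iter k V y.
  rewrite (big_ord_widen n (fun k => p`_(t - k) *: iter k V y))//.
  rewrite [RHS]big_mkcond; apply: eq_bigr => k _; rewrite coefMXn ltnS.
  by case: leqP => //; rewrite scale0r.
rewrite (reindex_inj rev_ord_inj); apply: eq_bigr => l _ /=.
have lt : (l <= t)%N by rewrite -ltnS.
rewrite subSS subKn// (iter_unitaryZ hV); congr (_ *: _).
move: (nat_of_ord l) lt => {}l lt; rewrite -{2}(subnK lt) iterD.
by congr (iter _ V _); elim: l {lt} => //= k IH; rewrite -iterS iterSr VU.
Qed.

Lemma orbit_coef_le (p : {poly C}) n y t :
  rnorm (orbit_coef p n y t) <= (\sum_(l < size p) rnorm p`_l) * rnorm y.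
Proof.
apply: le_trans (rnorm_sum _ _ _) _.
under eq_bigr do rewrite rnormZ (iter_unitary_norm hV).
rewrite -mulr_suml ler_wpM2r ?rnorm_ge0//.
apply: le_trans (@sum_ord_le _ t.+1 (fun k => rnorm (p * 'X^k)`_t) _ _) _.
- by move=> k; exact: rnorm_ge0.
- by move=> k tk; rewrite coefMXn tk rnorm0.
rewrite (reindex_inj rev_ord_inj) /=.
under eq_bigr => l _.
  rewrite subSS coefMXn ltnNge leq_subr /= subKn; last by rewrite -ltnS.
  over.
apply: (@sum_ord_le _ _ (fun l => rnorm p`_l)) => [l|l pl]; first exact: rnorm_ge0.
by rewrite nth_default// rnorm0.
Qed.

(** The sum of the squares of the norms of the coefficients of
[p(z) orbit_poly n y z] is [n |p(U) y|^2] up to a bounded error.  By Parseval it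
is also a mean over roots of unity [z], where the scalar hypothesis applies.
Dividing by [n] and letting [n] tend to infinity removes the error. *)
Theorem unitary_matrix_bound r (P : 'I_r -> 'I_r -> {poly C}) (q : {poly C})
    (b : R) : 0 <= b ->
  (forall z, rnorm z = 1 -> forall v : 'I_r -> C,
     \sum_(i < r) rnorm (\sum_(j < r) (P i j).[z] * v j) ^+ 2 <=
     b * (rnorm q.[z] ^+ 2 * \sum_(j < r) rnorm (v j) ^+ 2)) ->
  forall y : 'I_r -> K,
    \sum_(i < r) rnorm (\sum_(j < r) poly_op U (P i j) (y j)) ^+ 2 <=
    b * \sum_(j < r) rnorm (poly_op U q (y j)) ^+ 2.
Proof.
move=> b0 hP y.
pose d := (\max_(i < r) \max_(j < r) size (P i j) + size q)%N.
have Pd i j : (size (P i j) <= d)%N.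
  rewrite (leq_trans _ (leq_addr _ _))//.
  by rewrite (leq_trans _ (leq_bigmax i))// (leq_trans _ (leq_bigmax j)).
have qd : (size q <= d)%N by rewrite leq_addl.
set L := \sum_(i < r) _; set Q := \sum_(j < r) _.
pose S (j : 'I_r) := (\sum_(l < size q) rnorm q`_l) * rnorm (y j).
pose D := \sum_(j < r) S j ^+ 2.
have key (n' : nat) : n'.+1%:R * L <= b * (n'.+1%:R * Q + D *+ (d + d)).
  (* Orbits of length [n] leave [N'] undisturbed coefficients among the [m]
     coefficients of the product with a polynomial of size at most [d]. *)
  set N' := n'.+1; pose n := (d + N')%N; pose m := (n + d)%N.
  have m0 : (0 < m)%N by rewrite /m /n addnS.
  have [w wm w1] := @primitive_root_exists R m m0.
  pose cP i t := \sum_(j < r) orbit_coef (P i j) n (y j) t.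
  have mean (x : nat -> K) : \sum_(l < m) rnorm (\sum_(t < m) (w ^+ l) ^+ t *: x t) ^+ 2
      = m%:R * \sum_(t < m) rnorm (x t) ^+ 2.
    have := parseval siK (fun t : 'I_m => x t) wm w1.
    under eq_bigr do rewrite sinorm_ip.
    by move=> ->; under eq_bigr do rewrite sinorm_ip.
  have le1 : \sum_(i < r) \sum_(t < m) rnorm (cP i t) ^+ 2 <=
      b * \sum_(j < r) \sum_(t < m) rnorm (orbit_coef q n (y j) t) ^+ 2.
    have mpos : 0 < m%:R :> R by rewrite ltr0n.
    rewrite -(ler_pM2l mpos) mulrCA !mulr_sumr.
    under eq_bigr do rewrite -mean; rewrite exchange_big /=.
    under [leRHS]eq_bigr do rewrite -mean mulr_sumr; rewrite [leRHS]exchange_big /=.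
    apply: ler_sum => l _; set z := w ^+ l.
    have z1 : rnorm z = 1 by rewrite rnormX w1 expr1n.
    have cE i : \sum_(t < m) z ^+ t *: cP i t =
        \sum_(j < r) (P i j).[z] *: orbit_poly n (y j) z.
      under eq_bigr do rewrite scaler_sumr; rewrite exchange_big /=.
      by apply: eq_bigr => j _; rewrite orbit_coefE.
    under eq_bigr do rewrite cE -sinorm_ip.
    apply: le_trans (scalar_matrix_bound siK (b := b * rnorm q.[z] ^+ 2) _ _) _.
      by move=> v; rewrite -mulrA; exact: hP.
    rewrite -mulrA mulr_sumr mulr_sumr; apply: ler_sum => j _.
    by rewrite orbit_coefE// rnormZ exprMn sinorm_ip.
  apply: le_trans (le_trans le1 _).
    rewrite mulr_sumr; apply: ler_sum => i _.
    pose D' := \sum_(t < m) rnorm (cP i t) ^+ 2.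
    pose f t := if (t < m)%N then rnorm (cP i t) ^+ 2 else 0.
    have f1 t : (d <= t < d + N')%N ->
        f t = rnorm (\sum_(j < r) poly_op U (P i j) (y j)) ^+ 2.
      move=> /andP[dt tN]; rewrite /f (leq_trans tN) ?leq_addr//.
      rewrite -[in RHS](iter_unitary_norm hV t) (iter_unitary_sum hV).
      congr (rnorm _ ^+ 2); apply: eq_bigr => j _.
      by rewrite (orbit_coef_mid _ (Pd i j)) ?dt.
    have f2 t : 0 <= f t <= D'.
      rewrite /f; case: ltnP => tm; last by rewrite lexx sumr_ge0// => *; exact: sqr_ge0.
      rewrite sqr_ge0 /= /D' (bigD1 (Ordinal tm))//= lerDl sumr_ge0// => *; exact: sqr_ge0.
    have /andP[h _] := sum_plateau f1 f2; apply: le_trans h _.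
    by apply: ler_sum => t _; rewrite /f ltn_ord.
  rewrite ler_wpM2l// mulr_sumr /D -sumrMnl -big_split /=.
  apply: ler_sum => j _; pose f t := rnorm (orbit_coef q n (y j) t) ^+ 2.
  have f1 t : (d <= t < d + N')%N -> f t = rnorm (poly_op U q (y j)) ^+ 2.
    by move=> dtN; rewrite /f (orbit_coef_mid _ qd dtN) (iter_unitary_norm hV).
  have f2 t : 0 <= f t <= S j ^+ 2.
    rewrite /f sqr_ge0 lerXn2r ?nnegrE ?rnorm_ge0 ?orbit_coef_le//.
    by rewrite mulr_ge0 ?rnorm_ge0// sumr_ge0// => *; exact: rnorm_ge0.
  by have /andP[_] := sum_plateau f1 f2.
rewrite leNgt; apply/negP => lt0; have d0 : 0 < L - b * Q by rewrite subr_gt0.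
have E0 : 0 <= b * (D *+ (d + d)) / (L - b * Q).
  rewrite divr_ge0 ?(ltW d0)// mulr_ge0// mulrn_wge0// sumr_ge0// => *; exact: sqr_ge0.
have := archi_boundP E0; set M := Num.bound _; have := key M.
rewrite mulrDr mulrCA -lerBlDl -mulrBr ltr_pdivrMr// => h1 h2.
have : M%:R * (L - b * Q) <= M.+1%:R * (L - b * Q) by rewrite ler_pM2r// ler_nat.
by move=> h3; have := lt_le_trans h2 (le_trans h3 h1); rewrite ltxx.
Qed.

End von_neumann.

(** * Norms of operator matrices *)

Section operator_norms.
Variable R : realType.
Local Notation C := [the numClosedFieldType of R[i]].

Lemma dot_semi_inner r :
  semi_inner (fun u v : 'I_r -> C => \sum_(i < r) u i * (v i)^*).
Proof.
split=> [d x y z|x y|x].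
- rewrite mulr_sumr -big_split; apply: eq_bigr => i _ /=.
  by rewrite mulrA -mulrDl.
- rewrite rmorph_sum; apply: eq_bigr => i _.
  by rewrite rmorphM /= conjCK mulrC.
- by apply: sumr_ge0 => i _; rewrite mul_conjC_ge0.
Qed.

Section l2norm.
Variables (V : normedModType C) (r : nat).
Implicit Types x y : 'I_r -> V.

Lemma l2norm_ge0 x : 0 <= l2norm x.
Proof. exact: sqrtr_ge0. Qed.

Lemma l2norm_sqr x : l2norm x ^+ 2 = \sum_(i < r) rnorm (x i) ^+ 2.
Proof. by rewrite sqr_sqrtr// sumr_ge0// => i _; exact: sqr_ge0. Qed.

Lemma l2norm_le_sqr x (b : R) : 0 <= b ->
  \sum_(i < r) rnorm (x i) ^+ 2 <= b ^+ 2 -> l2norm x <= b.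
Proof.
by move=> b0; rewrite -l2norm_sqr ler_pXn2r// nnegrE l2norm_ge0.
Qed.

Lemma l2normE x : l2norm x =
  sinorm (fun u v : 'I_r -> C => \sum_(i < r) u i * (v i)^*) (fun i => (rnorm (x i))%:C).
Proof.
rewrite /sinorm /l2norm Re_sum; congr Num.sqrt; apply: eq_bigr => i _.
by rewrite mul_conj rnorm_real /= ger0_norm// rnorm_ge0.
Qed.

Lemma l2norm_coord x i : rnorm (x i) <= l2norm x.
Proof.
rewrite -(@ler_pXn2r _ 2) ?nnegrE ?rnorm_ge0 ?l2norm_ge0// l2norm_sqr.
by rewrite (bigD1 i)//= lerDl sumr_ge0// => *; exact: sqr_ge0.
Qed.

Lemma l2normZ (d : C) x : l2norm (fun i => d *: x i) = rnorm d * l2norm x.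
Proof.
apply/eqP; rewrite -(@eqrXn2 _ 2)// ?mulr_ge0 ?l2norm_ge0 ?rnorm_ge0//.
rewrite exprMn !l2norm_sqr mulr_sumr; apply/eqP; apply: eq_bigr => i _.
by rewrite rnormZ exprMn.
Qed.

Lemma l2norm_le_sum x : l2norm x <= \sum_(i < r) rnorm (x i).
Proof.
apply: l2norm_le_sqr; first by rewrite sumr_ge0// => *; exact: rnorm_ge0.
rewrite expr2 mulr_suml; apply: ler_sum => i _.
rewrite expr2 ler_wpM2l ?rnorm_ge0// (bigD1 i)//= lerDl sumr_ge0// => *.
exact: rnorm_ge0.
Qed.
End l2norm.

Lemma l2normD (V : normedModType C) r (x y : 'I_r -> V) :
  l2norm (fun i => x i + y i) <= l2norm x + l2norm y.
Proof.
rewrite !l2normE; apply: le_trans (sinormD (dot_semi_inner r) _ _).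
rewrite -!l2normE /sinorm ler_wsqrtr// Re_sum ler_sum// => i _.
rewrite mul_conj /= lerXn2r ?nnegrE ?rnorm_ge0// (le_trans (rnormD _ _))//.
have -> : ((fun i => (rnorm (x i))%:C) + (fun i => (rnorm (y i))%:C) : 'I_r -> C) i
    = (rnorm (x i) + rnorm (y i))%:C by rewrite rmorphD.
by rewrite rnorm_real ger0_norm// addr_ge0 ?rnorm_ge0.
Qed.

(** The supremum over the unit ball bounds the quotients of norms; the norm of
[x] is increased slightly to avoid a division by zero. *)
Lemma op_norm_forP (E : lmodType C) (nu : E -> R) (T : E -> E) (b : R) :
  (forall x, 0 <= nu x) -> (forall (t : R) x, 0 <= t -> nu (t%:C *: x) = t * nu x) ->
  (forall (t : R) x, T (t%:C *: x) = t%:C *: T x) -> 0 <= b ->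
  (op_norm_for nu T <= b%:E)%E -> forall x, nu (T x) <= b * nu x.
Proof.
move=> nu0 nuZ TZ b0 Tb x; apply/ler_addgt0Pr => e e0.
have b1 : 0 < b + 1 by rewrite ltr_wpDl.
pose d := nu x + e / (b + 1).
have d0 : 0 < d by rewrite ltr_wpDl// divr_gt0.
have t0 : 0 <= d^-1 by rewrite invr_ge0 ltW.
have : ((nu (T (d^-1%:C *: x)))%:E <= b%:E)%E.
  apply: le_trans Tb; apply: ereal_sup_ubound; exists (d^-1%:C *: x) => //=.
  by rewrite nuZ// mulrC ler_pdivrMr// mul1r lerDl ltW// divr_gt0.
rewrite lee_fin TZ nuZ// mulrC ler_pdivrMr// => /le_trans; apply.
rewrite mulrDr lerD2l mulrA ler_pdivrMr// mulrC ler_wpM2l ?(ltW e0)//.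
by rewrite lerDl.
Qed.

Lemma op_norm_for_le (E : Type) (nu : E -> R) (T : E -> E) (b : R) :
  (forall x, nu x <= 1 -> nu (T x) <= b) -> (op_norm_for nu T <= b%:E)%E.
Proof. by move=> h; apply: ub_ereal_sup => _ [x /= x1 <-]; rewrite lee_fin h. Qed.

Lemma op_normP (V : normedModType C) (T : V -> V) (b : R) : linear T -> 0 <= b ->
  (op_norm T <= b%:E)%E -> forall x, rnorm (T x) <= b * rnorm x.
Proof.
move=> TL b0; apply: op_norm_forP => // [x|t x t0|t x]; first exact: rnorm_ge0.
  by rewrite rnormZ rnorm_real ger0_norm.
exact: linear_funZ.
Qed.

(** A crude bound, for error terms and for the finiteness of a constant. *)
Lemma op_mx_act_le (V : normedModType C) r (T : 'M[V -> V]_r) (d : R) :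
  0 <= d -> (forall i j x, rnorm (T i j x) <= d * rnorm x) ->
  forall x, l2norm (op_mx_act T x) <= (r%:R * r%:R * d) * l2norm x.
Proof.
move=> d0 Td x; apply: le_trans (l2norm_le_sum _) _.
have -> : r%:R * r%:R * d * l2norm x = \sum_(i < r) \sum_(j < r) d * l2norm x.
  under eq_bigr do rewrite sumr_const card_ord.
  by rewrite sumr_const card_ord -[RHS]mulr_natl -[X in _ = _ * X]mulr_natl !mulrA.
apply: ler_sum => i _; apply: le_trans (rnorm_sum _ _ _) _.
apply: ler_sum => j _; apply: le_trans (Td _ _ _) _.
by rewrite ler_wpM2l// l2norm_coord.
Qed.

Lemma mx_sup_norm_ge0 r (F : 'M[C -> C]_r) : (0 <= mx_sup_norm F)%E.
Proof.
have z0 : @closed_disc R 0 by rewrite /closed_disc /= normr0.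
apply: (@le_trans _ _ (mx_op_norm (map_mx (fun f => f (0 : C)) F))); last first.
  by apply: ereal_sup_ubound; exists 0.
apply: (@le_trans _ _ (l2norm (op_mx_act (map_mx (fun m x : C => m * x)
   (map_mx (fun f => f (0 : C)) F)) (fun=> 0)))%:E); first by rewrite lee_fin l2norm_ge0.
apply: ereal_sup_ubound; exists (fun=> 0) => //=.
by rewrite /l2norm big1 ?sqrtr0// => i _; rewrite rnorm0 expr0n.
Qed.

Lemma mx_sup_normP r (F : 'M[C -> C]_r) (b : R) : 0 <= b ->
  (mx_sup_norm F <= b%:E)%E <->
  forall z, rnorm z <= 1 -> forall v : 'I_r -> C,
    l2norm (fun i => \sum_(j < r) F i j z * v j) <= b * l2norm v.
Proof.
move=> b0.
have actE z v : op_mx_act (map_mx (fun m x : C => m * x) (map_mx (fun f => f z) F)) v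
    = fun i => \sum_(j < r) F i j z * v j.
  by apply/funext => i; apply: eq_bigr => j _; rewrite !mxE.
split=> [Fb z z1 v|Fb].
  have {}Fb : (mx_op_norm (map_mx (fun f => f z) F) <= b%:E)%E.
    apply: le_trans Fb; apply: ereal_sup_ubound; exists z => //.
    by rewrite /closed_disc/= norm_le1.
  rewrite -actE; apply: (op_norm_forP _ _ _ b0 Fb) => [x|t x t0|t x].
  - exact: l2norm_ge0.
  - by rewrite (l2normZ t%:C x) rnorm_real ger0_norm.
  - rewrite !actE; apply/funext => i; rewrite -[RHS]/(_ *: _) scaler_sumr.
    by apply: eq_bigr => j _; exact: mulrCA.
apply: ub_ereal_sup => _ [z z1 <-]; apply: op_norm_for_le => v v1.
rewrite actE (le_trans (Fb z _ v))// -?norm_le1//.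
by rewrite -[leRHS]mulr1 ler_wpM2l.
Qed.

End operator_norms.

(** * Dilations yield complete contractivity *)

Section dilation.
Variable R : realType.
Local Notation C := [the numClosedFieldType of R[i]].
Variables (N : nat) (c : C) (a : 'I_N -> C).
Hypothesis (N2 : (2 <= N)%N) (hc : `|c| = 1) (ha : forall k, `|a k| < 1).
Local Notation B := (blaschke c a).
Local Notation A := (alg_B0 B).
Local Notation Q := (bden a).
Local Notation span := (mono_span c a).
Variables (H : hilbertType R) (pi : (C -> C) -> H -> H).
Hypothesis hpi : unital_representation A pi.

Let spanA f : span f -> A f. Proof. exact: mono_span_alg_B0. Qed.

Lemma representation_linear f : A f -> linear (pi f).
Proof. by move=> /(repr_bounded_operator hpi)[]. Qed.

(** The boundedness of [pi], in the form that carries estimates over from a dense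
subset. *)
Lemma representation_dist : exists2 M : R, 0 <= M & forall f g (e : R), A f -> A g ->
  0 <= e -> (forall z, rnorm z <= 1 -> rnorm (f z - g z) <= e) ->
  forall x, rnorm (pi f x - pi g x) <= M * e * rnorm x.
Proof.
have [M hM] := repr_bounded hpi.
exists `|M| => // f g e Af Ag e0 fg x.
have AN : A (fun z => -1 * g z) by exact: alg_B0Z.
have Afg : A (f \+ (fun z => -1 * g z)) by exact: alg_B0D.
have -> : pi f x - pi g x = pi (f \+ (fun z => -1 * g z)) x.
  by rewrite (repr_add hpi)//= (repr_scale hpi)// scaleN1r.
have [fL _] := repr_bounded_operator hpi Afg.
apply: op_normP => //; first exact: mulr_ge0.
have se : (sup_norm (f \+ (fun z => -1 * g z))%R <= e%:E)%E.
  apply: ub_ereal_sup => _ [z z1 <-]; rewrite lee_fin /= mulN1r fg//.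
  by rewrite -norm_le1.
have s0 : (0 <= sup_norm (f \+ (fun z => -1 * g z))%R)%E.
  apply: le_trans (sup_norm_ge _ (z := 0) _); last by rewrite rnorm0.
  by rewrite lee_fin rnorm_ge0.
apply: le_trans (hM _ Afg) _.
apply: (@le_trans _ _ (`|M|%:E * sup_norm (f \+ (fun z => -1 * g z))%R)%E).
  by rewrite lee_wpmul2r// lee_fin ler_norm.
by rewrite EFinM lee_wpmul2l// lee_fin.
Qed.

Section sufficiency.
Variables (K : hilbertType R) (J : H -> K) (U : K -> K).
Hypothesis (hJ : isometric_embedding J) (hU : unitary U).
Hypothesis hdil : forall i j : nat,
  ((1 <= i)%N /\ (i <= N - 2)%N /\ (j <= i)%N) \/ i = (N - 1)%N ->
  forall h : H, J (pi (fun z => z ^+ j * B z ^+ i) h) =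
    orth_proj (range J) (iter j U (iter i (blaschke_op c a U) (J h))).
Variables (J' : K -> H) (hJ' : forall x h, ip x (J h) = ip (J' x) h).

Lemma J_inj : injective J.
Proof. by move=> x y xy; rewrite -(adjointK hJ hJ' x) xy (adjointK hJ hJ'). Qed.

(** The span has the common denominator [Q ^ (N - 1)].  Writing [f = P / Q ^ (N - 1)],
the vector [y = Q(U) ^ -(N - 1) (J h)] makes [f(U) (J h)] equal to [P(U) y]. *)
Lemma span_compression f : span f -> exists P : {poly C},
  (forall z, rnorm z <= 1 -> P.[z] = Q.[z] ^+ N.-1 * f z) /\
  forall h y, poly_op U (Q ^+ N.-1) y = J h -> pi f h = J' (poly_op U P y).
Proof.
elim=> [i j ij|f1 f2 s1 [P1 [h1 k1]] s2 [P2 [h2 k2]]|d g sg [P [h1 k1]]].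
- have iN : (i <= N.-1)%N.
    case/orP: ij => [/andP[iN _]|/eqP ->//].
    by rewrite (leq_trans iN)// -subn1 leq_sub2l.
  exists ('X^j * (bnum c a ^+ i * Q ^+ (N.-1 - i))); split=> [z z1|h y yh].
    rewrite !(hornerM, horner_exp, hornerX) -(blaschke_bden _ ha z1) exprMn /mono.
    by rewrite -{2}(subnKC iN) exprD; ring.
  rewrite (poly_opM hU) (poly_opXn hU) -(iter_blaschke_op hU _ ha) subnKC// yh.
  have [i0|i0] := posnP i.
    have j0 : j = 0%N.
      case/orP: ij => [/andP[_]|/eqP iE]; first by rewrite i0 leqn0 => /eqP.
      by move: iE N2; rewrite i0; case: (N) => [|[]].
    rewrite i0 j0 /= (adjointK hJ hJ').
    rewrite (_ : mono c a 0 0 = cst 1) ?(repr_one hpi)//.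
    by apply/funext => z; rewrite /mono !expr0 mulr1.
  apply: J_inj; rewrite -(orth_proj_adjoint hJ hJ'); apply: hdil.
  case/orP: ij => [/andP[h1 h2]|/eqP ->]; [by left|by right; rewrite subn1].
- exists (P1 + P2); split=> [z z1|h y yh]; first by rewrite hornerD h1// h2// mulrDr.
  rewrite (repr_add hpi (spanA s1) (spanA s2)) /= (k1 _ _ yh) (k2 _ _ yh) poly_opD//.
  by rewrite (linear_funD (adjoint_linear hJ')).
- exists (d *: P); split=> [z z1|h y yh]; first by rewrite hornerZ h1// mulrCA.
  rewrite (repr_scale hpi)// ?(k1 _ _ yh) ?poly_opZ//; last exact: spanA.
  by rewrite (linear_funZ (adjoint_linear hJ')).
Qed.

(** The matrix [J' f(U) J] of compressions is bounded by the von Neumann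
inequality, with [Q ^ (N - 1)] as the comparison polynomial. *)
Lemma span_matrix_bound r (G : 'I_r -> 'I_r -> C -> C) (s : R) : 0 <= s ->
  (forall i j, span (G i j)) ->
  (forall z, rnorm z = 1 -> forall v : 'I_r -> C,
    l2norm (fun i => \sum_(j < r) G i j z * v j) <= s * l2norm v) ->
  forall x : 'I_r -> H,
    l2norm (fun i => \sum_(j < r) pi (G i j) (x j)) <= s * l2norm x.
Proof.
move=> s0 sG hG x.
have /choice[P hP] (ij : 'I_r * 'I_r) := span_compression (sG ij.1 ij.2).
have /choice[y hy] (j : 'I_r) := bden_surjective hU ha N.-1 (J (x j)).
have piE i : \sum_(j < r) pi (G i j) (x j) =
    J' (\sum_(j < r) poly_op U (P (i, j)) (y j)).
  rewrite (linear_fun_sum (adjoint_linear hJ')).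
  by apply: eq_bigr => j _; apply: (hP (i, j)).2; exact: hy.
apply: l2norm_le_sqr; first by rewrite mulr_ge0 ?l2norm_ge0.
rewrite exprMn l2norm_sqr.
under [X in _ <= _ * X]eq_bigr do rewrite -(isometric_embedding_norm hJ) -hy.
have [V [hVb hVadj VU UV]] := hU.2.
have hV : unitary V.
  split=> //; exists U; split=> //; first exact: hU.1.
  move=> u v; rewrite (si_conj (ip_semi_inner K) v).
  by rewrite -hVadj -(si_conj (ip_semi_inner K)).
have VUc : cancel U V by move=> u; exact: (congr1 (@^~ u) VU).
have key := @unitary_matrix_bound R K U V hV VUc r (fun i j => P (i, j))
  (Q ^+ N.-1) (s ^+ 2) (sqr_ge0 s).
apply: le_trans (key _ y) => [|z z1 v].
- apply: ler_sum => i _; rewrite piE lerXn2r ?nnegrE ?rnorm_ge0//.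
  by apply: (adjoint_norm_le hJ hJ').
- have z1' : rnorm z <= 1 by rewrite z1.
  have E i : \sum_(j < r) (P (i, j)).[z] * v j =
      Q.[z] ^+ N.-1 * \sum_(j < r) G i j z * v j.
    by rewrite mulr_sumr; apply: eq_bigr => j _; rewrite (hP (i, j)).1//= mulrA.
  under eq_bigr do rewrite E rnormM exprMn.
  rewrite -mulr_sumr horner_exp mulrCA ler_wpM2l ?sqr_ge0//.
  rewrite -!l2norm_sqr -exprMn lerXn2r ?nnegrE ?mulr_ge0 ?l2norm_ge0//.
  exact: hG.
Qed.

Theorem dilation_completely_contractive : completely_contractive A pi.
Proof.
move=> r F _ AF; have := mx_sup_norm_ge0 F.
case Es : (mx_sup_norm F) => [s| |]; [|by move=> _; exact: leey|by []].
rewrite lee_fin => s0; have /(mx_sup_normP _ s0) hF : (mx_sup_norm F <= s%:E)%E by rewrite Es.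
apply: op_norm_for_le => x x1; apply/ler_addgt0Pr => e e0.
have [M M0 hM] := representation_dist.
pose rr : R := r%:R * r%:R.
have rr0 : 0 <= rr by rewrite mulr_ge0.
(* Entries within [d] of those of [F] change both norms by at most
   [rr * (M + 1) * d <= e] in total. *)
pose d := e / (rr * (M + 1) + 1).
have den0 : 0 < rr * (M + 1) + 1 by rewrite ltr_wpDl// mulr_ge0// addr_ge0.
have d0 : 0 < d by rewrite divr_gt0.
have /choice[G hG] (ij : 'I_r * 'I_r) : exists g, span g /\
    forall z, rnorm z <= 1 -> rnorm (F ij.1 ij.2 z - g z) <= d.
  by have [g sg fg] := alg_B0_dense N2 hc ha (AF ij.1 ij.2) d0; exists g.
have Gbound : l2norm (fun i => \sum_(j < r) pi (G (i, j)) (x j)) <=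
    (s + rr * d) * l2norm x.
  apply: (@span_matrix_bound r (fun i j => G (i, j))).
  - by rewrite addr_ge0// mulr_ge0// ltW.
  - by move=> i j; case: (hG (i, j)).
  - move=> z z1 v; have z1' : rnorm z <= 1 by rewrite z1.
    have -> : (fun i => \sum_(j < r) G (i, j) z * v j) = (fun i =>
        \sum_(j < r) F i j z * v j + \sum_(j < r) (G (i, j) z - F i j z) * v j).
      apply/funext => i; rewrite -big_split; apply: eq_bigr => j _ /=.
      by rewrite -mulrDl addrC subrK.
    apply: le_trans (l2normD _ _) _; rewrite mulrDl lerD ?hF//.
    have := @op_mx_act_le R C r (\matrix_(i, j) fun t : C => (G (i, j) z - F i j z) * t)
      d (ltW d0) _ v.
    rewrite /op_mx_act; under [X in l2norm X]funext => i do
      under eq_bigr => j _ do rewrite mxE.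
    apply=> i j t; rewrite mxE rnormM ler_wpM2r ?rnorm_ge0// rnormB.
    exact: (hG (i, j)).2.
have -> : op_mx_act (map_mx pi F) x = fun i => \sum_(j < r) pi (G (i, j)) (x j) +
    \sum_(j < r) (pi (F i j) (x j) - pi (G (i, j)) (x j)).
  apply/funext => i; rewrite -big_split; apply: eq_bigr => j _ /=.
  by rewrite mxE addrC subrK.
apply: le_trans (l2normD _ _) _.
have Dbound : l2norm (fun i => \sum_(j < r) (pi (F i j) (x j) - pi (G (i, j)) (x j)))
    <= rr * (M * d) * l2norm x.
  have := @op_mx_act_le R H r (\matrix_(i, j) fun t => pi (F i j) t - pi (G (i, j)) t)
      (M * d) (mulr_ge0 M0 (ltW d0)) _ x.
  rewrite /op_mx_act; under [X in l2norm X]funext => i do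
      under eq_bigr => j _ do rewrite mxE.
  apply=> i j t; rewrite mxE; apply: hM (ltW d0) _ _ => //.
    by apply: spanA; case: (hG (i, j)).
  exact: (hG (i, j)).2.
have x0 : 0 <= l2norm x := l2norm_ge0 x.
have e1 : rr * (M + 1) * d <= e.
  by rewrite /d mulrA ler_pdivrMr// mulrC ler_wpM2l ?lerDl// ltW.
have b1 : (s + rr * d) * l2norm x <= s + rr * d.
  by rewrite ler_piMr// addr_ge0// mulr_ge0// ltW.
have b2 : rr * (M * d) * l2norm x <= rr * (M * d).
  by rewrite ler_piMr//; exact: mulr_ge0 rr0 (mulr_ge0 M0 (ltW d0)).
have := lerD (le_trans Gbound b1) (le_trans Dbound b2); move/le_trans; apply.
by move: e1; rewrite mulrDr mulrDl mulr1 -mulrA; lra.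
Qed.

End sufficiency.
End dilation.

(** * Complete contractivity yields positivity *)

Section positivity.
Variable R : realType.
Local Notation C := [the numClosedFieldType of R[i]].

Lemma sinormB_sqr (X : lmodType C) (s : X -> X -> C) (t : R) (u w : X) :
  semi_inner s -> sinorm s (u - t%:C *: w) ^+ 2 =
    sinorm s u ^+ 2 - t * Re (s w u) *+ 2 + t ^+ 2 * sinorm s w ^+ 2.
Proof.
move=> hs; rewrite (sinormD_sqr hs) (sinormN hs) (sinormZ hs) (siNr hs) (siZr hs).
rewrite conj_real ReN ReZ rnorm_real exprMn real_normK ?num_real//.
by rewrite (si_conj hs u w) Re_conj; ring.
Qed.

Lemma ip_sum_semi_inner (H : hilbertType R) r :
  semi_inner (fun u v : 'I_r -> H => \sum_(i < r) ip (u i) (v i)).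
Proof.
have hH := ip_semi_inner H; split=> [d x y z|x y|x].
- rewrite mulr_sumr -big_split; apply: eq_bigr => i _ /=.
  exact: si_linear hH _ _ _ _.
- by rewrite rmorph_sum; apply: eq_bigr => i _; exact: si_conj hH _ _.
- by apply: sumr_ge0 => i _; exact: si_ge0 hH _.
Qed.

Lemma l2norm_ip (H : hilbertType R) r (x : 'I_r -> H) :
  l2norm x = sinorm (fun u v : 'I_r -> H => \sum_(i < r) ip (u i) (v i)) x.
Proof.
rewrite /sinorm /l2norm Re_sum; congr Num.sqrt; apply: eq_bigr => i _.
by rewrite ip_self.
Qed.

Lemma l2norm_dot r (x : 'I_r -> C) :
  l2norm x = sinorm (fun u v : 'I_r -> C => \sum_(i < r) u i * (v i)^*) x.
Proof.
rewrite /sinorm /l2norm Re_sum; congr Num.sqrt; apply: eq_bigr => i _.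
by rewrite mul_conj.
Qed.

(** The maximum modulus principle for a matrix [G], applied to the scalar
functions [<G v, u>]. *)
Lemma matrix_maximum_modulus r (G : 'I_r -> 'I_r -> C -> C) (b : R) : 0 <= b ->
  (forall i j, poly_limit (G i j)) ->
  (forall z, rnorm z = 1 -> forall v : 'I_r -> C,
    l2norm (fun i => \sum_(j < r) G i j z * v j) <= b * l2norm v) ->
  forall w, rnorm w <= 1 -> forall v : 'I_r -> C,
    l2norm (fun i => \sum_(j < r) G i j w * v j) <= b * l2norm v.
Proof.
move=> b0 Gp hG w w1 v; rewrite [leLHS]l2norm_dot.
have hs := dot_semi_inner R r.
apply: (sinorm_le_of_dual hs) => [|u]; first by rewrite mulr_ge0 ?l2norm_ge0.
pose f z : C := \sum_(i < r) (\sum_(j < r) G i j z * v j) * (u i)^*.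
have fp : poly_limit f.
  have psum I (rr : seq I) (g : I -> C -> C) : (forall i, poly_limit (g i)) ->
      poly_limit (fun z => \sum_(i <- rr) g i z).
    move=> gp; elim: rr => [|i rr IH].
      by under [fun z => _]funext do rewrite big_nil; exact: poly_limit_cst.
    by under [fun z => _]funext do rewrite big_cons; exact: poly_limitD.
  apply: (psum) => i; apply: poly_limitM; last exact: poly_limit_cst.
  by apply: (psum) => j; apply: poly_limitM; [exact: Gp|exact: poly_limit_cst].
rewrite -/(f w); apply: (poly_limit_maximum_modulus fp _ w1) => z z1.
apply: le_trans (cauchy_schwarz hs (fun i => \sum_(j < r) G i j z * v j) u) _.
by rewrite -!l2norm_dot ler_wpM2r ?l2norm_ge0// hG.
Qed.

Lemma common_bound r (F : 'I_r -> 'I_r -> C -> C) :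
  (forall i j, disc_bounded (F i j)) -> exists2 d : R, 0 <= d &
  forall i j z, rnorm z <= 1 -> rnorm (F i j z) <= d.
Proof.
move=> hF; have /choice[M hM] (ij : 'I_r * 'I_r) := hF ij.1 ij.2.
exists (\sum_ij M ij) => [|i j z z1].
  by apply: sumr_ge0 => ij _; apply: ltW; exact: (hM ij).1.
apply: le_trans ((hM (i, j)).2 z z1) _; rewrite (bigD1 (i, j))//= lerDl.
by apply: sumr_ge0 => ij _; apply: ltW; exact: (hM ij).1.
Qed.

Lemma ge0_of_small_error (x y : R) : (forall t, 0 < t -> - (t * y) <= x) -> 0 <= x.
Proof.
move=> h; rewrite leNgt; apply/negP => x0.
have y1 : 0 < `|y| + 1 by rewrite ltr_wpDl.
have t0 : 0 < - x / (`|y| + 1) / 2 by rewrite !divr_gt0// oppr_gt0.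
have := h _ t0; rewrite leNgt => /negP; apply.
rewrite ltrNr; apply: le_lt_trans (ler_wpM2l (ltW t0) (ler_norm y)) _.
rewrite mulrAC ltr_pdivrMr// mulrAC ltr_pdivrMr//.
have : - x * `|y| <= - x * (`|y| + 1) by rewrite ler_pM2l ?oppr_gt0// lerDl.
have : 0 < - x * (`|y| + 1) by rewrite mulr_gt0// oppr_gt0.
lra.
Qed.

Variables (N : nat) (c : C) (a : 'I_N -> C).
Hypothesis (N2 : (2 <= N)%N) (hc : `|c| = 1) (ha : forall k, `|a k| < 1).
Local Notation B := (blaschke c a).
Local Notation A := (alg_B0 B).
Local Notation span := (mono_span c a).
Variables (H : hilbertType R) (pi : (C -> C) -> H -> H).
Hypothesis hpi : unital_representation A pi.
Hypothesis hcc : completely_contractive A pi.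
Let hH := ip_semi_inner H.

(** Positivity is read off from contractivity of [1 - t F]: if [F] has positive
real part then the norm of [1 - t F] is at most [1 + O(t^2)], and this estimate
for [1 - t pi(F)] gives back a positive real part as [t] tends to 0. *)
Lemma matrix_positivity r (F : 'I_r -> 'I_r -> C -> C) (x : 'I_r -> H) :
  (forall i j, span (F i j)) ->
  (forall z, rnorm z = 1 -> forall v : 'I_r -> C,
     0 <= Re (\sum_(i < r) (\sum_(j < r) F i j z * v j) * (v i)^*)) ->
  0 <= Re (\sum_(i < r) ip (\sum_(j < r) pi (F i j) (x j)) (x i)).
Proof.
move=> sF hF; have [r0|r0] := posnP r.
  by rewrite big1 // => i; have := ltn_ord i; rewrite {2}r0.
have [d d0 Fd] := common_bound (fun i j => mono_span_bounded ha (sF i j)).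
pose D := r%:R * r%:R * d; have D0 : 0 <= D by rewrite !mulr_ge0.
have FD z : rnorm z <= 1 -> forall v : 'I_r -> C,
    l2norm (fun i => \sum_(j < r) F i j z * v j) <= D * l2norm v.
  move=> z1 v; have := @op_mx_act_le R C r (\matrix_(i, j) fun t : C => F i j z * t) d d0 _ v.
  rewrite /op_mx_act; under [X in l2norm X]funext => i do
    under eq_bigr => j _ do rewrite mxE.
  by apply=> i j t; rewrite mxE rnormM ler_wpM2r ?rnorm_ge0// Fd.
pose y : 'I_r -> H := fun i => \sum_(j < r) pi (F i j) (x j).
suff key (t : R) : 0 < t -> - (t * (D ^+ 2 * l2norm x ^+ 2)) <=
    Re (\sum_(i < r) ip (y i) (x i)) *+ 2.
  by have := ge0_of_small_error key; rewrite pmulrn_lge0.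
move=> t0.
pose G i j : C -> C := fun z => (i == j)%:R + (- t%:C) * F i j z.
have sG i j : span (G i j).
  by apply: mono_spanD; [exact: mono_span_cst|exact: mono_spanZ].
(* [|v - t F v|^2 = |v|^2 - 2 t Re <F v, v> + t^2 |F v|^2 <= b^2 |v|^2] *)
pose b : R := Num.sqrt (1 + t ^+ 2 * D ^+ 2).
have b0 : 0 <= b by exact: sqrtr_ge0.
have b2 : b ^+ 2 = 1 + t ^+ 2 * D ^+ 2.
  by rewrite sqr_sqrtr// addr_ge0// mulr_ge0// sqr_ge0.
have GE z (v : 'I_r -> C) : (fun i => \sum_(j < r) G i j z * v j) =
    v - t%:C *: (fun i => \sum_(j < r) F i j z * v j : C).
  apply/funext => i; transitivity (v i - t%:C * \sum_(j < r) F i j z * v j); last by [].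
  rewrite /G; under eq_bigr do rewrite mulrDl.
  rewrite big_split /= (bigD1 i)//= eqxx mul1r big1 ?addr0 => [|j].
    by rewrite -mulNr mulr_sumr; congr (_ + _); apply: eq_bigr => j _; rewrite mulrA.
  by rewrite eq_sym => /negPf ->; rewrite mul0r.
have Gb : (mx_sup_norm (\matrix_(i, j) G i j) <= b%:E)%E.
  apply/(mx_sup_normP _ b0) => w w1 v.
  under [X in l2norm X]funext => i do under eq_bigr => j _ do rewrite mxE.
  apply: matrix_maximum_modulus w w1 v => // [i j|z z1 v].
    exact: mono_span_poly_limit ha _ (sG i j).
  rewrite -(@ler_pXn2r _ 2) ?nnegrE ?mulr_ge0 ?l2norm_ge0// exprMn b2 GE.
  rewrite l2norm_dot (sinormB_sqr _ _ _ (dot_semi_inner R r)) -!l2norm_dot.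
  have z1' : rnorm z <= 1 by rewrite z1.
  have h1 : l2norm (fun i => \sum_(j < r) F i j z * v j) ^+ 2 <= (D * l2norm v) ^+ 2.
    by rewrite lerXn2r ?nnegrE ?mulr_ge0 ?l2norm_ge0// FD.
  have := ler_wpM2l (sqr_ge0 t) h1; have := mulr_ge0 (ltW t0) (hF z z1 v).
  by rewrite exprMn mulrDl mul1r -[t ^+ 2 * D ^+ 2 * _]mulrA; lra.
have AG i j : A ((\matrix_(i, j) G i j) i j) by rewrite mxE; exact: mono_span_alg_B0.
have := le_trans (hcc r0 AG) Gb.
have piG i j u : pi (G i j) u = (i == j)%:R *: u - t%:C *: pi (F i j) u.
  have AF : A (F i j) by exact: mono_span_alg_B0.
  have A1 : A (cst (1 : C)) by case: (alg_B0_subalgebra c a).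
  have E : G i j = (fun z => (i == j)%:R * cst (1 : C) z) \+ (fun z => (- t%:C) * F i j z).
    by apply/funext => z; rewrite /= mulr1.
  rewrite E (repr_add hpi) ?(repr_scale hpi)//=; try exact: alg_B0Z.
  by rewrite (repr_one hpi) scaleNr.
have actE (u : 'I_r -> H) : op_mx_act (map_mx pi (\matrix_(i, j) G i j)) u =
    u - t%:C *: (fun i => \sum_(j < r) pi (F i j) (u j) : H).
  apply/funext => i.
  transitivity (u i - t%:C *: \sum_(j < r) pi (F i j) (u j)); last by [].
  rewrite /op_mx_act; under eq_bigr do rewrite !mxE piG.
  rewrite big_split /= sumrN scaler_sumr (bigD1 i)//= eqxx scale1r big1 ?addr0 => [//|j].
  by rewrite eq_sym => /negPf ->; rewrite scale0r.
move=> /(op_norm_forP (nu := @l2norm R H r)) => /(_ _ _ _ b0) h.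
have {h} : l2norm (x - t%:C *: y) <= b * l2norm x.
  rewrite -actE; apply: h => [u|s u s0|s u].
  - exact: l2norm_ge0.
  - by rewrite (l2normZ s%:C u) rnorm_real ger0_norm.
  - rewrite !actE scalerBr; congr (_ - _); apply/funext => i.
    transitivity (t%:C *: \sum_(j < r) pi (F i j) (s%:C *: u j)); first by [].
    transitivity (s%:C *: (t%:C *: \sum_(j < r) pi (F i j) (u j))); last by [].
    rewrite !scaler_sumr; apply: eq_bigr => j _.
    have AF : A (F i j) by exact: mono_span_alg_B0.
    rewrite (linear_funZ (representation_linear hpi AF)).
    by rewrite !scalerA mulrC.
rewrite -(@ler_pXn2r _ 2) ?nnegrE ?mulr_ge0 ?l2norm_ge0// exprMn b2.
rewrite l2norm_ip (sinormB_sqr _ _ _ (ip_sum_semi_inner H r)) -l2norm_ip.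
set n1 := l2norm x ^+ 2; set P := Re _; set n2 := sinorm _ _ ^+ 2 => h1.
have n20 : 0 <= t ^+ 2 * n2 by rewrite mulr_ge0// sqr_ge0.
rewrite -(ler_pM2l t0); move: h1 n20; rewrite expr2; lra.
Qed.

(** [(f, h, k)] stands for the operator-valued function [f |h><k|], a list for
the sum of its entries. *)
Definition tensor := ((C -> C) * H * H)%type.

Definition spanned (G : seq tensor) := forall t, t \in G -> span t.1.1.

(** The quadratic form of the operator [\sum f(z) |h><k|]. *)
Definition tensor_form (G : seq tensor) (z : C) (x : H) : C :=
  \sum_(t <- G) t.1.1 z * (ip t.1.2 x * ip x t.2).

Definition tensor_value (G : seq tensor) : C :=
  \sum_(t <- G) ip (pi t.1.1 t.1.2) t.2.

(** In an orthonormal basis of the span of all vectors involved, the tensor is a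
matrix of functions, and the tensor form is the quadratic form of this matrix. *)
Lemma tensor_positivity (G : seq tensor) : spanned G ->
  (forall z, rnorm z = 1 -> forall x, 0 <= Re (tensor_form G z x)) ->
  0 <= Re (tensor_value G).
Proof.
move=> sG hG.
have [m [e [ort ex]]] := gram_schmidt hH ([seq t.1.2 | t <- G] ++ [seq t.2 | t <- G]).
have expand x : x \in [seq t.1.2 | t <- G] ++ [seq t.2 | t <- G] ->
    x = \sum_(j < m) ip x (e j) *: e j.
  move=> xG; apply: ip_inj => y; rewrite (si_suml hH).
  by under eq_bigr do rewrite (siZl hH); exact: ex.
pose F i j : C -> C := fun z => \sum_(t <- G) (ip t.1.2 (e j) * ip (e i) t.2) * t.1.1 z.
have sF i j : span (F i j).
  rewrite /F; elim: (G) sG => [|t G' IH] sG'.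
    by under [fun z => _]funext do rewrite big_nil; exact: mono_span_cst.
  under [fun z => _]funext do rewrite big_cons.
  apply: mono_spanD; first by apply: mono_spanZ; apply: sG'; rewrite mem_head.
  by apply: IH => u uG; apply: sG'; rewrite inE uG orbT.
have piF i j x : pi (F i j) x =
    \sum_(t <- G) (ip t.1.2 (e j) * ip (e i) t.2) *: pi t.1.1 x.
  rewrite /F; elim: (G) sG => [|t G' IH] sG'.
    rewrite big_nil; under [fun z => _]funext do rewrite big_nil.
    have A1 : A (cst (1 : C)) by case: (alg_B0_subalgebra c a).
    rewrite (_ : (fun=> 0) = fun z => 0 * cst (1 : C) z); last first.
      by apply/funext => z; rewrite mul0r.
    by rewrite (repr_scale hpi)// scale0r.
  rewrite big_cons; under [fun z => _]funext do rewrite big_cons.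
  have st : A t.1.1 by apply: mono_span_alg_B0 => //; apply: sG'; rewrite mem_head.
  have sG1 : spanned G' by move=> u uG; apply: sG'; rewrite inE uG orbT.
  have sA : A (fun z => \sum_(u <- G') (ip u.1.2 (e j) * ip (e i) u.2) * u.1.1 z).
    elim: (G') sG1 => [|u G1 IH1] sG2.
      by under [fun z => _]funext do rewrite big_nil; exact: alg_B0_cst.
    under [fun z => _]funext do rewrite big_cons.
    apply: alg_B0D; last by apply: IH1 => v vG; apply: sG2; rewrite inE vG orbT.
    by apply: alg_B0Z; apply: mono_span_alg_B0 => //; apply: sG2; rewrite mem_head.
  rewrite (repr_add hpi (alg_B0Z _ st) sA) /= (repr_scale hpi)//.
  by rewrite IH.
suff -> : tensor_value G = \sum_(i < m) ip (\sum_(j < m) pi (F i j) (e j)) (e i).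
  apply: matrix_positivity sF _ => z z1 v.
  pose x := \sum_(k < m) (v k)^* *: e k.
  suff -> : \sum_(i < m) (\sum_(j < m) F i j z * v j) * (v i)^* = tensor_form G z x.
    exact: hG.
  rewrite /tensor_form; under eq_bigr do rewrite mulr_suml.
  rewrite /F; under eq_bigr do under eq_bigr do rewrite 2!mulr_suml.
  under eq_bigr do rewrite exchange_big; rewrite exchange_big /=.
  apply: eq_bigr => t _; rewrite (si_suml hH) (si_sumr hH) mulr_suml mulr_sumr.
  rewrite exchange_big; apply: eq_bigr => j _ /=.
  rewrite mulr_sumr mulr_sumr; apply: eq_bigr => i _.
  by rewrite (siZl hH) (siZr hH) conjCK; ring.
rewrite /tensor_value; under [RHS]eq_bigr do
  (rewrite (si_suml hH); under eq_bigr do rewrite piF (si_suml hH)).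
under [RHS]eq_bigr do rewrite exchange_big; rewrite [RHS]exchange_big /=.
rewrite !big_seq; apply: eq_bigr => t tG.
have At : A t.1.1 by apply: mono_span_alg_B0 => //; exact: sG.
have hE : t.1.2 = \sum_(j < m) ip t.1.2 (e j) *: e j.
  by apply: expand; rewrite mem_cat; apply/orP; left; apply/mapP; exists t.
have kE : t.2 = \sum_(j < m) ip t.2 (e j) *: e j.
  by apply: expand; rewrite mem_cat; apply/orP; right; apply/mapP; exists t.
rewrite {1}hE {1}kE.
have piL := representation_linear hpi At.
rewrite (linear_fun_sum piL) (si_sumr hH); apply: eq_bigr => i _.
rewrite (si_suml hH); apply: eq_bigr => j _.
by rewrite (linear_funZ piL) !(siZl hH) (siZr hH) -(si_conj hH); ring.
Qed.

End positivity.

(** * Positive functionals on operator-valued functions *)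

Section dilation_construction.
Variable R : realType.
Local Notation C := [the numClosedFieldType of R[i]].

(** The circle coordinate: functions of [circle z] are functions on the unit
circle, written on the whole plane. *)
Definition circle (z : C) : C := if rnorm z == 1 then z else 1.

Lemma rnorm_circle z : rnorm (circle z) = 1.
Proof. by rewrite /circle; case: eqP => // _; exact: rnorm1. Qed.

Lemma circle_id z : rnorm z = 1 -> circle z = z.
Proof. by rewrite /circle => ->; rewrite eqxx. Qed.

Section domination.
Variable H : hilbertType R.
Let hH := ip_semi_inner H.

Definition gram (hs : seq H) (x : H) : R := \sum_(h <- hs) rnorm (ip h x) ^+ 2.

Lemma gram_ge0 hs x : 0 <= gram hs x.
Proof. by apply: sumr_ge0 => h _; exact: sqr_ge0. Qed.

Lemma gram_cat hs ks x : gram (hs ++ ks) x = gram hs x + gram ks x.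
Proof. by rewrite /gram big_cat. Qed.

(** An operator [T] is recorded by its quadratic form [x |-> <T x, x>], so that an
operator-valued function on the circle becomes a scalar function of a pair
[(z, x)].  Domination by a Gram form stands for boundedness and finite rank. *)
Definition dominated : set (C * H -> C) :=
  [set w | exists (M : R) (hs : seq H), 0 <= M /\
     forall z x, rnorm (w (z, x)) <= M * gram hs x].

Definition real_dominated : set (C * H -> R) :=
  [set w | exists (M : R) (hs : seq H), 0 <= M /\
     forall z x, `|w (z, x)| <= M * gram hs x].

Lemma dominatedD (v w : C * H -> C) :
  dominated v -> dominated w -> dominated (fun p => v p + w p).
Proof.
move=> [M [hs [M0 vM]]] [L [ks [L0 wL]]]; exists (M + L), (hs ++ ks).
split=> [|z x]; first exact: addr_ge0.
apply: le_trans (rnormD _ _) _; rewrite gram_cat.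
have g1 := gram_ge0 hs x; have g2 := gram_ge0 ks x.
have := mulr_ge0 M0 g2; have := mulr_ge0 L0 g1; have := vM z x; have := wL z x.
by move: (rnorm (v (z, x))) (rnorm (w (z, x))) => *; lra.
Qed.

Lemma real_dominatedD v w :
  real_dominated v -> real_dominated w -> real_dominated (v + w).
Proof.
move=> [M [hs [M0 vM]]] [L [ks [L0 wL]]]; exists (M + L), (hs ++ ks).
split=> [|z x]; first exact: addr_ge0.
apply: le_trans (ler_normD _ _) _; rewrite gram_cat.
have g1 := gram_ge0 hs x; have g2 := gram_ge0 ks x.
have := mulr_ge0 M0 g2; have := mulr_ge0 L0 g1; have := vM z x; have := wL z x.
by move: `|v (z, x)| `|w (z, x)| => *; lra.
Qed.

Lemma real_dominatedZ (t : R) w : real_dominated w -> real_dominated (t *: w).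
Proof.
move=> [M [hs [M0 wM]]]; exists (`|t| * M), hs; split=> [|z x]; first exact: mulr_ge0.
have -> : (t *: w) (z, x) = t * w (z, x) by [].
by rewrite normrM -mulrA ler_wpM2l.
Qed.

Lemma dominatedZ (d : C) (w : C * H -> C) :
  dominated w -> dominated (fun p => d * w p).
Proof.
move=> [M [hs [M0 wM]]]; exists (rnorm d * M), hs.
split=> [|z x]; first by rewrite mulr_ge0 ?rnorm_ge0.
by rewrite rnormM -mulrA ler_wpM2l ?rnorm_ge0.
Qed.

Lemma dominated_Re (w : C * H -> C) : dominated w -> real_dominated (fun p => Re (w p)).
Proof.
move=> [M [hs [M0 wM]]]; exists M, hs; split=> // z x.
by apply: le_trans (wM z x); case: (Re_Im_le (w (z, x))).
Qed.

Lemma dominated_Im (w : C * H -> C) : dominated w -> real_dominated (fun p => Im (w p)).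
Proof.
move=> [M [hs [M0 wM]]]; exists M, hs; split=> // z x.
by apply: le_trans (wM z x); case: (Re_Im_le (w (z, x))).
Qed.

Section complexification.
Variable phi : (C * H -> R) -> R.
Hypothesis phiD : forall v w, real_dominated v -> real_dominated w ->
  phi (v + w) = phi v + phi w.
Hypothesis phiZ : forall (t : R) w, real_dominated w -> phi (t *: w) = t * phi w.

Definition complexify (w : C * H -> C) : C :=
  Complex (phi (fun p => Re (w p))) (phi (fun p => Im (w p))).

Lemma complexifyD v w : dominated v -> dominated w ->
  complexify (fun p => v p + w p) = complexify v + complexify w.
Proof.
move=> dv dw; have dvR := dominated_Re dv; have dwR := dominated_Re dw.
have dvI := dominated_Im dv; have dwI := dominated_Im dw.
rewrite /complexify.
have -> : (fun p => Re (v p + w p)) = (fun p => Re (v p)) + (fun p => Re (w p)).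
  by apply/funext => p; rewrite ReD.
have -> : (fun p => Im (v p + w p)) = (fun p => Im (v p)) + (fun p => Im (w p)).
  apply/funext => p; transitivity (Im (v p) + Im (w p)); last by [].
  by case: (v p) => ? ?; case: (w p).
by rewrite !phiD.
Qed.

Lemma complexifyZ (d : C) w : dominated w ->
  complexify (fun p => d * w p) = d * complexify w.
Proof.
move=> dw; have dR := dominated_Re dw; have dI := dominated_Im dw.
case: d => s t; rewrite /complexify.
have -> : (fun p => Re (Complex s t * w p)) =
    s *: (fun p => Re (w p)) + (- t) *: (fun p => Im (w p)).
  apply/funext => p; transitivity (s * Re (w p) + (- t) * Im (w p)); last by [].
  by case: (w p) => u v /=; rewrite mulNr.
have -> : (fun p => Im (Complex s t * w p)) =
    s *: (fun p => Im (w p)) + t *: (fun p => Re (w p)).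
  apply/funext => p; transitivity (s * Im (w p) + t * Re (w p)); last by [].
  by case: (w p) => u v /=.
rewrite !phiD ?phiZ//; try exact: real_dominatedZ.
by rewrite mulNr.
Qed.

Lemma complexify_conj w : dominated w ->
  complexify (fun p => (w p)^*) = (complexify w)^*.
Proof.
move=> dw; have dI := dominated_Im dw.
rewrite /complexify; have -> : (fun p => Re (w p)^*) = (fun p => Re (w p)).
  by apply/funext => p; rewrite Re_conj.
have -> : (fun p => Im (w p)^*) = (-1) *: (fun p => Im (w p)).
  apply/funext => p; transitivity (-1 * Im (w p)); last by [].
  by case: (w p) => u v /=; rewrite mulN1r.
by rewrite phiZ// mulN1r.
Qed.

Hypothesis phi_ge0 : forall w, real_dominated w -> (forall z x, 0 <= w (z, x)) -> 0 <= phi w.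

Lemma complexify_ge0 w : dominated w -> (forall z x, 0 <= w (z, x)) -> 0 <= complexify w.
Proof.
move=> dw w0; rewrite /complexify.
have -> : (fun p => Im (w p)) = 0 *: (fun p => Re (w p)).
  apply/funext => -[z x]; transitivity (0 : R); last by rewrite -[RHS]/(0 * _) mul0r.
  by have := w0 z x; rewrite lecE => /andP[/eqP].
have dR := dominated_Re dw.
rewrite phiZ// mul0r lecE eqxx /=; apply: phi_ge0 => // z x.
exact: le_Re (w0 z x).
Qed.

End complexification.

(** The bounded functions with values in the span of some finite [hs], expressed
so that [rank_one_form] is visibly dominated. *)
Definition finite_rank : {pred C -> H} := fun u =>
  `[< exists (M : R) (hs : seq H), 0 <= M /\
        forall z x, rnorm (ip (u z) x) ^+ 2 <= M * gram hs x >].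

Lemma finite_rankP (u : C -> H) : u \in finite_rank <->
  exists (M : R) (hs : seq H), 0 <= M /\
        forall z x, rnorm (ip (u z) x) ^+ 2 <= M * gram hs x.
Proof. by split=> /asboolP. Qed.

Lemma sqr_sum_le (p q : R) : (p + q) ^+ 2 <= p ^+ 2 *+ 2 + q ^+ 2 *+ 2.
Proof. by have := sqr_ge0 (p - q); nra. Qed.

Lemma finite_rank_mul (g : C -> C) (u : C -> H) (M : R) : (forall z, rnorm (g z) <= M) ->
  u \in finite_rank -> (fun z => g z *: u z) \in finite_rank.
Proof.
move=> gM /finite_rankP[L [hs [L0 uL]]]; apply/finite_rankP.
exists (M ^+ 2 * L), hs; split=> [|z x]; first by rewrite mulr_ge0// sqr_ge0.
rewrite (siZl hH) rnormM exprMn -mulrA ler_pM ?sqr_ge0//.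
have M0 : 0 <= M by apply: le_trans (gM z); exact: rnorm_ge0.
by rewrite lerXn2r ?nnegrE ?rnorm_ge0.
Qed.

Lemma finite_rank_submod : submod_closed finite_rank.
Proof.
split=> [|d u v du /finite_rankP[L [ks [L0 vL]]]].
  apply/finite_rankP; exists 0, [::]; split=> // z x.
  by rewrite -[(0 : C -> H) z]/(0 : H) (si0l hH) rnorm0 expr0n mul0r.
have /finite_rankP[M [hs [M0 uM]]] := finite_rank_mul (fun=> lexx (rnorm d)) du.
apply/finite_rankP; exists ((M + L) *+ 2), (hs ++ ks).
split=> [|z x]; first by rewrite mulrn_wge0// addr_ge0.
have -> : (d *: u + v) z = d *: u z + v z by [].
rewrite (siDl hH) gram_cat.
have g1 := gram_ge0 hs x; have g2 := gram_ge0 ks x.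
have h1 := mulr_ge0 M0 g2; have h2 := mulr_ge0 L0 g1.
have h3 := uM z x; have h4 := vL z x.
have h5 : rnorm (ip (d *: u z) x + ip (v z) x) ^+ 2 <=
    (rnorm (ip (d *: u z) x) + rnorm (ip (v z) x)) ^+ 2.
  by rewrite lerXn2r ?nnegrE ?addr_ge0 ?rnorm_ge0// rnormD.
have h6 := sqr_sum_le (rnorm (ip (d *: u z) x)) (rnorm (ip (v z) x)).
have := le_trans h5 h6; move: h1 h2 h3 h4; lra.
Qed.

Record vector_function := VectorFunction {
  vfun : C -> H ;
  _ : vfun \in finite_rank }.

HB.instance Definition _ := [isSub for vfun].
HB.instance Definition _ := [Choice of vector_function by <:].
HB.instance Definition _ :=
  GRing.isSubmodClosed.Build C (C -> H) finite_rank finite_rank_submod.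
HB.instance Definition _ := [SubChoice_isSubLmodule of vector_function by <:].

Lemma vfunP (u v : vector_function) : vfun u =1 vfun v -> u = v.
Proof. by move=> uv; apply/val_inj/funext. Qed.

Definition bounded_multiplier (g : C -> C) := exists M : R, forall z, rnorm (g z) <= M.

Definition multiply (g : C -> C) (u : vector_function) : vector_function :=
  insubd 0 (fun z => g z *: vfun u z).

Lemma multiplyE g u z : bounded_multiplier g -> vfun (multiply g u) z = g z *: vfun u z.
Proof.
move=> [M gM]; rewrite -[vfun _]/(val _) insubdK//.
by apply: finite_rank_mul gM _; exact: valP u.
Qed.

Lemma constant_finite_rank (h : H) : (fun _ : C => h) \in finite_rank.
Proof.
apply/finite_rankP; exists 1, [:: h]; split=> // z x.
by rewrite mul1r /gram big_seq1.
Qed.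

Definition constant (h : H) : vector_function := VectorFunction (constant_finite_rank h).

(** The quadratic form of the operator [|u(z)><v(z)|]. *)
Definition rank_one_form (u v : vector_function) : C * H -> C :=
  fun p => ip (vfun u p.1) p.2 * ip p.2 (vfun v p.1).

Lemma rank_one_dominated u v : dominated (rank_one_form u v).
Proof.
have /finite_rankP[M [hs [M0 uM]]] := valP u.
have /finite_rankP[L [ks [L0 vL]]] := valP v.
exists (M + L), (hs ++ ks); split=> [|z x]; first exact: addr_ge0.
rewrite /rank_one_form /= rnormM (si_conj hH (vfun v z) x) rnorm_conj gram_cat.
have g1 := gram_ge0 hs x; have g2 := gram_ge0 ks x.
have h1 := mulr_ge0 M0 g2; have h2 := mulr_ge0 L0 g1.
have h3 := uM z x; have h4 := vL z x; rewrite -[vfun u]/(val u) -[vfun v]/(val v).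
have p0 := rnorm_ge0 (ip (val u z) x); have q0 := rnorm_ge0 (ip (val v z) x).
by move: p0 q0 h3 h4; move: (rnorm _) (rnorm (ip (val v z) x)) => p q *; nra.
Qed.

Lemma disc_bounded_multiplier (f : C -> C) : disc_bounded f -> bounded_multiplier (f \o circle).
Proof. by move=> [M [_ fM]]; exists M => z; apply: fM; rewrite rnorm_circle. Qed.

Definition times (f : C -> C) := multiply (f \o circle).

Lemma timesE f u z : disc_bounded f -> vfun (times f u) z = f (circle z) *: vfun u z.
Proof. by move=> /disc_bounded_multiplier; exact: multiplyE. Qed.

End domination.

Section functional.
Variables (N : nat) (c : C) (a : 'I_N -> C).
Hypothesis (N2 : (2 <= N)%N) (hc : `|c| = 1) (ha : forall k, `|a k| < 1).
Local Notation B := (blaschke c a).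
Local Notation A := (alg_B0 B).
Local Notation span := (mono_span c a).
Variables (H : hilbertType R) (pi : (C -> C) -> H -> H).
Hypothesis hpi : unital_representation A pi.
Hypothesis hcc : completely_contractive A pi.
Let hH := ip_semi_inner H.
Implicit Types G : seq (tensor H).

Lemma spanned_cat G1 G2 : spanned c a G1 -> spanned c a G2 -> spanned c a (G1 ++ G2).
Proof. by move=> s1 s2 t; rewrite mem_cat => /orP[/s1|/s2]. Qed.

Lemma tensor_form_cat G1 G2 z x :
  tensor_form (G1 ++ G2) z x = tensor_form G1 z x + tensor_form G2 z x.
Proof. by rewrite /tensor_form big_cat. Qed.

Lemma tensor_value_cat G1 G2 :
  tensor_value pi (G1 ++ G2) = tensor_value pi G1 + tensor_value pi G2.
Proof. by rewrite /tensor_value big_cat. Qed.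

Definition tensor_scale (d : C) G : seq (tensor H) :=
  [seq ((fun z => d * t.1.1 z), t.1.2, t.2) | t <- G].

Lemma spanned_scale d G : spanned c a G -> spanned c a (tensor_scale d G).
Proof. by move=> sG t /mapP[u uG ->] /=; apply/mono_spanZ/sG. Qed.

Lemma tensor_form_scale d G z x :
  tensor_form (tensor_scale d G) z x = d * tensor_form G z x.
Proof.
rewrite /tensor_form big_map mulr_sumr; apply: eq_bigr => t _ /=.
by rewrite mulrA.
Qed.

Lemma tensor_value_scale d G : spanned c a G ->
  tensor_value pi (tensor_scale d G) = d * tensor_value pi G.
Proof.
move=> sG; rewrite /tensor_value big_map mulr_sumr !big_seq.
apply: eq_bigr => t tG /=; rewrite (repr_scale hpi) ?(siZl hH)//.
by apply: mono_span_alg_B0 => //; exact: sG.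
Qed.

(** The constant function [M sum_h |h><h|]; such functions majorize all dominated
ones, so [majorant] is finite. *)
Definition gram_tensor (M : R) (hs : seq H) : seq (tensor H) :=
  [seq ((fun=> M%:C), h, h) | h <- hs].

Lemma spanned_gram M hs : spanned c a (gram_tensor M hs).
Proof. by move=> t /mapP[h _ ->]; exact: mono_span_cst. Qed.

Lemma gram_tensor_form M hs z x : Re (tensor_form (gram_tensor M hs) z x) = M * gram hs x.
Proof.
rewrite /tensor_form big_map Re_sum /gram mulr_sumr; apply: eq_bigr => h _ /=.
by rewrite (si_conj hH h x) mul_conj ReZ.
Qed.

Definition majorizes G (w : C * H -> R) :=
  forall z x, w (z, x) <= Re (tensor_form G (circle z) x).

(** The largest extension that positivity permits: a positive extension is at most
the value of every tensor above [w]. *)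
Definition majorant (w : C * H -> R) : R :=
  inf [set Re (tensor_value pi G) | G in [set G | spanned c a G /\ majorizes G w]].

Lemma majorant_has_inf w : real_dominated w ->
  has_inf [set Re (tensor_value pi G) | G in [set G | spanned c a G /\ majorizes G w]].
Proof.
move=> [M [hs [M0 wM]]].
have sG : spanned c a (gram_tensor M hs) by exact: spanned_gram.
split.
  exists (Re (tensor_value pi (gram_tensor M hs))), (gram_tensor M hs) => //.
  split=> // z x; rewrite gram_tensor_form; exact: le_trans (ler_norm _) (wM z x).
exists (- Re (tensor_value pi (gram_tensor M hs))) => _ [G [sG' Gw] <-].
rewrite -subr_ge0 opprK -ReD -tensor_value_cat.
apply: (tensor_positivity N2 hc ha hpi hcc (spanned_cat sG' sG)).
move=> z z1 x; rewrite tensor_form_cat ReD gram_tensor_form.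
have := Gw z x; rewrite circle_id// => h1.
by have /ler_normlP[h2 _] := wM z x; lra.
Qed.

Lemma majorant_le w G : real_dominated w -> spanned c a G -> majorizes G w ->
  majorant w <= Re (tensor_value pi G).
Proof.
move=> dw sG Gw; apply: inf_lbound; first by case: (majorant_has_inf dw).
by exists G.
Qed.

Lemma majorant_sublinear : sublinear (@real_dominated H) majorant.
Proof.
split=> [v w dv dw|].
  rewrite -lerBlDr; apply: lb_le_inf; first by case: (majorant_has_inf dv).
  move=> _ [G [sG Gv] <-]; rewrite lerBlDr -lerBlDl.
  apply: lb_le_inf; first by case: (majorant_has_inf dw).
  move=> _ [G' [sG' Gw] <-]; rewrite lerBlDl -ReD -tensor_value_cat.
  apply: majorant_le; [exact: real_dominatedD|exact: spanned_cat|].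
  by move=> z x; rewrite tensor_form_cat ReD lerD.
apply: (homogeneous_of_le (@real_dominatedZ H)) => u v u0 dv; apply: lb_le_inf.
  by case: (majorant_has_inf (real_dominatedZ u dv)).
move=> _ [G [sG Gv] <-]; rewrite mulrC -ler_pdivlMr// mulrC -ReZ.
rewrite -tensor_value_scale//; apply: majorant_le => //; first exact: spanned_scale.
move=> z x; rewrite tensor_form_scale ReZ mulrC ler_pdivlMr// mulrC.
exact: Gv.
Qed.

Definition circle_form G : C * H -> C := fun p => tensor_form G (circle p.1) p.2.

Lemma circle_form_dominated G : spanned c a G -> dominated (circle_form G).
Proof.
elim: G => [|t G IH] sG.
  exists 0, [::]; split=> // z x.
  by rewrite /circle_form /tensor_form big_nil rnorm0 mul0r.
have st : span t.1.1 by apply: sG; rewrite mem_head.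
have -> : circle_form (t :: G) = fun p =>
    rank_one_form (times t.1.1 (constant t.1.2)) (constant t.2) p + circle_form G p.
  apply/funext => p; rewrite /circle_form /tensor_form big_cons; congr (_ + _).
  rewrite /rank_one_form timesE; first by rewrite (siZl hH) mulrA.
  exact: mono_span_bounded ha _ st.
apply: dominatedD; first exact: rank_one_dominated.
by apply: IH => u uG; apply: sG; rewrite inE uG orbT.
Qed.

(** A linear functional below [majorant] is positive, because the empty tensor
majorizes the nonpositive functions; and it takes the right value on a tensor
[G], because [G] majorizes itself and [-G] majorizes its opposite. *)
Lemma positive_functional_exists : exists phi : (C * H -> R) -> R,
  [/\ forall v w, real_dominated v -> real_dominated w -> phi (v + w) = phi v + phi w,
      forall (t : R) w, real_dominated w -> phi (t *: w) = t * phi w,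
      forall w, real_dominated w -> (forall z x, 0 <= w (z, x)) -> 0 <= phi w &
      forall G, spanned c a G -> complexify phi (circle_form G) = tensor_value pi G].
Proof.
have [phi [phiD phiZ phi_le]] := hahn_banach (@real_dominatedD H) (@real_dominatedZ H)
  majorant_sublinear.
have phiN w : real_dominated w -> phi (- w) = - phi w.
  by move=> dw; rewrite -scaleN1r phiZ// mulN1r.
have dN w : real_dominated w -> real_dominated (- w).
  by rewrite -scaleN1r; exact: real_dominatedZ.
have ReG G : spanned c a G -> phi (fun p => Re (circle_form G p)) = Re (tensor_value pi G).
  move=> sG; have dG := dominated_Re (circle_form_dominated sG).
  apply/eqP; rewrite eq_le; apply/andP; split.
    by apply: le_trans (phi_le _ dG) _; exact: majorant_le.
  have h := phiN _ dG; rewrite -lerN2 -h.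
  have <- : Re (tensor_value pi (tensor_scale (-1) G)) = - Re (tensor_value pi G).
    by rewrite tensor_value_scale// mulN1r ReN.
  apply: le_trans (phi_le _ (dN _ _ dG)) _.
  apply: majorant_le; [exact: dN|exact: spanned_scale|].
  by move=> z x; rewrite tensor_form_scale mulN1r ReN.
exists phi; split=> // [w dw w0|G sG].
  have h := phiN _ dw; rewrite -oppr_le0 -h.
  apply: le_trans (phi_le _ (dN _ _ dw)) _.
  have <- : Re (tensor_value pi [::]) = 0 by rewrite /tensor_value big_nil.
  apply: majorant_le; [exact: dN|by []|].
  move=> z x; rewrite /tensor_form big_nil -[(- w) _]/(- w (z, x)) oppr_le0.
  exact: w0.
(* The imaginary part of a value is the real part for the tensor [-i G]. *)
have ReI (z : C) : Re (- (Complex 0 1) * z) = Im z.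
  by case: z => u v /=; rewrite oppr0 mul0r sub0r mulN1r opprK.
rewrite /complexify ReG//.
have -> : (fun p => Im (circle_form G p)) =
    (fun p => Re (circle_form (tensor_scale (- (Complex 0 1)) G) p)).
  by apply/funext => p; rewrite /circle_form tensor_form_scale ReI.
rewrite ReG; last exact: spanned_scale.
by rewrite tensor_value_scale// ReI; case: (tensor_value pi G).
Qed.

Lemma poly_limit_factors (r : seq 'I_N) :
  poly_limit (fun z => \prod_(k <- r) ((z - a k) / (1 - (a k)^* * z))).
Proof.
elim: r => [|k r IH].
  by under [fun z => _]funext do rewrite big_nil; exact: poly_limit_cst.
under [fun z => _]funext do rewrite big_cons; apply: poly_limitM => //.
apply: poly_limitM; last by apply: poly_limit_inv; rewrite rnorm_conj -norm_lt1.
by apply: poly_limitD; [exact: poly_limit_id|exact: poly_limit_cst].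
Qed.

(** The inverse of [1 - conj(a k) U] is multiplication by
[(1 - conj(a k) z)^-1], a bounded function on the circle. *)
Lemma blaschke_op_times (K : hilbertType R) (e : vector_function H -> K) (U : K -> K)
    (u : vector_function H) :
  linear e -> unitary U -> (forall v, U (e v) = e (times id v)) ->
  blaschke_op c a U (e u) = e (times B u).
Proof.
move=> eL hU Ue.
have eB (d : C) v w : e v - d *: e w = e (v - d *: w).
  by rewrite (linear_funB eL) (linear_funZ eL).
pose P (r : seq 'I_N) z : C := \prod_(k <- r) ((z - a k) / (1 - (a k)^* * z)).
have Pb r : disc_bounded (P r) := poly_limit_bounded (poly_limit_factors r).
have idb : disc_bounded id := poly_limit_bounded (@poly_limit_id R).
suff H0 r : (\big[(fun S1 S2 : K -> K => S1 \o S2)/idfun]_(k <- r)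
    ((fun y => U y - a k *: y) \o op_inv (fun y => y - (a k)^* *: U y))) (e u)
    = e (times (P r) u).
  rewrite /blaschke_op H0 -(linear_funZ eL); congr e; apply: vfunP => z.
  rewrite timesE; last exact: poly_limit_bounded (poly_limit_blaschke c ha).
  rewrite -[LHS]/(c *: vfun (times (P (index_enum 'I_N)) u) z) timesE//.
  by rewrite scalerA.
elim: r => [|k r IH].
  rewrite big_nil /=; congr e; apply: vfunP => z.
  by rewrite timesE// /P big_nil scale1r.
have ak : rnorm (a k)^* < 1 by rewrite rnorm_conj -norm_lt1.
have invb : disc_bounded (fun z : C => (1 - (a k)^* * z)^-1).
  exact: poly_limit_bounded (poly_limit_inv ak).
rewrite big_cons /= IH; set u1 := times (P r) u.
pose u2 := times (fun z : C => (1 - (a k)^* * z)^-1) u1.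
have -> : e u1 = e u2 - (a k)^* *: U (e u2).
  rewrite Ue eB; congr e; apply: vfunP => z.
  rewrite -[RHS]/(vfun u2 z - (a k)^* *: vfun (times id u2) z).
  rewrite [vfun (times id u2) z]timesE// scalerA -{1}[vfun u2 z]scale1r.
  rewrite -scalerBl [vfun u2 z]timesE// scalerA.
  by rewrite divff ?scale1r// one_sub_neq0// rnorm_circle.
rewrite op_inv_one_sub// Ue eB; congr e; apply: vfunP => z.
rewrite -[LHS]/(vfun (times id u2) z - a k *: vfun u2 z).
rewrite timesE// -scalerBl timesE// timesE// timesE// !scalerA /P big_cons.
by congr (_ *: _); ring.
Qed.

(** The semi inner product [phi(|u><v|)] on vector functions is invariant under
multiplication by [z], whose inverse on the circle is multiplication by the
conjugate of [z].  It reproduces [<pi f h, k>] on the pair of vector functions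
[f h] and [k], which is the dilation identity. *)
Theorem dilation_exists : exists (K : hilbertType R) (J : H -> K) (U : K -> K),
  [/\ isometric_embedding J, unitary U &
      forall i j, admissible N i j -> forall h,
        J (pi (mono c a i j) h) =
        orth_proj (range J) (iter j U (iter i (blaschke_op c a U) (J h)))].
Proof.
have [phi [phiD phiZ phi0 phiG]] := positive_functional_exists.
pose s (u v : vector_function H) : C := complexify phi (rank_one_form u v).
have hs : semi_inner s.
  split=> [d u v w|u v|u].
  - rewrite -complexifyZ//; last exact: rank_one_dominated.
    rewrite -complexifyD//; [|exact/dominatedZ/rank_one_dominated|exact: rank_one_dominated].
    congr complexify; apply/funext => p; rewrite /rank_one_form.
    rewrite -[vfun (d *: u + v) _]/(d *: vfun u p.1 + vfun v p.1).
    by rewrite (si_linear hH) mulrDl mulrA.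
  - rewrite -complexify_conj//; last exact: rank_one_dominated.
    congr complexify; apply/funext => p; rewrite /rank_one_form.
    by rewrite rmorphM /= -!(si_conj hH) mulrC.
  - apply: complexify_ge0 => // [|z x]; first exact: rank_one_dominated.
    by rewrite /rank_one_form /= (si_conj hH (vfun u z) x) mul_conjC_ge0.
have idb : disc_bounded (id : C -> C) := poly_limit_bounded (@poly_limit_id R).
have conjb : disc_bounded (fun z : C => z^*).
  by exists 1; split=> // z z1; rewrite rnorm_conj.
have circ z : (circle z)^* * circle z = 1 by rewrite mulrC rnorm1_conj ?rnorm_circle.
have [|||K [e [U [eL es hU Ue]]]] := @hilbert_completion R _ s
    (times id) (times (fun z => z^*)) hs.
- by move=> u; apply: vfunP => z; rewrite !timesE// scalerA circ scale1r.
- by move=> u; apply: vfunP => z; rewrite !timesE// scalerA mulrC circ scale1r.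
- move=> u v; congr complexify; apply/funext => p; rewrite /rank_one_form.
  by rewrite !timesE// (siZl hH) (siZr hH) conjCK mulrCA mulrA.
pose J h := e (constant h).
have dilate i j h k : admissible N i j ->
    s (times (mono c a i j) (constant h)) (constant k) = ip (pi (mono c a i j) h) k.
  move=> ij; have := phiG [:: (mono c a i j, h, k)].
  rewrite /tensor_value big_seq1 => <-; last first.
    by move=> t; rewrite inE => /eqP ->; exact: mono_span_gen.
  congr complexify; apply/funext => p.
  rewrite /rank_one_form /circle_form /tensor_form big_seq1 timesE.
    by rewrite (siZl hH) mulrA.
  exact: mono_span_bounded ha _ (mono_span_gen _ _ ij).
have hJ : isometric_embedding J.
  split=> [d x y|x y].
    rewrite /J -eL; congr e; exact: vfunP.
  rewrite es; have := @dilate 0%N 0%N x y isT.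
  have m00 : mono c a 0 0 = cst 1.
    by apply/funext => z; rewrite /mono !expr0 mulr1.
  rewrite m00 (repr_one hpi) => <-; congr (s _ _); apply: vfunP => z.
  by rewrite timesE ?scale1r//; exact: disc_bounded_cst.
exists K, J, U; split=> // i j ij h.
have Bb : disc_bounded B := poly_limit_bounded (poly_limit_blaschke c ha).
have monob i' j' : disc_bounded (mono c a i' j').
  exact: poly_limit_bounded (poly_limit_mono _ ha _ _).
have -> : iter j U (iter i (blaschke_op c a U) (J h)) =
    e (times (mono c a i j) (constant h)).
  elim: j {ij} => [|j IH].
    elim: i => [|i IH].
      by congr e; apply: vfunP => z; rewrite timesE// /mono !expr0 mul1r scale1r.
    rewrite /= in IH *; rewrite IH blaschke_op_times//; congr e.
    apply: vfunP => z.
    by rewrite !timesE// scalerA /mono !mul1r exprS.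
  rewrite iterS IH Ue; congr e; apply: vfunP => z.
  by rewrite !timesE// scalerA /mono exprS mulrA.
apply/esym; apply: (orth_proj_eq hJ) => [|k]; first by eexists.
rewrite (siBl (ip_semi_inner K)) hJ.2 es dilate//; exact: subrr.
Qed.

End functional.
End dilation_construction.

Theorem theorem7p2 (R : realType) (N : nat) (hN : (2 <= N)%N)
    (c : R[i]) (a : 'I_N -> R[i]) (hc : `|c| = 1) (ha : forall k, `|a k| < 1)
    (H : hilbertType R) (pi : (R[i] -> R[i]) -> H -> H)
    (hpi : unital_representation (alg_B0 (blaschke c a)) pi) :
  completely_contractive (alg_B0 (blaschke c a)) pi <->
  exists (K : hilbertType R) (J : H -> K) (U : K -> K),
    [/\ isometric_embedding J, unitary U &
        forall i j : nat,
          ((1 <= i)%N /\ (i <= N - 2)%N /\ (j <= i)%N) \/ i = (N - 1)%N ->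
          forall h : H,
            J (pi (fun z => z ^+ j * blaschke c a z ^+ i) h) =
            orth_proj (range J) (iter j U (iter i (blaschke_op c a U) (J h)))].
Proof.
split=> [hcc|[K [J [U [hJ hU hdil]]]]].
  have [K [J [U [hJ hU hdil]]]] := dilation_exists hN hc ha hpi hcc.
  exists K, J, U; split=> // i j ij; apply: hdil.
  rewrite /admissible; case: ij => [[_ [-> ->]]//|->].
  by rewrite subn1 eqxx orbT.
have [J' hJ'] := adjoint_exists hJ.
exact: dilation_completely_contractive hN hc ha _ _ hpi _ _ _ hJ hU hdil _ hJ'.
Qed.
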